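(* Let $M$ be a smooth manifold of dimension $n\geq 2$, let $\nabla$ be a torsion-free linear connection on $TM$, let $\nu:T^*M\to M$ be the cotangent bundle, let $\tau\in\Omega^1(T^*M)$ be the tautological one-form, let $h_0$ be the Patterson--Walker metric of $\nabla$ on $T^*M$, and let $\boldsymbol{\mathsf{P}}^p$ be the projective Schouten tensor of $\nabla$. Then $$h_0-\nu^*(\operatorname{Sym}\boldsymbol{\mathsf{P}}^p)-\tau\otimes\tau$$ is an Einstein metric on $T^*M$, which together with $\Omega=-\mathrm{d}\tau+\nu^*(\operatorname{Alt}\boldsymbol{\mathsf{P}}^p)$ defines an almost para-Kähler structure on $T^*M$. Moreover, projectively equivalent connections lead to isometric metrics: if $\nabla$ and $\nabla'$ are projectively equivalent torsion-free connections on $TM$, then the metrics on $T^*M$ obtained in this way from $\nabla$ and from $\nabla'$ are isometric.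
   Context: All manifolds and maps are $C^\infty$. Conventions: for a $\binom{0}{2}$-tensor $b$, $\operatorname{Sym} b(X,Y)=\frac12(b(X,Y)+b(Y,X))$ and $\operatorname{Alt} b(X,Y)=\frac12(b(X,Y)-b(Y,X))$. For one-forms, $\alpha\odot\beta=\operatorname{Sym}(\alpha\otimes\beta)$ and $\alpha\wedge\beta=\operatorname{Alt}(\alpha\otimes\beta)$, so that, viewed as a bilinear form, $\mathrm{d}\tau(X,Y)=\frac12\big(X\tau(Y)-Y\tau(X)-\tau([X,Y])\big)$. Tautological form: $\tau_\alpha(v)=\alpha(\nu'_\alpha(v))$ for $\alpha\in T^*M$, $v\in T_\alpha T^*M$, where $\nu'_\alpha$ is the derivative of $\nu$ at $\alpha$. Patterson--Walker metric: in canonical coordinates $(x^i,\xi_i)$ on $T^*M$ induced by local coordinates $(x^i)$ on $M$, with $\Gamma^k_{ij}$ the Christoffel symbols of $\nabla$, $h_0=(\mathrm{d}\xi_i-\Gamma^k_{ij}\xi_k\,\mathrm{d}x^j)\odot \mathrm{d}x^i$ (summation convention). This is globally well defined and has signature $(n,n)$. Curvature: $R^\nabla(X,Y)(Z)=\nabla_X\nabla_YZ-\nabla_Y\nabla_XZ-\nabla_{[X,Y]}Z$ and $\mathrm{Ric}(\nabla)(X,Y)=\operatorname{tr}\big(Z\mapsto R^\nabla(Z,X)(Y)\big)$. The projective Schouten tensor is $$\boldsymbol{\mathsf{P}}^p=\tfrac{1}{n-1}\operatorname{Sym}\mathrm{Ric}(\nabla)+\tfrac{1}{n+1}\operatorname{Alt}\mathrm{Ric}(\nabla).$$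 Two torsion-free connections on $TM$ are projectively equivalent if they have the same geodesics up to parametrization. An almost para-Kähler structure on a $2n$-manifold $N$ consists of a pseudo-Riemannian metric $h$ of signature $(n,n)$ and a symplectic form $\Omega$ such that the endomorphism $I:TN\to TN$ defined by $\Omega=h(\cdot,I\cdot)$ satisfies $I^2=\mathrm{Id}_{TN}$. A pseudo-Riemannian metric $h$ is Einstein if $\mathrm{Ric}(h)=\lambda h$ for a constant $\lambda$. *)

(* Defs.v *)
From HB Require Import structures.
From mathcomp Require Import all_boot all_order all_algebra.
From mathcomp Require Import all_classical all_reals all_analysis.
Set Implicit Arguments.
Unset Strict Implicit.
Unset Printing Implicit Defensive.
Import Order.TTheory GRing.Theory Num.Theory.
Import numFieldNormedType.Exports.
Local Open Scope classical_set_scope.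
Local Open Scope ring_scope.

(* Smooth manifolds are presented by atlases on a set of points; the topology
   is the one determined by the charts. As no dependent type of tangent spaces
   is available, every point p comes with a preferred chart [pref p] around it,
   and the tangent space T_pM is the space 'rV[R]_n of components with respect
   to that chart; the components in any other chart around p are obtained with
   the Jacobian of the change of charts ([tcomp], [tvec] below). Likewise T*_pM
   is 'rV[R]_n, paired with T_pM by the dot product. The preferred charts need
   not depend continuously on the point, so that smoothness of fields is always
   read in a fixed chart. *)

Section Smooth.
Context {R : realType} {V W : normedModType R}.

(* V is meant to be finite dimensional and U open. *)
Fixpoint Ck (k : nat) (U : set V) (f : V -> W) : Prop :=
  match k with
  | 0 => forall x, U x -> {for x, continuous f}
  | k'.+1 => (forall x, U x -> differentiable f x) /\
             (forall v : V, Ck k' U ('D_v f))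
  end.

Definition smooth (U : set V) (f : V -> W) := forall k, Ck k U f.

End Smooth.

Record atlas (R : realType) (n : nat) := Atlas {
  pt :> Type;
  chart : Type;
  cdom : chart -> set pt;
  cmap : chart -> pt -> 'rV[R]_n;
  cmapV : chart -> 'rV[R]_n -> pt;
  pref : pt -> chart
}.

Section Manifold.
Context {R : realType} {n : nat}.
Variable M : atlas R n.

Definition mopen (A : set M) :=
  forall a : chart M, open (cmap a @` (cdom a `&` A)).

Record smooth_manifold : Prop := SmoothManifold {
  pref_cdom : forall p : M, cdom (pref p) p;
  cmapK : forall (a : chart M) (p : M), cdom a p -> cmapV a (cmap a p) = p;
  overlap_open : forall a b : chart M, open (cmap a @` (cdom a `&` cdom b));
  transition_smooth : forall a b : chart M,
    smooth (cmap a @` (cdom a `&` cdom b)) (@cmap R n M b \o cmapV a);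
  hausdorff_axiom : forall p q : M, p <> q ->
    exists A B : set M, [/\ mopen A, mopen B, A p, B q & A `&` B = set0];
  second_countable_axiom : exists B : nat -> set M,
    (forall k, mopen (B k)) /\
    (forall (A : set M) (p : M), mopen A -> A p ->
       exists k, B k p /\ B k `<=` A)
}.

(* Components in the chart a of a tangent vector v at p, and conversely the
   tangent vector at p with components w in the chart a. *)
Definition tcomp (a : chart M) (p : M) (v : 'rV[R]_n) : 'rV[R]_n :=
  'd (@cmap R n M a \o cmapV (pref p)) (cmap (pref p) p) v.

Definition tvec (a : chart M) (p : M) (w : 'rV[R]_n) : 'rV[R]_n :=
  'd (@cmap R n M (pref p) \o cmapV a) (cmap a p) w.

(* coordinate vector field of the chart a, defined on cdom a *)
Definition dd (a : chart M) (k : 'I_n) (p : M) : 'rV[R]_n :=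
  tvec a p (delta_mx 0 k).

Definition vfield := M -> 'rV[R]_n.
Definition oneform := M -> 'rV[R]_n -> R.
Definition tensor2 := M -> 'rV[R]_n -> 'rV[R]_n -> R.

Definition smooth_fun_on (A : set M) (f : M -> R) :=
  forall a : chart M, smooth (cmap a @` (cdom a `&` A)) (f \o cmapV a).

Definition smooth_vf_on (A : set M) (X : vfield) :=
  forall a : chart M, smooth (cmap a @` (cdom a `&` A))
    (fun x => tcomp a (cmapV a x) (X (cmapV a x))).

Definition smooth_fun_near (p : M) (f : M -> R) :=
  exists A, [/\ mopen A, A p & smooth_fun_on A f].

Definition smooth_vf_near (p : M) (X : vfield) :=
  exists A, [/\ mopen A, A p & smooth_vf_on A X].

Definition smooth_tensor2 (b : tensor2) :=
  [/\ forall p u, scalar (b p u),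
      forall p v, scalar (b p ^~ v) &
      forall (a : chart M) (i j : 'I_n),
        smooth (cmap a @` cdom a)
          ((fun p => b p (dd a i p) (dd a j p)) \o cmapV a)].

(* derivative of a function along a tangent vector v at p *)
Definition vder {W : normedModType R} (f : M -> W) (p : M) (v : 'rV[R]_n) : W :=
  'D_v (f \o cmapV (pref p)) (cmap (pref p) p).

(* [X, Y]^k = X(Y^k) - Y(X^k), in the preferred chart at p *)
Definition bracket (X Y : vfield) : vfield := fun p =>
  vder (fun q => tcomp (pref p) q (Y q)) p (X p)
  - vder (fun q => tcomp (pref p) q (X q)) p (Y p).

(* A vector field near p with value v at p. Tensors given by a formula in
   vector fields are evaluated on tangent vectors by means of this extension. *)
Definition extend (p : M) (v : 'rV[R]_n) : vfield := fun q => tvec (pref p) q v.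

Definition Sym2 (b : tensor2) : tensor2 := fun p u v =>
  2^-1 * (b p u v + b p v u).
Definition Alt2 (b : tensor2) : tensor2 := fun p u v =>
  2^-1 * (b p u v - b p v u).
Definition tens (s t : oneform) : tensor2 := fun p u v => s p u * t p v.
Definition odot (s t : oneform) : tensor2 := Sym2 (tens s t).

Definition extd1 (t : oneform) : tensor2 := fun p u v =>
  let X := extend p u in let Y := extend p v in
  2^-1 * (vder (fun q => t q (Y q)) p (X p) - vder (fun q => t q (X q)) p (Y p)
          - t p (bracket X Y p)).

Definition extd2 (w : tensor2) (X Y Z : vfield) (p : M) : R :=
  3^-1 * (vder (fun q => w q (Y q) (Z q)) p (X p)
        + vder (fun q => w q (Z q) (X q)) p (Y p)
        + vder (fun q => w q (X q) (Y q)) p (Z p)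
        - w p (bracket X Y p) (Z p)
        - w p (bracket Y Z p) (X p)
        - w p (bracket Z X p) (Y p)).

Definition nondegenerate2 (b : tensor2) :=
  forall p u, (forall v, b p u v = 0) -> u = 0.

Definition symplectic (w : tensor2) :=
  [/\ smooth_tensor2 w,
      forall p u v, w p u v = - w p v u,
      nondegenerate2 w &
      forall p X Y Z, smooth_vf_near p X -> smooth_vf_near p Y ->
        smooth_vf_near p Z -> extd2 w X Y Z p = 0].

Definition pseudo_riemannian (h : tensor2) :=
  [/\ smooth_manifold, smooth_tensor2 h,
      forall p u v, h p u v = h p v u & nondegenerate2 h].

(* Linear connections on TM, as covariant derivatives of locally defined
   smooth vector fields. Locality is a consequence of [nablaM], in which f
   may be the indicator function of a neighbourhood of p. *)
Record connection := Connection {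
  nabla : forall p : M, 'rV[R]_n -> vfield -> 'rV[R]_n;
  nabla_linear : forall p Y, smooth_vf_near p Y -> linear (nabla p ^~ Y);
  nablaD : forall p u Y Z, smooth_vf_near p Y -> smooth_vf_near p Z ->
    nabla p u (fun q => Y q + Z q) = nabla p u Y + nabla p u Z;
  nablaM : forall p u f Y, smooth_fun_near p f -> smooth_vf_near p Y ->
    nabla p u (fun q => f q *: Y q) = vder f p u *: Y p + f p *: nabla p u Y;
  nabla_smooth : forall A X Y, mopen A -> smooth_vf_on A X ->
    smooth_vf_on A Y -> smooth_vf_on A (fun p => nabla p (X p) Y)
}.

Section Connection.
Variable D : connection.

Definition cov (X Y : vfield) : vfield := fun p => nabla D p (X p) Y.

Definition torsion_free := forall p X Y,
  smooth_vf_near p X -> smooth_vf_near p Y ->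
  cov X Y p - cov Y X p = bracket X Y p.

Definition curvature (X Y Z : vfield) : vfield := fun p =>
  cov X (cov Y Z) p - cov Y (cov X Z) p - cov (bracket X Y) Z p.

Definition Ric : tensor2 := fun p u v =>
  \tr (lin1_mx (fun z => curvature (extend p z) (extend p u) (extend p v) p)).

Definition schouten : tensor2 := fun p u v =>
  (n%:R - 1)^-1 * Sym2 Ric p u v + (n%:R + 1)^-1 * Alt2 Ric p u v.

(* Christoffel symbol Gamma^k_ij at p in the chart a *)
Definition christoffel (a : chart M) (p : M) (i j k : 'I_n) : R :=
  tcomp a p (nabla D p (dd a i p) (dd a j)) 0 k.

Definition smooth_curve (I : set R) (c : R -> M) :=
  forall a : chart M, open (I `&` (c @^-1` cdom a)) /\
    smooth (I `&` (c @^-1` cdom a)) (@cmap R n M a \o c).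

(* Affinely parametrized geodesics; c is only meaningful on the open interval
   I. The last condition is the equation nabla_c' c' = 0. *)
Definition geodesic (I : set R) (c : R -> M) :=
  [/\ open I, is_interval I, smooth_curve I c &
      forall (a : chart M) (t : R), I t -> cdom a (c t) ->
        let x := @cmap R n M a \o c in
        forall k : 'I_n,
          (derive1 (derive1 x) t) 0 k
          + \sum_(i < n) \sum_(j < n)
              christoffel a (c t) i j k * (derive1 x t) 0 i * (derive1 x t) 0 j = 0].

Definition levi_civita (h : tensor2) :=
  torsion_free /\
  forall p u Y Z, smooth_vf_near p Y -> smooth_vf_near p Z ->
    vder (fun q => h q (Y q) (Z q)) p u
    = h p (nabla D p u Y) (Z p) + h p (Y p) (nabla D p u Z).

End Connection.

Definition einstein (h : tensor2) :=
  pseudo_riemannian h /\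
  exists D : connection, levi_civita D h /\
    exists lambda : R, forall p u v, Ric D p u v = lambda * h p u v.

(* For intervals J and I, phi is then a diffeomorphism from J onto I. *)
Definition reparametrization (J I : set R) (phi : R -> R) :=
  [/\ smooth J phi, phi @` J = I & forall t, J t -> derive1 phi t != 0].

Definition geodesics_in (D D' : connection) := forall (I : set R) (c : R -> M),
  geodesic D I c -> exists (J : set R) (phi : R -> R),
    reparametrization J I phi /\ geodesic D' J (c \o phi).

Definition projectively_equivalent (D D' : connection) :=
  geodesics_in D D' /\ geodesics_in D' D.

End Manifold.

Section Maps.
Context {R : realType} {m n : nat} {M : atlas R m} {N : atlas R n}.

Definition smooth_map (f : M -> N) :=
  forall (a : chart M) (b : chart N),
    open (cmap a @` (cdom a `&` (f @^-1` cdom b))) /\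
    smooth (cmap a @` (cdom a `&` (f @^-1` cdom b)))
           (@cmap R n N b \o f \o cmapV a).

Definition tangent_map (f : M -> N) (p : M) (v : 'rV[R]_m) : 'rV[R]_n :=
  'd (@cmap R n N (pref (f p)) \o f \o cmapV (pref p)) (cmap (pref p) p) v.

Definition pullback2 (f : M -> N) (b : tensor2 N) : tensor2 M := fun p u v =>
  b (f p) (tangent_map f p u) (tangent_map f p v).

End Maps.

Definition isometric {R : realType} {m n : nat} {M : atlas R m} {N : atlas R n}
    (h : tensor2 M) (h' : tensor2 N) :=
  exists f : M -> N, exists g : N -> M,
    [/\ smooth_map f, smooth_map g, cancel f g, cancel g f &
        forall p u v, h p u v = pullback2 f h' p u v].

Section ParaKaehler.
Context {R : realType} {n : nat} (N : atlas R (n + n)).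

(* In a suitable basis of T_pN, the rows of B, the Gram matrix of h is
   diag(1, .., 1, -1, .., -1), with n entries of each sign. *)
Definition neutral_signature (h : tensor2 N) := forall p : N,
  exists B : 'M[R]_(n + n), B \in unitmx /\
    \matrix_(i, j) h p (row i B) (row j B)
    = block_mx 1%:M 0 0 (- 1%:M) :> 'M[R]_(n + n).

Definition almost_para_kaehler (h w : tensor2 N) :=
  [/\ pseudo_riemannian h, neutral_signature h, symplectic w &
      exists I : N -> 'M[R]_(n + n),
        (forall p u v, w p u v = h p u (v *m I p)) /\
        (forall p, I p *m I p = 1%:M)].

End ParaKaehler.

Section Cotangent.
Context {R : realType} {n : nat} (M : atlas R n).

(* value of a covector on a tangent vector *)
Definition ev (xi v : 'rV[R]_n) : R := (xi *m v^T) 0 0.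

(* components of a covector xi at p in the chart a, and conversely *)
Definition ccomp (a : chart M) (p : M) (xi : 'rV[R]_n) : 'rV[R]_n :=
  \row_k ev xi (dd a k p).
Definition covec (a : chart M) (p : M) (y : 'rV[R]_n) : 'rV[R]_n :=
  \row_k ev y (tcomp a p (delta_mx 0 k)).

(* T*M with the canonical coordinates (x^i, xi_i) induced by the charts of M *)
Definition cotangent : atlas R (n + n) := {|
  pt := (M * 'rV[R]_n)%type;
  chart := chart M;
  cdom := fun a => [set z | cdom a z.1];
  cmap := fun a z => row_mx (cmap a z.1) (ccomp a z.1 z.2);
  cmapV := fun a y => let p := cmapV a (lsubmx y) in (p, covec a p (rsubmx y));
  pref := fun z => pref z.1 |}.

Definition nu : cotangent -> M := fst.

Definition tau : oneform cotangent := fun z v =>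
  ev z.2 (tangent_map nu z v).

Definition dx (a : chart M) (i : 'I_n) : oneform cotangent := fun z v =>
  lsubmx (@tcomp R (n + n) cotangent a z v) 0 i.
Definition dxi (a : chart M) (i : 'I_n) : oneform cotangent := fun z v =>
  rsubmx (@tcomp R (n + n) cotangent a z v) 0 i.

Definition patterson_walker_in (D : connection M) (a : chart M) :
    tensor2 cotangent := fun z u v =>
  \sum_(i < n) odot
    (fun z' w => dxi a i z' w - \sum_(j < n) \sum_(k < n)
       christoffel D a z'.1 i j k * ccomp a z'.1 z'.2 0 k * dx a j z' w)
    (dx a i) z u v.

(* The formula does not depend on the chart around z.1. *)
Definition patterson_walker (D : connection M) : tensor2 cotangent :=
  fun z => patterson_walker_in D (pref z.1) z.

Definition einstein_cot (D : connection M) : tensor2 cotangent := fun z u v =>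
  patterson_walker D z u v - pullback2 nu (Sym2 (schouten D)) z u v
  - tens tau tau z u v.

Definition Omega_cot (D : connection M) : tensor2 cotangent := fun z u v =>
  - extd1 tau z u v + pullback2 nu (Alt2 (schouten D)) z u v.

End Cotangent.

(* Main.v *)
From HB Require Import structures.
Require Import Defs.
From mathcomp Require Import all_boot all_order all_algebra.
From mathcomp Require Import all_classical all_reals all_analysis.
From mathcomp Require Import ring lra.
Set Implicit Arguments.
Unset Strict Implicit.
Unset Printing Implicit Defensive.
Import Order.TTheory GRing.Theory Num.Theory.
Import numFieldNormedType.Exports.
Local Open Scope classical_set_scope.
Local Open Scope ring_scope.

(** In canonical coordinates (x, xi) of the cotangent bundle the metric is
    h((u, a), (v, b)) = (a(v) + b(u))/2 - xi(Gamma(u, v)) - P(u, v) - xi(u) xi(v) with P the symmetrized Schouten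
    tensor. Its Levi-Civita connection is explicit, and tracing its curvature gives Ric(h) = -2 (n + 1) h.
    The two-form is closed because the alternating part of the Ricci tensor is the differential of the trace of
    Gamma up to a factor, and the endomorphism I is block triangular with diagonal blocks -1 and 1.
    For the isometry, if nabla' has the geodesics of nabla up to parametrization, then the difference tensor B
    satisfies B(v, v) || v, since there is a geodesic in every direction (Picard iteration); so
    B(u, v) = Y(u) v + Y(v) u for a smooth one-form Y (Weyl), and the fibre translation xi |-> xi - Y pulls the
    metric of nabla' back to that of nabla, by the transformation rule of the Schouten tensor. *)

(** Everything global is compared through chart expressions, and the obstacle is the Hessian of the
    transition maps, which enters derivatives of fields, Christoffel terms and the fibre coordinates
    of the cotangent bundle alike. For the connection on the cotangent bundle the transformation law
    is not computed: two torsion-free connections compatible with one metric agree, so the local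
    solutions of the Koszul formula glue by themselves. The constant -2(n + 1) can be read off the
    pairing (a(v) + b(u))/2: the divergence of the connection contributes -(n + 1)(a(v) + b(u)),
    with n from a multiple of the identity and 1 from a rank-one map. The factor 1/(n - 1) of the
    Schouten tensor then gives the horizontal part the same ratio. The translation by Y is an
    isometry because the Schouten tensor changes by -Sym(nabla Y) + Y(u) Y(v): the first term is
    offset by the differential of the translation, while the products of xi and Y coming from Gamma
    cancel against those of the square of the tautological form. *)

Section NearEq.
Context {R : realType} {V W : normedModType R}.

(** Chart expressions are controlled only on open sets, so differentiability has to pass along
    germs. The differential of f serves for g because the two remainders coincide near 0. *)
Lemma near_eq_diff (f g : V -> W) (x : V) :
  {near x, f =1 g} -> differentiable f x ->
  differentiable g x.
Proof.
move=> fg df.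
have fgx : f x = g x by exact: (nbhs_singleton fg).
have dfc := diff_continuous df.
suff gE : g \o shift x = cst (g x) + 'd f x +o_ (0 : V) id.
  have dE : 'd g x = 'd f x :> (V -> W) by apply: diff_unique.
  by apply/diff_locallyP; rewrite dE.
apply/eqaddoP => e e0.
have := diff_locally df; move/eqaddoP => /(_ e e0) h.
have fg0 : \forall h \near (0 : V), f (h + x) = g (h + x).
  have h0 : (h + x) @[h --> (0 : V)] --> x.
    by rewrite -[X in _ --> X]add0r; apply: cvgD; [exact: cvg_id | exact: cvg_cst].
  exact: h0 _ fg.
near=> y.
have -> : (g \o shift x - (cst (g x) + 'd f x)) y = (f \o shift x - (cst (f x) + 'd f x)) y.
  rewrite !fctE /= /shift /= fgx; congr (_ - _).
  by rewrite (near fg0 y).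
by near: y.
Unshelve. all: by end_near. Qed.

Lemma open_near (U : set V) (P : V -> Prop) x :
  open U -> U x -> (forall y, U y -> P y) -> \forall y \near x, P y.
Proof. by move=> oU Ux UP; apply: filterS (open_nbhs_nbhs (conj oU Ux)). Qed.

(** [Ck] forms ['D_v f] as a function on the whole space but tests it on U only. As U is open,
    equality on U passes to the derivatives on U, and values outside U never matter. *)
Lemma Ck_eq k (U : set V) (f g : V -> W) : open U ->
  (forall x, U x -> f x = g x) -> Ck k U f -> Ck k U g.
Proof.
move=> oU; elim: k f g => [|k IH] f g fg /=.
  move=> cf x Ux; rewrite /prop_for /continuous_at -fg //.
  apply: cvg_trans (cf _ Ux); apply: near_eq_cvg.
  by apply: (open_near oU Ux) => y /fg.
move=> [df Df]; split=> [x Ux|v].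
  by apply: near_eq_diff (df _ Ux); apply: (open_near oU Ux).
apply: IH (Df v) => x Ux.
by apply: near_eq_derive; apply: (open_near oU Ux).
Qed.

Lemma Ck_sub k (U U' : set V) (f : V -> W) : U' `<=` U -> Ck k U f -> Ck k U' f.
Proof.
move=> UU'; elim: k f => [|k IH] f /=; first by move=> cf x /UU' /cf.
by move=> [df Df]; split=> [x /UU'/df //|v]; apply: IH.
Qed.

Lemma CkS k (U : set V) (f : V -> W) : Ck k.+1 U f -> Ck k U f.
Proof.
elim: k f => [|k IH] f; first by case=> df _ x /df; apply: differentiable_continuous.
by case=> df Df; split=> // v; apply: IH.
Qed.

Lemma Ck_cst k (U : set V) (w : W) : Ck k U (fun=> w).
Proof.
elim: k w => [|k IH] w /=; first by move=> x _; exact: cst_continuous.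
split=> [x _|v]; first exact: differentiable_cst.
rewrite (_ : 'D_v _ = fun=> 0) //.
by apply/funext => x; rewrite derive_cst.
Qed.

Lemma CkD k (U : set V) (f g : V -> W) : open U ->
  Ck k U f -> Ck k U g -> Ck k U (fun x => f x + g x).
Proof.
move=> oU; elim: k f g => [|k IH] f g /=.
  by move=> cf cg x Ux; apply: continuousD; [exact: cf | exact: cg].
move=> [df Df] [dg Dg]; split=> [x Ux|v].
  by apply: differentiableD; [exact: df | exact: dg].
apply: (Ck_eq oU _ (IH _ _ (Df v) (Dg v))) => x Ux /=.
by rewrite -deriveD //; apply: diff_derivable; [exact: df | exact: dg].
Qed.

Lemma Ck_sum k (U : set V) (I : Type) (r : seq I) (f : I -> V -> W) : open U ->
  (forall i, Ck k U (f i)) -> Ck k U (fun x => \sum_(i <- r) f i x).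
Proof.
move=> oU Cf; elim: r => [|i r IH].
  by apply: (Ck_eq oU _ (Ck_cst k U 0)) => x _; rewrite big_nil.
by apply: (Ck_eq oU _ (CkD oU (Cf i) IH)) => x _; rewrite big_cons.
Qed.

End NearEq.

Lemma derive_lin {R : realType} {V W X : normedModType R} (L : {linear W -> X})
  (f : V -> W) x v : continuous L -> differentiable f x ->
  'D_v (fun y => L (f y)) x = L ('D_v f x).
Proof.
move=> cL df.
have dL : differentiable L (f x) by exact: linear_differentiable.
rewrite deriveE; last exact: (differentiable_comp df dL).
rewrite (_ : (fun y => L (f y)) = L \o f) // diff_comp //= diff_lin //.
by rewrite deriveE.
Qed.

Lemma Ck_lin {R : realType} {V W X : normedModType R} k (U : set V)
    (L : {linear W -> X}) (f : V -> W) : open U ->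
  continuous L -> Ck k U f -> Ck k U (fun x => L (f x)).
Proof.
move=> oU cL; elim: k f => [|k IH] f /=.
  by move=> cf x Ux; apply: continuous_comp; [exact: cf | exact: cL].
move=> [df Df]; split=> [x Ux|v].
  apply: (differentiable_comp (df _ Ux)); exact: linear_differentiable.
apply: (Ck_eq oU _ (IH _ (Df v))) => x Ux.
by rewrite derive_lin //; exact: df.
Qed.

(** * Smooth functions on normed spaces *)

Section Ck_scalar.
Context {R : realType} {V : normedModType R}.

Lemma CkM k (U : set V) (f g : V -> R) : open U ->
  Ck k U f -> Ck k U g -> Ck k U (fun x => f x * g x).
Proof.
move=> oU; elim: k f g => [|k IH] f g.
  by move=> cf cg x Ux; apply: continuousM; [exact: cf | exact: cg].
move=> Cf Cg; have [df Df] := Cf; have [dg Dg] := Cg; split=> [x Ux|v].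
  by apply: differentiableM; [exact: df | exact: dg].
have C1 := IH _ _ (CkS Cf) (Dg v); have C2 := IH _ _ (CkS Cg) (Df v).
apply: (Ck_eq oU _ (CkD oU C1 C2)) => x Ux /=.
by rewrite -[RHS]/('D_v (f * g) x) deriveM //; apply: diff_derivable; [exact: df | exact: dg].
Qed.

Lemma Ck_scalel {W : normedModType R} k (U : set V) (f : V -> R) (w : W) : open U ->
  Ck k U f -> Ck k U (fun x => f x *: w).
Proof.
move=> oU Cf.
have L : linear (fun r : R => r *: w) by move=> a x y; rewrite scalerDl scalerA.
pose L' := HB.pack (fun r : R => r *: w) (GRing.isLinear.Build _ _ _ _ _ L) : {linear R -> W}.
apply: (@Ck_lin _ _ _ _ k U L' f) => //.
by move=> r; apply: scalel_continuous.
Qed.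

Lemma Ck_rV k (U : set V) m (f : V -> 'rV[R]_m) : open U ->
  (forall j, Ck k U (fun x => f x 0 j)) -> Ck k U f.
Proof.
move=> oU Cf.
have C := fun j : 'I_m => Ck_scalel (delta_mx 0 j : 'rV[R]_m) oU (Cf j).
apply: (Ck_eq oU _ (Ck_sum (index_enum 'I_m) oU C)) => x Ux.
by rewrite -row_sum_delta.
Qed.

Lemma coord_continuous_rV m (j : 'I_m) : continuous (fun u : 'rV[R]_m => u 0 j).
Proof. exact: coord_continuous. Qed.

Lemma Ck_coord k (U : set V) m (f : V -> 'rV[R]_m) j : open U ->
  Ck k U f -> Ck k U (fun x => f x 0 j).
Proof.
move=> oU Cf.
have L : linear (fun u : 'rV[R]_m => u 0 j : R^o) by move=> a x y; rewrite !mxE.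
pose L' := HB.pack (fun u : 'rV[R]_m => u 0 j) (GRing.isLinear.Build _ _ _ _ _ L) : {linear 'rV[R]_m -> R^o}.
apply: (@Ck_lin _ _ _ _ k U L' f) => //.
exact: coord_continuous_rV.
Qed.

End Ck_scalar.

Section Chain.
Context {R : realType} {V : normedModType R}.

Lemma derive_chain {W X : normedModType R} (f : V -> W) (g : W -> X) x v :
  differentiable f x -> differentiable g (f x) ->
  'D_v (fun y => g (f y)) x = 'D_('D_v f x) g (f x).
Proof.
move=> df dg; rewrite deriveE; last exact: (differentiable_comp df dg).
rewrite (_ : (fun y => g (f y)) = g \o f) // diff_comp //=.
by rewrite (deriveE _ dg) (deriveE _ df).
Qed.

Lemma derive_dir_lin {X : normedModType R} (g : V -> X) y :
  differentiable g y -> forall a u v, 'D_(a *: u + v) g y = a *: 'D_u g y + 'D_v g y.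
Proof. by move=> dg a u v; rewrite !deriveE // linearP. Qed.

Lemma derive_coord m (f : V -> 'rV[R]_m) x v j : differentiable f x ->
  'D_v (fun y => f y 0 j) x = ('D_v f x) 0 j.
Proof.
by move=> df; rewrite derive_mx ?mxE //; exact: diff_derivable.
Qed.

Lemma diff_coord m (f : V -> 'rV[R]_m) x j : differentiable f x ->
  differentiable (fun y => f y 0 j) x.
Proof.
move=> df; apply: (@differentiable_comp _ _ _ _ f (fun u : 'rV[R]_m => u 0 j)) => //.
exact: differentiable_coord.
Qed.

Lemma diff_sum {W : normedModType R} (I : Type) (r : seq I) (f : I -> V -> W) x :
  (forall i, differentiable (f i) x) -> differentiable (fun y => \sum_(i <- r) f i y) x.
Proof.
move=> df; elim: r => [|i r IH].
  rewrite (_ : (fun y => _) = fun=> 0); last by apply/funext => y; rewrite big_nil.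
  exact: differentiable_cst.
rewrite (_ : (fun y => _) = (f i : V -> W) + (fun y => \sum_(i <- r) f i y)).
  exact: differentiableD.
by apply/funext => y; rewrite big_cons.
Qed.

Lemma derive_bigsum {W : normedModType R} (I : Type) (r : seq I) (f : I -> V -> W) x v :
  (forall i, differentiable (f i) x) ->
  'D_v (fun y => \sum_(i <- r) f i y) x = \sum_(i <- r) 'D_v (f i) x.
Proof.
move=> df; elim: r => [|i r IH].
  rewrite (_ : (fun y => _) = fun=> 0); last by apply/funext => y; rewrite big_nil.
  by rewrite derive_cst big_nil.
rewrite (_ : (fun y => _) = (f i : V -> W) + (fun y => \sum_(i <- r) f i y)).
  rewrite deriveD ?IH ?big_cons //; apply: diff_derivable => //; exact: diff_sum.
by apply/funext => y; rewrite big_cons.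
Qed.

Lemma diff_rV m (f : V -> 'rV[R]_m) x :
  (forall j, differentiable (fun y => f y 0 j) x) -> differentiable f x.
Proof.
move=> df; rewrite (_ : f = fun y => \sum_j f y 0 j *: delta_mx 0 j).
  by apply: diff_sum => j; apply: differentiableZl.
by apply/funext => y; rewrite -row_sum_delta.
Qed.

Lemma derive_rV m (f : V -> 'rV[R]_m) x v :
  differentiable f x -> 'D_v f x = \row_j 'D_v (fun y => f y 0 j) x.
Proof. by move=> df; apply/rowP => j; rewrite mxE derive_coord. Qed.

Lemma derive_mul (f g : V -> R) x v : differentiable f x -> differentiable g x ->
  'D_v (fun y => f y * g y) x = 'D_v f x * g x + f x * 'D_v g x.
Proof.
move=> df dg; rewrite -[LHS]/('D_v (f * g) x) deriveM; try exact: diff_derivable.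
by rewrite addrC mulrC.
Qed.

Lemma diff_mul (f g : V -> R) x : differentiable f x -> differentiable g x ->
  differentiable (fun y => f y * g y) x.
Proof. exact: differentiableM. Qed.

Lemma derive_add {W : normedModType R} (f g : V -> W) x v : differentiable f x -> differentiable g x ->
  'D_v (fun y => f y + g y) x = 'D_v f x + 'D_v g x.
Proof. by move=> df dg; rewrite -deriveD //; exact: diff_derivable. Qed.

Lemma derive_opp {W : normedModType R} (f : V -> W) x v : differentiable f x ->
  'D_v (fun y => - f y) x = - 'D_v f x.
Proof. by move=> df; rewrite -deriveN //; exact: diff_derivable. Qed.

Lemma derive_sub {W : normedModType R} (f g : V -> W) x v : differentiable f x -> differentiable g x ->
  'D_v (fun y => f y - g y) x = 'D_v f x - 'D_v g x.
Proof. by move=> df dg; rewrite -deriveB //; exact: diff_derivable. Qed.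

Lemma derive_scale {W : normedModType R} (c : R) (f : V -> W) x v : differentiable f x ->
  'D_v (fun y => c *: f y) x = c *: 'D_v f x.
Proof. by move=> df; rewrite -deriveZ //; exact: diff_derivable. Qed.

End Chain.

(** * Families of linear maps depending on a point *)

Section Pointwise.
Context {R : realType} {V : normedModType R}.

(** A bare predicate instead of a bundled linear map: most maps below, such as a Christoffel term at
    x, are linear only for x in a chart image. *)
Definition lin {U W : lmodType R} (f : U -> W) := forall a u v, f (a *: u + v) = a *: f u + f v.

Lemma lin0 {U W : lmodType R} (f : U -> W) : lin f -> f 0 = 0.
Proof. by move=> /(_ (-1) 0 0); rewrite scaleN1r addNr scaleN1r addNr. Qed.

Lemma linD {U W : lmodType R} (f : U -> W) : lin f -> forall u v, f (u + v) = f u + f v.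
Proof. by move=> lf u v; have := lf 1 u v; rewrite !scale1r. Qed.

Lemma linZ {U W : lmodType R} (f : U -> W) : lin f -> forall a u, f (a *: u) = a *: f u.
Proof. by move=> lf a u; have := lf a u 0; rewrite !addr0 (lin0 lf) addr0. Qed.

Lemma linN {U W : lmodType R} (f : U -> W) : lin f -> forall u, f (- u) = - f u.
Proof. by move=> lf u; rewrite -scaleN1r linZ // scaleN1r. Qed.

Lemma linB {U W : lmodType R} (f : U -> W) : lin f -> forall u v, f (u - v) = f u - f v.
Proof. by move=> lf u v; rewrite linD // linN. Qed.

Lemma lin_sum {U W : lmodType R} (f : U -> W) (I : Type) (r : seq I) (g : I -> U) : lin f ->
  f (\sum_(i <- r) g i) = \sum_(i <- r) f (g i).
Proof.
move=> lf; elim: r => [|i r IH]; first by rewrite !big_nil lin0.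
by rewrite !big_cons linD // IH.
Qed.

Lemma lin_row m {W : lmodType R} (f : 'rV[R]_m -> W) u : lin f ->
  f u = \sum_j u 0 j *: f (delta_mx 0 j).
Proof.
move=> lf; rewrite {1}[u]row_sum_delta lin_sum //.
by apply: eq_bigr => j _; rewrite linZ.
Qed.

Lemma diff_lin_app m (l : V -> 'rV[R]_m -> R) (f : V -> 'rV[R]_m) x :
  (\forall y \near x, lin (l y)) ->
  (forall i, differentiable (fun y => l y (delta_mx 0 i)) x) ->
  differentiable f x -> differentiable (fun y => l y (f y)) x.
Proof.
move=> ll dl df.
apply: (@near_eq_diff _ _ _ (fun y => \sum_i f y 0 i * l y (delta_mx 0 i))).
  by near=> y; rewrite /= [RHS]lin_row //; near: y.
by apply: diff_sum => i; apply: diff_mul => //; apply: diff_coord.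
Unshelve. all: by end_near. Qed.

(** Leibniz rule for a moving linear map applied to a moving vector, with linearity required only
    near x. Jacobians and Christoffel terms occur in this form. *)
Lemma derive_lin_app m (l : V -> 'rV[R]_m -> R) (f : V -> 'rV[R]_m) x w :
  (\forall y \near x, lin (l y)) ->
  (forall i, differentiable (fun y => l y (delta_mx 0 i)) x) ->
  differentiable f x ->
  'D_w (fun y => l y (f y)) x = 'D_w (fun y => l y (f x)) x + l x ('D_w f x).
Proof.
move=> ll dl df.
have E (g : V -> 'rV[R]_m) : differentiable g x -> 'D_w (fun y => l y (g y)) x
    = \sum_i (g x 0 i * 'D_w (fun y => l y (delta_mx 0 i)) x
              + 'D_w g x 0 i * l x (delta_mx 0 i)).
  move=> dg; transitivity ('D_w (fun y => \sum_i g y 0 i * l y (delta_mx 0 i)) x).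
    by apply: near_eq_derive; near=> y; rewrite [LHS]lin_row //; near: y.
  rewrite derive_bigsum => [|i]; last by apply: diff_mul => //; apply: diff_coord.
  apply: eq_bigr => i _; rewrite derive_mul //; last exact: diff_coord.
  by rewrite derive_coord // addrC.
(* The expansion [E] for the constant map with value [f x] is the first term on the right; the terms
   by which the two expansions differ make up the second. *)
have dc : differentiable (fun=> f x : 'rV[R]_m) x by exact: differentiable_cst.
rewrite (E _ df) (E _ dc).
have lx : lin (l x) by apply: (nbhs_singleton ll).
rewrite (lin_row _ lx) -big_split /=; apply: eq_bigr => i _.
by rewrite derive_cst mxE mul0r addr0.
Unshelve. all: by end_near. Qed.

Lemma diff_lin_app_rV m p (l : V -> 'rV[R]_m -> 'rV[R]_p) (f : V -> 'rV[R]_m) x :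
  (\forall y \near x, lin (l y)) ->
  (forall i, differentiable (fun y => l y (delta_mx 0 i)) x) ->
  differentiable f x -> differentiable (fun y => l y (f y)) x.
Proof.
move=> ll dl df; apply: diff_rV => j.
apply: (@diff_lin_app _ (fun y u => l y u 0 j)) => //.
  by near=> y; move=> a u v; rewrite (near ll y) // !mxE.
by move=> i; apply: (diff_coord j (dl i)).
Unshelve. all: by end_near. Qed.

Lemma derive_lin_app_rV m p (l : V -> 'rV[R]_m -> 'rV[R]_p) (f : V -> 'rV[R]_m) x w :
  (\forall y \near x, lin (l y)) ->
  (forall i, differentiable (fun y => l y (delta_mx 0 i)) x) ->
  differentiable f x ->
  'D_w (fun y => l y (f y)) x = 'D_w (fun y => l y (f x)) x + l x ('D_w f x).
Proof.
move=> ll dl df; apply/rowP => j; rewrite [in RHS]mxE.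
rewrite -derive_coord; last exact: diff_lin_app_rV.
rewrite -derive_coord; last by apply: diff_lin_app_rV => //; exact: differentiable_cst.
apply: (@derive_lin_app _ (fun y u => l y u 0 j)) => //.
  by near=> y; move=> a u v; rewrite (near ll y) // !mxE.
by move=> i; apply: (diff_coord j (dl i)).
Unshelve. all: by end_near. Qed.

End Pointwise.

Section CkComp.
Context {R : realType} {V : normedModType R}.

Lemma derive_dir_sum m {W : normedModType R} (g : 'rV[R]_m -> W) y v : differentiable g y ->
  'D_v g y = \sum_j v 0 j *: 'D_(delta_mx 0 j) g y.
Proof. by move=> dg; apply: (@lin_row R m W (fun w => 'D_w g y)); apply: derive_dir_lin. Qed.

(** Induction on k through the chain rule in coordinates: the derivative of the composite is a
    finite sum of coordinates of ['D_v f] times partial derivatives of g along f, in fixed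
    directions, and both factors are of class k. *)
Lemma Ck_comp k (U : set V) m (U' : set 'rV[R]_m) (f : V -> 'rV[R]_m) (g : 'rV[R]_m -> R) :
  open U -> Ck k U f -> Ck k U' g -> (forall x, U x -> U' (f x)) ->
  Ck k U (fun x => g (f x)).
Proof.
move=> oU; elim: k f g => [|k IH] f g.
  by move=> cf cg UU' x Ux; apply: continuous_comp; [exact: cf | apply: cg; exact: UU'].
move=> Cf Cg UU'; have [df Df] := Cf; have [dg Dg] := Cg; split=> [x Ux|v].
  by apply: (differentiable_comp (df _ Ux)); apply: dg; apply: UU'.
have C1 := fun j : 'I_m => CkM oU (Ck_coord j oU (Df v)) (IH _ _ (CkS Cf) (Dg (delta_mx 0 j)) UU').
apply: (Ck_eq oU _ (Ck_sum (index_enum 'I_m) oU C1)) => x Ux /=.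
have dfx := df _ Ux; have dgx := dg _ (UU' _ Ux).
by rewrite (derive_chain _ dfx dgx) (derive_dir_sum _ dgx).
Qed.

Lemma Ck_comp_rV k (U : set V) m p (U' : set 'rV[R]_m) (f : V -> 'rV[R]_m) (g : 'rV[R]_m -> 'rV[R]_p) :
  open U -> open U' -> Ck k U f -> Ck k U' g -> (forall x, U x -> U' (f x)) ->
  Ck k U (fun x => g (f x)).
Proof.
move=> oU oU' Cf Cg UU'; apply: Ck_rV => // j.
by apply: (Ck_comp oU Cf (Ck_coord j oU' Cg)).
Qed.

End CkComp.

(** * Symmetry of second derivatives *)

Section Schwarz.
Context {R : realType} {V : normedModType R}.

Lemma diff_add {W : normedModType R} (f g : V -> W) x : differentiable f x -> differentiable g x ->
  differentiable (fun y => f y + g y) x.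
Proof. exact: differentiableD. Qed.

Lemma diff_opp {W : normedModType R} (f : V -> W) x : differentiable f x ->
  differentiable (fun y => - f y) x.
Proof. exact: differentiableN. Qed.

Lemma diff_sub {W : normedModType R} (f g : V -> W) x : differentiable f x -> differentiable g x ->
  differentiable (fun y => f y - g y) x.
Proof. by move=> df dg; apply: diff_add => //; apply: diff_opp. Qed.

Lemma diff_id (x : V) : differentiable (fun y : V => y) x.
Proof. exact: (@ex_diff _ _ _ _ _ id id). Qed.

Lemma diff_line (y u : V) (s : R) : differentiable (fun t : R => y + t *: u) s.
Proof.
apply: differentiableD; first exact: differentiable_cst.
by apply: differentiableZl; exact: (@ex_diff _ _ _ _ _ id id).
Qed.

Lemma derive_line (y u : V) (s : R) : 'D_1 (fun t : R => y + t *: u) s = u.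
Proof.
have dl : differentiable (fun t : R => t *: u) s.
  by apply: differentiableZl; exact: (@ex_diff _ _ _ _ _ id id).
rewrite derive_add //.
rewrite derive_cst add0r deriveE // (_ : (fun t : R => t *: u) = ( *:%R^~ u)) //.
have /= -> := @diff_val _ _ _ _ _ _ _ (is_diff_scalel s u).
by rewrite scale1r.
Qed.

Lemma is_derive_line {W : normedModType R} (f : V -> W) (y u : V) (s : R) :
  differentiable f (y + s *: u) ->
  is_derive s 1 (fun t : R => f (y + t *: u)) ('D_u f (y + s *: u)).
Proof.
move=> df; have dl := diff_line y u s.
apply: DeriveDef.
  by apply: diff_derivable; apply: (@differentiable_comp _ _ _ _ (fun t : R => y + t *: u)).
by rewrite (@derive_chain R R V W _ f s 1 dl df) derive_line.
Qed.

Lemma MVT_line (f : V -> R) (y u : V) (h : R) : 0 < h ->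
  (forall s, 0 <= s <= h -> differentiable f (y + s *: u)) ->
  exists2 s, 0 <= s <= h & f (y + h *: u) - f y = 'D_u f (y + s *: u) * h.
Proof.
move=> h0 df.
have H s : s \in `[0, h] -> is_derive s 1 (fun t : R => f (y + t *: u)) ('D_u f (y + s *: u)).
  by rewrite in_itv /= => /df; apply: is_derive_line.
pose g : R -> R := fun t : R => f (y + t *: u).
pose dg : R -> R := fun s => 'D_u f (y + s *: u).
have dgP x : x \in `]0, h[ -> is_derive x 1 g (dg x).
  by move=> xI; apply: H; apply: subset_itv_oo_cc.
have cg : {within `[0, h], continuous g}.
  by by apply: derivable_within_continuous => s /H [].
have [s] := MVT h0 dgP cg.
rewrite in_itv /= subr0 /g /dg scale0r addr0 => /andP[s0 sh] E.
by exists s => //; rewrite !ltW.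
Qed.

(** The second difference is the increment along u of z |-> f(h v + z) - f z. One mean value theorem
    along u and one along v turn it into a mixed derivative at an intermediate point. *)
Lemma second_difference (f : V -> R) (x u v : V) (h : R) : 0 < h ->
  (forall s t, 0 <= s <= h -> 0 <= t <= h -> differentiable f (x + s *: u + t *: v) /\
      differentiable ('D_u f) (x + s *: u + t *: v)) ->
  exists s t, [/\ 0 <= s <= h, 0 <= t <= h &
   f (x + h *: u + h *: v) - f (x + h *: u) - f (x + h *: v) + f x =
   'D_v ('D_u f) (x + s *: u + t *: v) * h * h].
Proof.
move=> h0 df.
have hh : 0 <= h <= h by rewrite lexx ltW.
have h00 : 0 <= (0 : R) <= h by rewrite lexx ltW.
pose g (z : V) := f (h *: v + z) - f z.
have dg s : 0 <= s <= h -> differentiable (fun z => f (h *: v + z)) (x + s *: u) /\ differentiable f (x + s *: u).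
  move=> sh; have [d1 _] := df _ _ sh hh; have [d0 _] := df _ _ sh h00.
  rewrite scale0r addr0 in d0; split => //.
  rewrite addrC in d1.
  have dz : differentiable (fun z => h *: v + z) (x + s *: u).
    by apply: diff_add; [exact: differentiable_cst | exact: diff_id].
  exact: (differentiable_comp dz d1).
have [s sh E1] : exists2 s, 0 <= s <= h & g (x + h *: u) - g x = 'D_u g (x + s *: u) * h.
  by apply: MVT_line => // s sh; have [d1 d2] := dg _ sh; apply: diff_sub.
have dsh t : 0 <= t <= h -> differentiable ('D_u f) (x + s *: u + t *: v).
  by move=> th; have [_] := df _ _ sh th.
have [t th E2] := MVT_line h0 dsh.
exists s, t; split => //.
rewrite -E2.
have -> : 'D_u f (x + s *: u + h *: v) - 'D_u f (x + s *: u) = 'D_u g (x + s *: u).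
  have [d1 d2] := dg _ sh; rewrite /g derive_sub //; congr (_ - _).
  have [d3 _] := df _ _ sh hh; rewrite addrC in d3.
  have di : differentiable (fun z : V => z) (x + s *: u) by exact: (@ex_diff _ _ _ _ _ id id).
  have dz : differentiable (fun z => h *: v + z) (x + s *: u).
    by apply: diff_add; [exact: differentiable_cst | exact: diff_id].
  rewrite (derive_chain u dz d3) [RHS](_ : _ = 'D_u f (h *: v + (x + s *: u))) 1?addrC //.
  rewrite derive_add //.
  by rewrite derive_cst add0r derive_id.
rewrite -E1 /g.
rewrite ![h *: v + _]addrC; ring.
Qed.

(** The second difference over a small parallelogram is symmetric in u and v, so the two mixed
    derivatives share a value, at two points near x. If they differed at x, continuity would keep
    them apart there. *)
Lemma schwarz_Ck (U : set V) (f : V -> R) (x u v : V) : open U -> U x -> Ck 2 U f ->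
  'D_u ('D_v f) x = 'D_v ('D_u f) x.
Proof.
move=> oU Ux [df Df].
have cuv : {for x, continuous ('D_u ('D_v f))} by apply: (Df v).2.
have cvu : {for x, continuous ('D_v ('D_u f))} by apply: (Df u).2.
have tri (a b c d : R) : `|a - c| < `|a - b| / 3 -> `|b - d| < `|a - b| / 3 -> c <> d.
  move=> ac bd cd; rewrite -cd in bd.
  have : `|a - b| <= `|a - c| + `|b - c|.
    by rewrite (distrC b); apply: le_trans (ler_normD _ _); rewrite addrA subrK.
  have := normr_ge0 (a - b); lra.
pose a : R := 'D_u ('D_v f) x; pose b : R := 'D_v ('D_u f) x.
suff : ~ 0 < `|a - b|.
  by move=> /negP; rewrite -leNgt normr_le0 subr_eq0 => /eqP.
move=> e0.
have e3 : 0 < `|a - b| / 3 by rewrite divr_gt0.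
have n1 : \forall y \near x, `|a - 'D_u ('D_v f) y| < `|a - b| / 3.
  by move/cvgrPdist_lt : cuv => /(_ _ e3).
have n2 : \forall y \near x, `|b - 'D_v ('D_u f) y| < `|a - b| / 3.
  by move/cvgrPdist_lt : cvu => /(_ _ e3).
have nU : \forall y \near x, U y by exact: (open_near oU Ux (fun y Uy => Uy)).
have nA := filterI nU (filterI n1 n2); have [r /= r0 rx] := (nbhs_ballP x _).1 (nA _ _).
(* This side keeps the whole parallelogram inside the ball of radius r; the summand 1 covers the
   case u = v = 0. *)
pose h := r / (`|u| + `|v| + 1).
have d0 : 0 < `|u| + `|v| + 1 by rewrite ltr_wpDl // addr_ge0.
have h0 : 0 < h by rewrite divr_gt0.
have inb s t : 0 <= s <= h -> 0 <= t <= h -> ball x r (x + s *: u + t *: v).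
  move=> /andP[s0 sh] /andP[t0 th]; rewrite -ball_normE /ball_ /= -addrA opprD addrA subrr add0r normrN.
  apply: (le_lt_trans (ler_normD _ _)); rewrite !normrZ !ger0_norm //.
  apply: (@le_lt_trans _ _ (h * `|u| + h * `|v|)); first by rewrite lerD // ler_wpM2r.
  by rewrite -mulrDr /h mulrAC ltr_pdivrMr // ltr_pM2l // ltrDl ltr01.
have [s [t [sh th E1]]] : exists s t, [/\ 0 <= s <= h, 0 <= t <= h &
   f (x + h *: u + h *: v) - f (x + h *: u) - f (x + h *: v) + f x =
   'D_v ('D_u f) (x + s *: u + t *: v) * h * h].
  apply: second_difference => // s t sh th; have [/= Uy _] := rx _ (inb _ _ sh th).
  by split; [exact: df | exact: (Df u).1].
have [t' [s' [th' sh' E2]]] : exists t s, [/\ 0 <= t <= h, 0 <= s <= h &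
   f (x + h *: v + h *: u) - f (x + h *: v) - f (x + h *: u) + f x =
   'D_u ('D_v f) (x + t *: v + s *: u) * h * h].
  apply: second_difference => // s' t' sh' th'.
  have := inb _ _ th' sh'; rewrite -addrA [t' *: _ + _]addrC addrA => /rx [/= Uy _].
  by split; [exact: df | exact: (Df v).1].
have E : 'D_v ('D_u f) (x + s *: u + t *: v) = 'D_u ('D_v f) (x + t' *: v + s' *: u).
  apply: (mulIf (lt0r_neq0 h0)); apply: (mulIf (lt0r_neq0 h0)).
  apply: etrans (esym E1) (etrans _ E2); rewrite [x + h *: v + h *: u]addrAC; congr (_ + _); exact: addrAC.
have [_ [_ /= b2]] := rx _ (inb _ _ sh th).
have := inb _ _ sh' th'; rewrite -addrA [_ *: u + _]addrC addrA => /rx [_ [/= b1 _]].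
exact: (tri _ _ _ _ b1 b2 (esym E)).
Qed.

End Schwarz.

Section Smooth_lemmas.
Context {R : realType} {V : normedModType R}.
Implicit Types U : set V.

Lemma smooth_eq {W : normedModType R} U (f g : V -> W) : open U ->
  (forall x, U x -> f x = g x) -> smooth U f -> smooth U g.
Proof. by move=> oU fg sf k; apply: (Ck_eq oU fg (sf k)). Qed.

Lemma smooth_sub {W : normedModType R} U U' (f : V -> W) : U' `<=` U -> smooth U f -> smooth U' f.
Proof. by move=> UU' sf k; apply: (Ck_sub UU' (sf k)). Qed.

Lemma smooth_cst {W : normedModType R} U (w : W) : smooth U (fun=> w).
Proof. by move=> k; apply: Ck_cst. Qed.

Lemma smoothD {W : normedModType R} U (f g : V -> W) : open U ->
  smooth U f -> smooth U g -> smooth U (fun x => f x + g x).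
Proof. by move=> oU sf sg k; apply: CkD. Qed.

Lemma smooth_sum {W : normedModType R} U (I : Type) (r : seq I) (f : I -> V -> W) : open U ->
  (forall i, smooth U (f i)) -> smooth U (fun x => \sum_(i <- r) f i x).
Proof. by move=> oU sf k; apply: Ck_sum => // i; apply: sf. Qed.

Lemma smoothM U (f g : V -> R) : open U ->
  smooth U f -> smooth U g -> smooth U (fun x => f x * g x).
Proof. by move=> oU sf sg k; apply: CkM. Qed.

Lemma smoothZl {W : normedModType R} U (f : V -> R) (w : W) : open U ->
  smooth U f -> smooth U (fun x => f x *: w).
Proof. by move=> oU sf k; apply: Ck_scalel. Qed.

Lemma smooth_rV U m (f : V -> 'rV[R]_m) : open U ->
  (forall j, smooth U (fun x => f x 0 j)) -> smooth U f.
Proof. by move=> oU sf k; apply: Ck_rV => // j; apply: sf. Qed.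

Lemma smooth_coord U m (f : V -> 'rV[R]_m) j : open U ->
  smooth U f -> smooth U (fun x => f x 0 j).
Proof. by move=> oU sf k; apply: Ck_coord. Qed.

Lemma smoothZ U (c : R) (f : V -> R) : open U ->
  smooth U f -> smooth U (fun x => c * f x).
Proof. by move=> oU; apply: smoothM => //; apply: smooth_cst. Qed.

Lemma smoothN U (f : V -> R) : open U -> smooth U f -> smooth U (fun x => - f x).
Proof. by move=> oU sf; apply: (smooth_eq oU _ (smoothZ (-1) oU sf)) => x _; rewrite mulN1r. Qed.

Lemma smoothB U (f g : V -> R) : open U ->
  smooth U f -> smooth U g -> smooth U (fun x => f x - g x).
Proof. by move=> oU sf sg; apply: smoothD => //; apply: smoothN. Qed.

Lemma smooth_D {W : normedModType R} U (f : V -> W) v : smooth U f -> smooth U ('D_v f).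
Proof. by move=> sf k; have [_ Df] := sf k.+1; exact: Df. Qed.

Lemma smooth_diff {W : normedModType R} U (f : V -> W) x : smooth U f -> U x -> differentiable f x.
Proof. by move=> sf Ux; have [df _] := sf 1; exact: df. Qed.

Lemma smooth_comp U m (U' : set 'rV[R]_m) (f : V -> 'rV[R]_m) (g : 'rV[R]_m -> R) :
  open U -> smooth U f -> smooth U' g -> (forall x, U x -> U' (f x)) ->
  smooth U (fun x => g (f x)).
Proof. by move=> oU sf sg UU' k; apply: (Ck_comp oU (sf k) (sg k)). Qed.

Lemma smooth_comp_rV U m p (U' : set 'rV[R]_m) (f : V -> 'rV[R]_m) (g : 'rV[R]_m -> 'rV[R]_p) :
  open U -> open U' -> smooth U f -> smooth U' g -> (forall x, U x -> U' (f x)) ->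
  smooth U (fun x => g (f x)).
Proof. by move=> oU oU' sf sg UU' k; apply: (Ck_comp_rV oU oU' (sf k) (sg k)). Qed.

Lemma smooth_id U : open U -> smooth U (fun x => x).
Proof.
move=> oU [|k] /=; first by move=> x _; exact: cvg_id.
split=> [x _|v]; first exact: (@ex_diff _ _ _ _ _ id id).
by apply: (Ck_eq oU _ (Ck_cst k U v)) => x _; rewrite derive_id.
Qed.

Lemma schwarz U (f : V -> R) x u v : open U -> U x -> smooth U f ->
  'D_u ('D_v f) x = 'D_v ('D_u f) x.
Proof. by move=> oU Ux sf; apply: (schwarz_Ck _ _ oU Ux (sf 2)). Qed.

Lemma schwarz_rV m U (f : V -> 'rV[R]_m) x u v : open U -> U x -> smooth U f ->
  'D_u ('D_v f) x = 'D_v ('D_u f) x.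
Proof.
move=> oU Ux sf.
have D2 w w' : 'D_w ('D_w' f) x = \row_j 'D_w ('D_w' (fun y => f y 0 j)) x.
  rewrite derive_rV; last exact: (smooth_diff (smooth_D w' sf)).
  apply/rowP => j; rewrite !mxE; apply: near_eq_derive.
  by apply: (open_near oU Ux) => y Uy; rewrite derive_coord //; exact: (smooth_diff sf).
apply: etrans (D2 u v) (etrans _ (esym (D2 v u))); apply/rowP => j.
apply: etrans (mxE _ _ _ _) (etrans _ (esym (mxE _ _ _ _))).
exact: (schwarz _ _ oU Ux (smooth_coord j oU sf)).
Qed.

End Smooth_lemmas.

Section Smooth_linear.
Context {R : realType} {m : nat}.

Lemma smooth_lin {W : normedModType R} (U : set 'rV[R]_m) (f : 'rV[R]_m -> W) : open U ->
  lin f -> smooth U f.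
Proof.
move=> oU lf; have c (j : 'I_m) : smooth U (fun u : 'rV[R]_m => u 0 j).
  by apply: smooth_coord => //; apply: smooth_id.
have s (j : 'I_m) := smoothZl (f (delta_mx 0 j)) oU (c j).
apply: (smooth_eq oU _ (smooth_sum (index_enum 'I_m) oU s)) => x _.
by rewrite -lin_row.
Qed.

Lemma diff_of_lin {W : normedModType R} (f : 'rV[R]_m -> W) x : lin f -> differentiable f x.
Proof. by move=> lf; apply: (smooth_diff (smooth_lin openT lf)). Qed.

Lemma derive_of_lin {W : normedModType R} (f : 'rV[R]_m -> W) x v : lin f -> 'D_v f x = f v.
Proof.
move=> lf; have df := diff_of_lin x lf.
rewrite [RHS](_ : _ = 'D_1 (fun t : R => f (x + t *: v)) 0); last first.
  have dc : differentiable (fun t : R => f x + t *: f v) 0 by exact: diff_line.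
  rewrite (_ : (fun t => _) = fun t => f x + t *: f v) ?derive_line //.
  by apply/funext => t; rewrite linD // linZ.
have : differentiable f (x + 0 *: v) by rewrite scale0r addr0.
by move/is_derive_line => -[_ ->]; rewrite scale0r addr0.
Qed.

End Smooth_linear.

Lemma subr_add2l (V : zmodType) (x y z : V) : x + y - (x + z) = y - z.
Proof. by rewrite opprD addrACA subrr add0r. Qed.

(** * Tensor calculus in charts *)

Section Charts.
Context {R : realType} {n : nat} {M : atlas R n}.
Hypothesis HM : smooth_manifold M.
Implicit Types (a b c : chart M) (p q : M).

Definition im a : set 'rV[R]_n := @cmap R n M a @` cdom a.
Definition ovl a b : set 'rV[R]_n := @cmap R n M a @` (cdom a `&` cdom b).
Definition phi a b : 'rV[R]_n -> 'rV[R]_n := fun x => cmap b (cmapV a x).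
(** Written with ['D_v] so that its own derivatives in x are again directional derivatives of a
    smooth map, namely [hess]. *)
Definition jac a b (x v : 'rV[R]_n) : 'rV[R]_n := 'D_v (phi a b) x.
Definition vloc a (Y : vfield M) (x : 'rV[R]_n) : 'rV[R]_n :=
  tcomp a (cmapV a x) (Y (cmapV a x)).

Lemma ovl_open a b : open (ovl a b). Proof. exact: overlap_open. Qed.

Arguments ovl_open : clear implicits.

Lemma im_open a : open (im a).
Proof. by have := ovl_open a a; rewrite /ovl setIid. Qed.

Lemma phi_smooth a b : smooth (ovl a b) (phi a b).
Proof. exact: transition_smooth. Qed.

Arguments im_open : clear implicits.
Arguments phi_smooth : clear implicits.

Lemma ovlP a b p : cdom a p -> cdom b p -> ovl a b (cmap a p).
Proof. by move=> pa pb; exists p. Qed.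

Lemma imP a p : cdom a p -> im a (cmap a p). Proof. by move=> pa; exists p. Qed.

Lemma cmapVP a x : im a x -> cdom a (cmapV a x) /\ cmap a (cmapV a x) = x.
Proof. by move=> [p pa <-]; rewrite (cmapK HM pa). Qed.

Lemma phi_cmap a b p : cdom a p -> phi a b (cmap a p) = cmap b p.
Proof. by move=> pa; rewrite /phi (cmapK HM pa). Qed.

Lemma phi_diff a b p : cdom a p -> cdom b p -> differentiable (phi a b) (cmap a p).
Proof. by move=> pa pb; apply: (smooth_diff (phi_smooth a b)); exact: ovlP. Qed.

Lemma jac_lin a b p : cdom a p -> cdom b p -> lin (jac a b (cmap a p)).
Proof. by move=> pa pb; apply: derive_dir_lin; apply: phi_diff. Qed.

Lemma jac_id a p v : cdom a p -> jac a a (cmap a p) v = v.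
Proof.
move=> pa; rewrite /jac -[RHS](derive_id (cmap a p) v); apply: near_eq_derive.
by apply: (open_near (im_open a) (imP pa)) => y /cmapVP[].
Qed.

Lemma jac_chain a b c p v : cdom a p -> cdom b p -> cdom c p ->
  jac b c (cmap b p) (jac a b (cmap a p) v) = jac a c (cmap a p) v.
Proof.
move=> pa pb pc; rewrite /jac -{1}(phi_cmap b pa).
have d1 := phi_diff pa pb.
have d2 : differentiable (phi b c) (phi a b (cmap a p)) by rewrite phi_cmap //; exact: phi_diff.
rewrite -(derive_chain v d1 d2); apply: near_eq_derive.
apply: (open_near (ovl_open a b) (ovlP pa pb)) => _ [q [qa qb] <-].
by rewrite !phi_cmap.
Qed.

Lemma tcompE a p v : cdom a p -> tcomp a p v = jac (pref p) a (cmap (pref p) p) v.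
Proof. by move=> pa; rewrite /jac deriveE //; apply: phi_diff => //; exact: pref_cdom. Qed.

Lemma tvecE a p v : cdom a p -> tvec a p v = jac a (pref p) (cmap a p) v.
Proof. by move=> pa; rewrite /jac deriveE //; apply: phi_diff => //; exact: pref_cdom. Qed.

Lemma tcomp_tvec_jac a b p v : cdom a p -> cdom b p -> tcomp b p (tvec a p v) = jac a b (cmap a p) v.
Proof. by move=> pa pb; rewrite tcompE // tvecE // jac_chain //; exact: pref_cdom. Qed.

Lemma tcomp_tvec a p v : cdom a p -> tcomp a p (tvec a p v) = v.
Proof. by move=> pa; rewrite tcomp_tvec_jac // jac_id. Qed.

Lemma tvec_tcomp a p v : cdom a p -> tvec a p (tcomp a p v) = v.
Proof.
move=> pa; have pp := pref_cdom HM p.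
by rewrite tvecE // tcompE // jac_chain // jac_id.
Qed.

Lemma tcomp_pref p v : tcomp (pref p) p v = v.
Proof. by have pp := pref_cdom HM p; rewrite tcompE // jac_id. Qed.

Lemma tvec_pref p v : tvec (pref p) p v = v.
Proof. by have pp := pref_cdom HM p; rewrite tvecE // jac_id. Qed.

Lemma tcomp_change a b p v : cdom a p -> cdom b p ->
  tcomp b p v = jac a b (cmap a p) (tcomp a p v).
Proof. by move=> pa pb; rewrite -tcomp_tvec_jac // tvec_tcomp. Qed.

Lemma tcomp_lin a p : cdom a p -> lin (tcomp a p).
Proof. by move=> pa k u v; rewrite !tcompE // jac_lin //; exact: pref_cdom. Qed.

Lemma tvec_lin a p : cdom a p -> lin (tvec a p).
Proof. by move=> pa k u v; rewrite !tvecE // jac_lin //; exact: pref_cdom. Qed.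

Lemma vloc_cmap a Y p : cdom a p -> vloc a Y (cmap a p) = tcomp a p (Y p).
Proof. by move=> pa; rewrite /vloc (cmapK HM pa). Qed.

Lemma cdom_mopen a : mopen (cdom a). Proof. by move=> b; exact: ovl_open. Qed.

Arguments cdom_mopen : clear implicits.

Lemma near_mopen a p (A : set M) : mopen A -> A p -> cdom a p ->
  \forall x \near cmap a p, [/\ im a x, cdom a (cmapV a x) & A (cmapV a x)].
Proof.
move=> oA Ap pa; apply: (@open_near _ _ _ _ _ (oA a)); first by exists p.
by move=> _ [q [qa qA] <-]; rewrite (cmapK HM qa); split=> //; exact: imP.
Qed.

Lemma tvec_field_smooth a v : smooth_vf_on (cdom a) (fun q => tvec a q v).
Proof.
move=> b; have s1 := phi_smooth b a.
have s2 : smooth (ovl a b) (fun x => jac a b x v) := smooth_D v (phi_smooth a b).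
apply: (smooth_eq (ovl_open b a) _ (smooth_comp_rV (ovl_open b a) (ovl_open a b) s1 s2 _)).
  by move=> _ [q [qb qa] <-]; rewrite (cmapK HM qb) phi_cmap // tcomp_tvec_jac.
by move=> _ [q [qb qa] <-]; rewrite phi_cmap //; exact: ovlP.
Qed.

Arguments tvec_field_smooth : clear implicits.

Lemma tvec_field_near a v p : cdom a p -> smooth_vf_near p (fun q => tvec a q v).
Proof. by move=> pa; exists (cdom a); split=> //; [exact: cdom_mopen | exact: tvec_field_smooth]. Qed.

Lemma extend_near p v : smooth_vf_near p (extend p v).
Proof. by apply: tvec_field_near; exact: pref_cdom. Qed.

Lemma vloc_smooth a p Y : cdom a p -> smooth_vf_near p Y ->
  exists U, [/\ open U, U (cmap a p), U `<=` im a,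
     (forall x, U x -> smooth_vf_near (cmapV a x) Y) & smooth U (vloc a Y)].
Proof.
move=> pa [A [oA Ap sY]]; exists (cmap a @` (cdom a `&` A)); split.
- exact: (oA a).
- by exists p.
- by move=> _ [q [qa _] <-]; exact: imP.
- by move=> _ [q [qa qA] <-]; rewrite (cmapK HM qa); exists A.
- exact: sY.
Qed.

Lemma vloc_diff a p Y : cdom a p -> smooth_vf_near p Y -> differentiable (vloc a Y) (cmap a p).
Proof. by move=> pa /(vloc_smooth pa)[U [_ Up _ _ sY]]; exact: (smooth_diff sY). Qed.

Lemma near_transition a b p : cdom a p -> cdom b p ->
  \forall x \near cmap a p, [/\ cdom a (cmapV a x), cdom b (cmapV a x) & cmapV a x = cmapV b (phi a b x)].
Proof.
move=> pa pb; apply: (open_near (ovl_open a b) (ovlP pa pb)) => _ [q [qa qb] <-].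
by rewrite phi_cmap // !(cmapK HM _).
Qed.

(** [vder] is defined in the preferred chart of p; the chain rule through the transition map moves
    it to any other chart. *)
Lemma vder_loc {W : normedModType R} a p (f : M -> W) u : cdom a p ->
  differentiable (fun x => f (cmapV a x)) (cmap a p) ->
  vder f p u = 'D_(tcomp a p u) (fun x => f (cmapV a x)) (cmap a p).
Proof.
move=> pa df; have pp := pref_cdom HM p.
have d1 := phi_diff pp pa.
have d2 : differentiable (fun x => f (cmapV a x)) (phi (pref p) a (cmap (pref p) p)) by rewrite phi_cmap.
rewrite (tcompE _ pa) /jac -(phi_cmap a pp) -(@derive_chain _ _ _ _ (phi (pref p) a) (fun x => f (cmapV a x)) _ u d1 d2).
apply: near_eq_derive; apply: filterS (near_transition pp pa) => x [_ _ E] /=.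
by rewrite {1}E.
Qed.

Lemma vloc_tvec a v x : im a x -> vloc a (fun q => tvec a q v) x = v.
Proof. by move=> /cmapVP[xa _]; rewrite /vloc tcomp_tvec. Qed.

Lemma tcomp_inj a p u v : cdom a p -> tcomp a p u = tcomp a p v -> u = v.
Proof. by move=> pa E; rewrite -(tvec_tcomp u pa) E tvec_tcomp. Qed.

Lemma bracket_pref X Y p : bracket X Y p =
  'D_(X p) (vloc (pref p) Y) (cmap (pref p) p) - 'D_(Y p) (vloc (pref p) X) (cmap (pref p) p).
Proof. by []. Qed.

Definition hess a b x (u v : 'rV[R]_n) := 'D_u (fun y => jac a b y v) x.

Lemma hess_sym a b p u v : cdom a p -> cdom b p -> hess a b (cmap a p) u v = hess a b (cmap a p) v u.
Proof.
by move=> pa pb; apply: (schwarz_rV _ _ (ovl_open a b) (ovlP pa pb) (phi_smooth a b)).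
Qed.

Lemma jac_diff a b p v : cdom a p -> cdom b p -> differentiable (fun y => jac a b y v) (cmap a p).
Proof. by move=> pa pb; exact: (smooth_diff (smooth_D v (phi_smooth a b)) (ovlP pa pb)). Qed.

(** Components of Y in the chart b are the Jacobian applied to those in the chart a, and
    differentiating the Jacobian gives the non-tensorial term [hess]. Brackets lose it by symmetry,
    connections absorb it in their Christoffel terms. *)
Lemma derive_vloc_change a b p Y u : cdom a p -> cdom b p -> smooth_vf_near p Y ->
  'D_(jac a b (cmap a p) u) (vloc b Y) (cmap b p) =
  hess a b (cmap a p) u (vloc a Y (cmap a p)) + jac a b (cmap a p) ('D_u (vloc a Y) (cmap a p)).
Proof.
move=> pa pb sY.
have d1 := phi_diff pa pb.
have d2 : differentiable (vloc b Y) (phi a b (cmap a p)) by rewrite phi_cmap //; exact: vloc_diff.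
rewrite -{1}(phi_cmap b pa) -(derive_chain u d1 d2).
transitivity ('D_u (fun x => jac a b x (vloc a Y x)) (cmap a p)).
  apply: near_eq_derive; apply: (open_near (ovl_open a b) (ovlP pa pb)) => _ [q [qa qb] <-].
  by rewrite phi_cmap // !vloc_cmap // (tcomp_change _ qa qb).
apply: derive_lin_app_rV.
- apply: (open_near (ovl_open a b) (ovlP pa pb)) => _ [q [qa qb] <-]; exact: jac_lin.
- by move=> i; exact: jac_diff.
- exact: vloc_diff.
Qed.

Lemma bracket_loc a p X Y : cdom a p -> smooth_vf_near p X -> smooth_vf_near p Y ->
  tcomp a p (bracket X Y p) =
  'D_(tcomp a p (X p)) (vloc a Y) (cmap a p) - 'D_(tcomp a p (Y p)) (vloc a X) (cmap a p).
Proof.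
move=> pa sX sY; have pp := pref_cdom HM p.
rewrite bracket_pref (linB (tcomp_lin pa)) !(tcompE _ pa).
rewrite !derive_vloc_change // !vloc_cmap // !tcomp_pref (hess_sym (Y p)) //.
exact: esym (subr_add2l _ _ _).
Qed.

End Charts.

Arguments ovl_open {R n M} HM a b.
Arguments im_open {R n M} HM a.
Arguments phi_smooth {R n M} HM a b.
Arguments cdom_mopen {R n M} HM a.
Arguments tvec_field_smooth {R n M} HM a v.

Section Smooth_app.
Context {R : realType} {V : normedModType R}.

Lemma smooth_lin_app (U : set V) m (l : V -> 'rV[R]_m -> R) (f : V -> 'rV[R]_m) : open U ->
  (forall x, U x -> lin (l x)) -> (forall j, smooth U (fun x => l x (delta_mx 0 j))) ->
  smooth U f -> smooth U (fun x => l x (f x)).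
Proof.
move=> oU ll sl sf.
have s (j : 'I_m) := smoothM oU (smooth_coord j oU sf) (sl j).
apply: (smooth_eq oU _ (smooth_sum (index_enum 'I_m) oU s)) => x Ux.
by rewrite (lin_row _ (ll _ Ux)).
Qed.

Lemma smooth_lin_app_rV (U : set V) m p (l : V -> 'rV[R]_m -> 'rV[R]_p) (f : V -> 'rV[R]_m) : open U ->
  (forall x, U x -> lin (l x)) -> (forall j, smooth U (fun x => l x (delta_mx 0 j))) ->
  smooth U f -> smooth U (fun x => l x (f x)).
Proof.
move=> oU ll sl sf; apply: smooth_rV => // k.
apply: (@smooth_lin_app _ _ (fun x u => l x u 0 k)) => //.
  by move=> x Ux a u v; rewrite ll // !mxE.
by move=> j; apply: smooth_coord.
Qed.

Lemma smoothD_rV (U : set V) m (f g : V -> 'rV[R]_m) : open U ->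
  smooth U f -> smooth U g -> smooth U (fun x => f x + g x).
Proof. exact: smoothD. Qed.

Lemma smoothZ_rV (U : set V) m (c : V -> R) (f : V -> 'rV[R]_m) : open U ->
  smooth U c -> smooth U f -> smooth U (fun x => c x *: f x).
Proof.
move=> oU sc sf; apply: smooth_rV => // j.
apply: (smooth_eq oU _ (smoothM oU sc (smooth_coord j oU sf))) => x _.
by rewrite mxE.
Qed.

End Smooth_app.

(** * Covariant derivatives in charts *)

Section Fields.
Context {R : realType} {n : nat} {M : atlas R n}.
Hypothesis HM : smooth_manifold M.
Implicit Types (a b c : chart M) (p q : M).

Lemma mopenI (A B : set M) : mopen A -> mopen B -> mopen (A `&` B).
Proof.
move=> oA oB a; rewrite (_ : _ @` _ = (cmap a @` (cdom a `&` A)) `&` (cmap a @` (cdom a `&` B))).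
  by apply: openI; [exact: (oA a) | exact: (oB a)].
apply/seteqP; split=> [_ [q [qa [qA qB]] <-] //|x [[q [qa qA] <-] [r [ra rB] E]]].
  by split; exists q.
exists q => //; split=> //; split=> //.
by rewrite -(cmapK HM qa) -E (cmapK HM ra).
Qed.

Lemma smooth_vf_sub (A B : set M) Y : mopen A -> A `<=` B -> smooth_vf_on B Y -> smooth_vf_on A Y.
Proof.
move=> oA AB sY a; apply: smooth_sub (sY a).
by move=> _ [q [qa qA] <-]; exists q; split=> //; exact: AB.
Qed.

Lemma smooth_fun_sub (A B : set M) (f : M -> R) : A `<=` B -> smooth_fun_on B f -> smooth_fun_on A f.
Proof.
move=> AB sf a; apply: smooth_sub (sf a).
by move=> _ [q [qa qA] <-]; exists q; split=> //; exact: AB.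
Qed.

Lemma smooth_vf_eq (A : set M) Y Z : mopen A -> (forall q, A q -> Y q = Z q) ->
  smooth_vf_on A Y -> smooth_vf_on A Z.
Proof.
move=> oA YZ sY a; apply: (smooth_eq (oA a) _ (sY a)) => _ [q [qa qA] <-].
by rewrite (cmapK HM qa) YZ.
Qed.

Lemma smooth_vf_near_eq p (A : set M) Y Z : mopen A -> A p -> (forall q, A q -> Y q = Z q) ->
  smooth_vf_near p Y -> smooth_vf_near p Z.
Proof.
move=> oA Ap YZ [B [oB Bp sY]]; exists (A `&` B); split=> //; first exact: mopenI.
apply: (@smooth_vf_eq _ Y); first exact: mopenI.
  by move=> q [/YZ].
by apply: smooth_vf_sub sY; [exact: mopenI | move=> q []].
Qed.

Lemma smooth_vf_nearD p Y Z : smooth_vf_near p Y -> smooth_vf_near p Z ->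
  smooth_vf_near p (fun q => Y q + Z q).
Proof.
move=> [A [oA Ap sY]] [B [oB Bp sZ]]; have oAB := mopenI oA oB.
exists (A `&` B); split=> // a.
have s1 := smooth_vf_sub oAB (@subIsetl _ A B) sY a.
have s2 := smooth_vf_sub oAB (@subIsetr _ A B) sZ a.
apply: (smooth_eq (oAB a) _ (smoothD_rV (oAB a) s1 s2)) => _ [q [qa qA] <-].
by rewrite (cmapK HM qa) (linD (tcomp_lin HM qa)).
Qed.

Lemma smooth_vf_nearZ p (f : M -> R) Y : smooth_fun_near p f -> smooth_vf_near p Y ->
  smooth_vf_near p (fun q => f q *: Y q).
Proof.
move=> [A [oA Ap sf]] [B [oB Bp sY]]; have oAB := mopenI oA oB.
exists (A `&` B); split=> // a.
have s1 := smooth_fun_sub (@subIsetl _ A B) sf a.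
have s2 := smooth_vf_sub oAB (@subIsetr _ A B) sY a.
apply: (smooth_eq (oAB a) _ (smoothZ_rV (oAB a) s1 s2)) => _ [q [qa qA] <-].
by rewrite /= (cmapK HM qa) (linZ (tcomp_lin HM qa)).
Qed.

Lemma smooth_fun_near_cst p (k : R) : mopen [set: M] -> smooth_fun_near p (fun=> k).
Proof. by move=> oT; exists setT; split=> // a; apply: smooth_cst. Qed.

Lemma mopenT : mopen [set: M].
Proof. by move=> a; rewrite setIT; exact: (im_open HM). Qed.

Arguments mopenT : clear implicits.

Lemma smooth_vf_near0 p : smooth_vf_near p (fun=> 0 : 'rV[R]_n).
Proof.
exists setT; split=> //; first exact: mopenT.
move=> a.
have s0 : smooth (cmap a @` (cdom a `&` [set: M])) (fun=> 0 : 'rV[R]_n) by exact: smooth_cst.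
apply: (smooth_eq (mopenT a) _ s0) => _ [q [qa _] <-].
by rewrite (cmapK HM qa) (lin0 (tcomp_lin HM qa)).
Qed.

Lemma smooth_vf_near_sum p (I : Type) (r : seq I) (Y : I -> vfield M) :
  (forall i, smooth_vf_near p (Y i)) -> smooth_vf_near p (fun q => \sum_(i <- r) Y i q).
Proof.
move=> sY; elim: r => [|i r IH].
  rewrite (_ : (fun q => _) = fun=> 0); first exact: smooth_vf_near0.
  by apply/funext => q; rewrite big_nil.
rewrite (_ : (fun q => _) = (fun q => Y i q + \sum_(i <- r) Y i q)).
  exact: smooth_vf_nearD.
by apply/funext => q; rewrite big_cons.
Qed.

Lemma jac_app_smooth a b (U : set 'rV[R]_n) (f : 'rV[R]_n -> 'rV[R]_n) : open U -> U `<=` ovl a b ->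
  smooth U f -> smooth U (fun x => jac a b x (f x)).
Proof.
move=> oU Uab sf; apply: smooth_lin_app_rV => //.
  by move=> x /Uab [q [qa qb] <-]; exact: (jac_lin HM).
by move=> j; apply: smooth_sub (smooth_D _ (phi_smooth HM a b)).
Qed.

Lemma smooth_comp_near a p Y k : cdom a p -> smooth_vf_near p Y ->
  smooth_fun_near p (fun q => tcomp a q (Y q) 0 k).
Proof.
move=> pa [A [oA Ap sY]]; have oAa := mopenI oA (cdom_mopen HM a).
exists (A `&` cdom a); split=> // b; apply: smooth_coord; first exact: (oAa b).
have s1 := smooth_vf_sub oAa (@subIsetl _ A (cdom a)) sY b.
apply: (smooth_eq (oAa b) _ (jac_app_smooth (a := b) (b := a) (oAa b) _ s1)).
  by move=> _ [q [qb [_ qa]] <-]; rewrite /= (cmapK HM qb) -(tcomp_change HM _ qb qa).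
by move=> _ [q [qb [_ qa]] <-]; exists q.
Qed.

Section Conn.
Variable D : connection M.

Lemma vder_near_cst p (A : set M) (f : M -> R) k u : mopen A -> A p -> (forall q, A q -> f q = k) ->
  vder f p u = 0.
Proof.
move=> oA Ap fk; rewrite -(derive_cst k (cmap (pref p) p) u); apply: near_eq_derive.
by apply: filterS (near_mopen HM oA Ap (pref_cdom HM p)) => x [_ _ /fk].
Qed.

(** The indicator of A is constant near p, so multiplying a field by it does not change the
    covariant derivative at p; after multiplication Y and Z are the same function on all of M. *)
Lemma nabla_local p u (A : set M) Y Z : mopen A -> A p -> (forall q, A q -> Y q = Z q) ->
  smooth_vf_near p Y -> nabla D p u Y = nabla D p u Z.
Proof.
move=> oA Ap YZ sY; have sZ := smooth_vf_near_eq oA Ap YZ sY.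
pose f (q : M) : R := if q \in A then 1 else 0.
have f1 q : A q -> f q = 1 by move=> /mem_set qA; rewrite /f qA.
have sf : smooth_fun_near p f.
  exists A; split=> // a.
  have s0 : smooth (cmap a @` (cdom a `&` A)) (fun=> 1 : R) by exact: smooth_cst.
  apply: (smooth_eq (oA a) _ s0).
  by move=> _ [q [qa qA] <-]; rewrite /= (cmapK HM qa) f1.
have E X : smooth_vf_near p X -> nabla D p u X = nabla D p u (fun q => f q *: X q).
  move=> sX; rewrite (nablaM D u sf sX) (vder_near_cst u oA Ap f1) scale0r add0r.
  by rewrite (f1 _ Ap) scale1r.
rewrite (E Y sY) (E Z sZ); congr (nabla D p u _); apply/funext => q.
rewrite /f; case: ifPn => [/set_mem/YZ -> //|_]; by rewrite !scale0r.
Qed.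

Lemma nablaZ p u k Y : smooth_vf_near p Y ->
  nabla D p u (fun q => k *: Y q) = k *: nabla D p u Y.
Proof.
move=> sY; rewrite (nablaM D u (smooth_fun_near_cst p k mopenT) sY).
by rewrite (@vder_near_cst p setT (fun=> k) k u mopenT) // scale0r add0r.
Qed.

Lemma nabla_sum p u (I : Type) (r : seq I) (Y : I -> vfield M) :
  (forall i, smooth_vf_near p (Y i)) ->
  nabla D p u (fun q => \sum_(i <- r) Y i q) = \sum_(i <- r) nabla D p u (Y i).
Proof.
move=> sY; elim: r => [|i r IH].
  rewrite big_nil (_ : (fun q => _) = fun q => 0 *: (fun=> 0 : 'rV[R]_n) q).
    by rewrite nablaZ ?scale0r //; exact: smooth_vf_near0.
  by apply/funext => q; rewrite big_nil scale0r.
rewrite big_cons -IH -(nablaD D) //; last exact: smooth_vf_near_sum.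
by congr (nabla D p u _); apply/funext => q; rewrite big_cons.
Qed.

(** The Christoffel term Gamma(u, v) as a vector-valued bilinear map, free of indices: the
    derivative along u of the field with constant components v in the chart a. *)
Definition gam a (x u v : 'rV[R]_n) : 'rV[R]_n :=
  tcomp a (cmapV a x) (nabla D (cmapV a x) (tvec a (cmapV a x) u) (fun q => tvec a q v)).

Lemma gam_linl a p v : cdom a p -> lin (gam a (cmap a p) ^~ v).
Proof.
move=> pa k u w; rewrite /gam (cmapK HM pa) (tvec_lin HM pa).
by rewrite (nabla_linear D (tvec_field_near HM v pa)) (tcomp_lin HM pa).
Qed.

Lemma gam_linr a p u : cdom a p -> lin (gam a (cmap a p) u).
Proof.
move=> pa k v w; rewrite /gam (cmapK HM pa).
have sv v := tvec_field_near HM v pa.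
rewrite -(tcomp_lin HM pa) -nablaZ // -(nablaD D) //; last first.
  by apply: smooth_vf_nearZ => //; apply: smooth_fun_near_cst; exact: mopenT.
congr (tcomp a p _); apply: (@nabla_local p _ (cdom a) _ _ (cdom_mopen HM a) pa) => [q qa|]; last exact: sv.
by rewrite (tvec_lin HM qa).
Qed.

Lemma gam_smooth a u v : smooth (im a) (fun x => gam a x u v).
Proof.
have sT w := tvec_field_smooth HM a w.
have := nabla_smooth D (cdom_mopen HM a) (sT u) (sT v) a.
by rewrite setIid.
Qed.

(** Y is expanded in the coordinate frame, which locality permits although the frame makes sense on
    [cdom a] only. The Leibniz rule separates the derivative of the components from the Christoffel
    term. *)
Lemma nabla_loc a p u Y : cdom a p -> smooth_vf_near p Y ->
  tcomp a p (nabla D p u Y) = 'D_(tcomp a p u) (vloc a Y) (cmap a p)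
    + gam a (cmap a p) (tcomp a p u) (vloc a Y (cmap a p)).
Proof.
move=> pa sY.
have sk k := smooth_comp_near k pa sY.
have sd k : smooth_vf_near p (fun q => tvec a q (delta_mx 0 k)) := tvec_field_near HM _ pa.
have E : nabla D p u Y = nabla D p u (fun q => \sum_k tcomp a q (Y q) 0 k *: tvec a q (delta_mx 0 k)).
  apply: (@nabla_local p _ (cdom a) _ _ (cdom_mopen HM a) pa) => [q qa|]; last exact: sY.
  by rewrite -(lin_row _ (tvec_lin HM qa)) (tvec_tcomp HM).
rewrite E nabla_sum; last by move=> k; apply: smooth_vf_nearZ.
have tl := tcomp_lin HM pa.
rewrite (lin_sum _ _ tl) (row_sum_delta ('D_(tcomp a p u) _ _)) (lin_row _ (gam_linr _ pa)).
rewrite -big_split /=; apply: eq_bigr => k _.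
rewrite (nablaM D u (sk k) (sd k)) tl (linZ tl); congr (_ *: _ + _ *: _).
- rewrite -derive_coord; last exact: (vloc_diff HM).
  apply: (vder_loc HM) => //; exact: (diff_coord k (vloc_diff HM pa sY)).
- by rewrite (tcomp_tvec HM).
- by rewrite (vloc_cmap HM).
- by rewrite /gam (cmapK HM pa) (tvec_tcomp HM).
Qed.

(** This is [nabla_loc] in the chart b for a field with constant components in the chart a: in b its
    components vary like the Jacobian, whence the Hessian. *)
Lemma gam_phi a b p u v : cdom a p -> cdom b p ->
  jac a b (cmap a p) (gam a (cmap a p) u v) = hess a b (cmap a p) u v
   + gam b (cmap b p) (jac a b (cmap a p) u) (jac a b (cmap a p) v).
Proof.
move=> pa pb; have sv := tvec_field_near HM v pa.
rewrite {1}/gam (cmapK HM pa) -(tcomp_change HM _ pa pb) (nabla_loc _ pb sv).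
rewrite (tcomp_tvec_jac HM _ pa pb) (vloc_cmap HM _ pb) (tcomp_tvec_jac HM _ pa pb).
rewrite (derive_vloc_change HM) // (vloc_tvec HM); last exact: imP.
suff -> : 'D_u (vloc a (fun q => tvec a q v)) (cmap a p) = 0.
  by rewrite (lin0 (jac_lin HM pa pb)) addr0.
rewrite -(derive_cst v (cmap a p) u); apply: near_eq_derive.
by apply: (open_near (im_open HM a) (imP pa)) => x xa; rewrite (vloc_tvec HM).
Qed.

Lemma bracket_tvec a p u v : cdom a p -> bracket (fun q => tvec a q u) (fun q => tvec a q v) p = 0.
Proof.
move=> pa; apply: (tcomp_inj HM pa); rewrite (bracket_loc HM pa); try exact: (tvec_field_near HM).
rewrite (lin0 (tcomp_lin HM pa)).
have d0 w z : 'D_z (vloc a (fun q => tvec a q w)) (cmap a p) = 0.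
  rewrite -(derive_cst w (cmap a p) z); apply: near_eq_derive.
  by apply: (open_near (im_open HM a) (imP pa)) => x xa; rewrite (vloc_tvec HM).
by rewrite !d0 subrr.
Qed.

Lemma gam_sym a p u v : torsion_free D -> cdom a p ->
  gam a (cmap a p) u v = gam a (cmap a p) v u.
Proof.
move=> tf pa; rewrite /gam (cmapK HM pa); apply/eqP; rewrite -subr_eq0 -(linB (tcomp_lin HM pa)).
have := tf p _ _ (tvec_field_near HM u pa) (tvec_field_near HM v pa).
by rewrite /cov bracket_tvec // => ->; rewrite (lin0 (tcomp_lin HM pa)).
Qed.

End Conn.
End Fields.

Arguments mopenT {R n M} HM.
Arguments mopenI {R n M} HM {A B}.
Arguments gam_smooth {R n M} HM D a u v.

(** * Curvature in charts *)

Section Local.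
Context {R : realType} {n : nat}.
Implicit Types (x y u v w z : 'rV[R]_n).

(** Trace of an endomorphism given as a function, meaningful for linear f; it avoids the passage to
    matrices. *)
Definition trc (f : 'rV[R]_n -> 'rV[R]_n) : R := \sum_k f (delta_mx 0 k) 0 k.

Lemma eq_trc f g : f =1 g -> trc f = trc g.
Proof. by move=> fg; apply: eq_bigr => k _; rewrite fg. Qed.

Lemma trcD f g : trc (fun z => f z + g z) = trc f + trc g.
Proof. by rewrite /trc -big_split; apply: eq_bigr => k _; rewrite mxE. Qed.

Lemma trcN f : trc (fun z => - f z) = - trc f.
Proof. by rewrite /trc -sumrN; apply: eq_bigr => k _; rewrite mxE. Qed.

Lemma trcZ k f : trc (fun z => k *: f z) = k * trc f.
Proof. by rewrite /trc mulr_sumr; apply: eq_bigr => i _; rewrite mxE. Qed.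

Lemma trcC f g : lin f -> lin g -> trc (fun z => f (g z)) = trc (fun z => g (f z)).
Proof.
move=> lf lg; have E (h k : 'rV[R]_n -> 'rV[R]_n) : lin h ->
    trc (fun z => h (k z)) = \sum_i \sum_j k (delta_mx 0 i) 0 j * h (delta_mx 0 j) 0 i.
  move=> lh; apply: eq_bigr => i _; rewrite (lin_row _ lh) summxE.
  by apply: eq_bigr => j _; rewrite mxE.
rewrite E // E // exchange_big; apply: eq_bigr => i _; apply: eq_bigr => j _.
by rewrite mulrC.
Qed.

(* [G x u v] stands for the Christoffel term Gamma(u, v) of a torsion-free connection at the point x of a chart. *)
Record local_connection (U : set 'rV[R]_n) (G : 'rV[R]_n -> 'rV[R]_n -> 'rV[R]_n -> 'rV[R]_n) : Prop :=
  LocalConnection {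
    lc_lin : forall x u, U x -> lin (G x u);
    lc_sym : forall x u v, U x -> G x u v = G x v u;
    lc_smooth : forall u v, smooth U (fun x => G x u v)
  }.

Lemma lc_linl U G x v : local_connection U G -> U x -> lin (G x ^~ v).
Proof. by move=> lG Ux k u w; rewrite !(lc_sym lG _ v) // (lc_lin lG). Qed.

Lemma lc_diff U G x u v : local_connection U G -> U x -> differentiable (fun y => G y u v) x.
Proof. by move=> lG Ux; exact: (smooth_diff (lc_smooth lG u v)). Qed.

(** The curvature on fields with constant components. Such fields commute, so no bracket term
    appears. *)
Definition curvc (G : 'rV[R]_n -> 'rV[R]_n -> 'rV[R]_n -> 'rV[R]_n) x z u v :=
  'D_z (fun y => G y u v) x - 'D_u (fun y => G y z v) x + G x z (G x u v) - G x u (G x z v).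

Definition ricc G x u v := trc (fun z => curvc G x z u v).

Section LC.
Variables (U : set 'rV[R]_n) (G : 'rV[R]_n -> 'rV[R]_n -> 'rV[R]_n -> 'rV[R]_n).
Hypotheses (oU : open U) (lG : local_connection U G).

Lemma lc_app_diff x (f g : 'rV[R]_n -> 'rV[R]_n) : U x ->
  differentiable f x -> differentiable g x -> differentiable (fun y => G y (f y) (g y)) x.
Proof.
move=> Ux df dg; apply: (@diff_lin_app_rV _ _ _ _ (fun y u => G y u (g y))) => //.
  by apply: (open_near oU Ux) => y Uy; apply: (lc_linl _ lG).
move=> i; apply: (@diff_lin_app_rV _ _ _ _ (fun y u => G y _ u)) => //.
  by apply: (open_near oU Ux) => y Uy; apply: (lc_lin lG).
by move=> j; exact: lc_diff lG Ux.
Qed.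

Lemma lc_app_derive x w (f g : 'rV[R]_n -> 'rV[R]_n) : U x ->
  differentiable f x -> differentiable g x ->
  'D_w (fun y => G y (f y) (g y)) x =
  'D_w (fun y => G y (f x) (g x)) x + G x ('D_w f x) (g x) + G x (f x) ('D_w g x).
Proof.
move=> Ux df dg.
have c u : differentiable (fun=> u : 'rV[R]_n) x by exact: differentiable_cst.
rewrite (@derive_lin_app_rV _ _ _ _ (fun y u => G y u (g y)) f) //; last first.
- by move=> i; apply: lc_app_diff.
- by apply: (open_near oU Ux) => y Uy; apply: (lc_linl _ lG).
rewrite (@derive_lin_app_rV _ _ _ _ (fun y u => G y (f x) u) g) //; last first.
- by move=> i; apply: (lc_diff _ _ lG Ux).
- by apply: (open_near oU Ux) => y Uy; apply: (lc_lin lG).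
by rewrite addrAC.
Qed.

Lemma lc_app_smooth (f g : 'rV[R]_n -> 'rV[R]_n) :
  smooth U f -> smooth U g -> smooth U (fun y => G y (f y) (g y)).
Proof.
move=> sf sg; apply: (@smooth_lin_app_rV _ _ _ _ _ (fun y u => G y u (g y))) => //.
  by move=> y Uy; apply: (lc_linl _ lG).
move=> i; apply: (@smooth_lin_app_rV _ _ _ _ _ (fun y u => G y _ u)) => //.
  by move=> y Uy; apply: (lc_lin lG).
by move=> j; exact: (lc_smooth lG).
Qed.

Lemma curvc_smooth z u v : smooth U (fun x => curvc G x z u v).
Proof.
have s w w' := lc_smooth lG w w'.
have c w : smooth U (fun=> w : 'rV[R]_n) by exact: smooth_cst.
have smN (f : 'rV[R]_n -> 'rV[R]_n) : smooth U f -> smooth U (fun x => - f x).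
  move=> sf; apply: (smooth_eq oU _ (smoothZ_rV oU (@smooth_cst _ _ _ U (- 1 : R)) sf)) => x _.
  by rewrite scaleN1r.
apply: (smoothD_rV oU (smoothD_rV oU (smoothD_rV oU (smooth_D z (s u v)) (smN _ (smooth_D u (s z v)))) _) (smN _ _)).
  exact: lc_app_smooth.
exact: lc_app_smooth.
Qed.

Lemma ricc_smooth u v : smooth U (fun x => ricc G x u v).
Proof.
by apply: smooth_sum => // k; apply: smooth_coord => //; exact: curvc_smooth.
Qed.

Lemma curvc_linz x u v : U x -> lin (fun z => curvc G x z u v).
Proof.
move=> Ux k z w.
have d1 := derive_dir_lin (lc_diff u v lG Ux) k z w.
have E : 'D_u (fun y => G y (k *: z + w) v) x = k *: 'D_u (fun y => G y z v) x + 'D_u (fun y => G y w v) x.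
  have dk : differentiable (fun y => k *: G y z v) x by apply: differentiableZ; exact: lc_diff lG Ux.
  rewrite -derive_scale; last exact: lc_diff lG Ux.
  rewrite -derive_add //; last exact: lc_diff lG Ux.
  apply: near_eq_derive; apply: (open_near oU Ux) => y Uy; exact: (lc_linl v lG Uy).
rewrite /curvc d1 E (lc_linl _ lG Ux) (lc_linl _ lG Ux) (lc_lin lG _ Ux).
by apply/rowP => j; rewrite !mxE; ring.
Qed.

End LC.

(** Bookkeeping for the curvature in a chart: s is the second derivative of Z, p derives Z along a
    derivative of X or Y, g derives the Christoffel term, a and b are Christoffel terms with a
    derivative of X or Y and of Z respectively, and c is an iterated Christoffel term. *)
Lemma curvature_cancel m (s p1 p2 g1 g2 a1 a2 b1 b2 c1 c2 : 'rV[R]_m) :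
  (s + p1 + (g1 + a1 + b1) + (b2 + c1)) - (s + p2 + (g2 + a2 + b2) + (b1 + c2))
    - (p1 - p2 + (a1 - a2)) = g1 - g2 + c1 - c2.
Proof. by apply/rowP => j; rewrite !mxE; ring. Qed.

End Local.

Section Curvature.
Context {R : realType} {n : nat} {M : atlas R n}.
Hypothesis HM : smooth_manifold M.
Variable D : connection M.
Hypothesis tf : torsion_free D.
Implicit Types (a b c : chart M) (p q : M).

Lemma gam_lc a : local_connection (im a) (gam D a).
Proof.
split.
- by move=> x u /cmapVP -/(_ HM) [xa <-]; exact: gam_linr.
- by move=> x u v /cmapVP -/(_ HM) [xa <-]; exact: gam_sym.
- by move=> u v; exact: gam_smooth.
Qed.

Lemma cov_near p Y Z : smooth_vf_near p Y -> smooth_vf_near p Z -> smooth_vf_near p (cov D Y Z).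
Proof.
move=> [A [oA Ap sY]] [B [oB Bp sZ]]; have oAB := mopenI HM oA oB.
exists (A `&` B); split=> //; apply: nabla_smooth => //.
  exact: smooth_vf_sub oAB (@subIsetl _ A B) sY.
exact: smooth_vf_sub oAB (@subIsetr _ A B) sZ.
Qed.

Lemma near_smooth a p Y (P : 'rV[R]_n -> Prop) : cdom a p -> smooth_vf_near p Y ->
  (forall q, cdom a q -> smooth_vf_near q Y -> P (cmap a q)) -> \forall x \near cmap a p, P x.
Proof.
move=> pa [A [oA Ap sY]] H; apply: (@open_near _ _ _ _ _ (oA a)); first by exists p.
by move=> _ [q [qa qA] <-]; apply: H => //; exists A.
Qed.

Lemma derive_vloc_cov a p X Y Z : cdom a p ->
  smooth_vf_near p Y -> smooth_vf_near p Z ->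
  let x := cmap a p in
  'D_X (vloc a (cov D Y Z)) x =
    'D_X ('D_(vloc a Y x) (vloc a Z)) x + 'D_('D_X (vloc a Y) x) (vloc a Z) x
    + ('D_X (fun y => gam D a y (vloc a Y x) (vloc a Z x)) x
       + gam D a x ('D_X (vloc a Y) x) (vloc a Z x)
       + gam D a x (vloc a Y x) ('D_X (vloc a Z) x)).
Proof.
move=> pa sY sZ x; have oI := im_open HM a; have xI : im a x by exact: imP.
have dY := vloc_diff HM pa sY; have dZ := vloc_diff HM pa sZ.
have [U [oU Ux UI Us sUZ]] := vloc_smooth HM pa sZ.
have lD : \forall y \near x, lin (fun u => 'D_u (vloc a Z) y).
  by apply: (open_near oU Ux) => y Uy; apply: derive_dir_lin; exact: (smooth_diff sUZ).
have dD u : differentiable (fun y => 'D_u (vloc a Z) y) x by exact: (smooth_diff (smooth_D u sUZ) Ux).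
rewrite -(@derive_lin_app_rV _ _ _ _ (fun y u => 'D_u (vloc a Z) y) (vloc a Y) x X lD (fun i => dD _) dY).
rewrite -(lc_app_derive oI (gam_lc a) X xI dY dZ) -derive_add; first last.
- exact: (lc_app_diff oI (gam_lc a) xI dY dZ).
- exact: (diff_lin_app_rV lD (fun i => dD _) dY).
apply: near_eq_derive; apply: (near_smooth pa sZ) => q qa sZq.
by rewrite {1}/vloc (cmapK HM qa) /cov (nabla_loc HM D (Y q) qa sZq) (vloc_cmap HM Y qa).
Qed.

(** Tensoriality by computation: second derivatives of Z cancel by Schwarz, derivatives of X and Y
    against the bracket, and first derivatives of Z in Christoffel terms between the two iterated
    covariant derivatives. *)
Lemma curvature_loc a p X Y Z : cdom a p -> smooth_vf_near p X ->
  smooth_vf_near p Y -> smooth_vf_near p Z ->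
  tcomp a p (curvature D X Y Z p) =
  curvc (gam D a) (cmap a p) (tcomp a p (X p)) (tcomp a p (Y p)) (tcomp a p (Z p)).
Proof.
move=> pa sX sY sZ; have tl := tcomp_lin HM pa.
have xI : im a (cmap a p) by exact: imP.
have dZ := vloc_diff HM pa sZ.
have gl u := gam_linr HM D u pa.
have gll v := gam_linl HM D v pa.
have dd := derive_dir_lin dZ.
have [U [oU Ux UI Us sUZ]] := vloc_smooth HM pa sZ.
rewrite /curvature !(linB tl) {1 3}/cov.
rewrite (nabla_loc HM D (X p) pa (cov_near sY sZ)) (nabla_loc HM D (Y p) pa (cov_near sX sZ)).
rewrite {3}/cov (nabla_loc HM D (bracket X Y p) pa sZ).
rewrite !derive_vloc_cov // !(vloc_cmap HM _ pa) {1 2}/cov.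
rewrite !(nabla_loc HM D _ pa sZ) (bracket_loc HM pa sX sY) !(vloc_cmap HM _ pa).
set x := cmap a p; set u := tcomp a p (X p); set v := tcomp a p (Y p); set w := tcomp a p (Z p).
rewrite (linB (f := fun u => 'D_u (vloc a Z) x) dd) (linB (gll w)) !(linD (gl _)).
rewrite (schwarz_rV u v oU Ux sUZ).
exact: curvature_cancel.
Qed.

(** [Ric] takes its trace in preferred components; conjugation by [tcomp] and [tvec] leaves a trace
    unchanged, by cyclicity. *)
Lemma Ric_loc a p u v : cdom a p ->
  Ric D p u v = ricc (gam D a) (cmap a p) (tcomp a p u) (tcomp a p v).
Proof.
move=> pa; have xI : im a (cmap a p) by exact: imP.
have E : Ric D p u v = trc (fun z => curvature D (extend p z) (extend p u) (extend p v) p).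
  by apply: eq_bigr => k _; rewrite mxE.
have sE w := extend_near HM p w.
have cl := curvc_linz (im_open HM a) (gam_lc a) (tcomp a p u) (tcomp a p v) xI.
rewrite E; transitivity (trc (fun z => tvec a p
   (curvc (gam D a) (cmap a p) (tcomp a p z) (tcomp a p u) (tcomp a p v)))).
  apply: eq_trc => z; rewrite -[LHS](tvec_tcomp HM _ pa) curvature_loc //.
  by rewrite /extend !(tvec_pref HM).
rewrite (@trcC _ _ (tvec a p) (fun z => curvc (gam D a) (cmap a p) (tcomp a p z) _ _)).
- by apply: eq_trc => z; rewrite (tcomp_tvec HM _ pa).
- exact: tvec_lin.
- by move=> k z w; rewrite (tcomp_lin HM pa) cl.
Qed.

End Curvature.

(** * Levi-Civita connections from local data *)

Section Bilinear_forms.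
Context {R : realType} {V : normedModType R}.

Definition bilin m (b : 'rV[R]_m -> 'rV[R]_m -> R) := (forall u, lin (b u)) /\ (forall v, lin (b ^~ v)).

Lemma bil_app_diff m (b : V -> 'rV[R]_m -> 'rV[R]_m -> R) (f g : V -> 'rV[R]_m) x :
  (\forall y \near x, bilin (b y)) -> (forall u v, differentiable (fun y => b y u v) x) ->
  differentiable f x -> differentiable g x -> differentiable (fun y => b y (f y) (g y)) x.
Proof.
move=> bl bd df dg; apply: (@diff_lin_app _ _ _ (fun y u => b y u (g y))) => //.
  by apply: filterS bl => y [_ l2].
move=> i; apply: (@diff_lin_app _ _ _ (fun y u => b y _ u)) => //.
by apply: filterS bl => y [l1 _].
Qed.

Lemma bil_app_derive m (b : V -> 'rV[R]_m -> 'rV[R]_m -> R) (f g : V -> 'rV[R]_m) x w :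
  (\forall y \near x, bilin (b y)) -> (forall u v, differentiable (fun y => b y u v) x) ->
  differentiable f x -> differentiable g x ->
  'D_w (fun y => b y (f y) (g y)) x =
  'D_w (fun y => b y (f x) (g x)) x + b x ('D_w f x) (g x) + b x (f x) ('D_w g x).
Proof.
move=> bl bd df dg.
have c u : differentiable (fun=> u : 'rV[R]_m) x by exact: differentiable_cst.
rewrite (@derive_lin_app _ _ _ (fun y u => b y u (g y)) f) //; last first.
- by move=> i; apply: bil_app_diff.
- by apply: filterS bl => y [_ l2].
rewrite (@derive_lin_app _ _ _ (fun y u => b y (f x) u) g) //; last first.
  by apply: filterS bl => y [l1 _].
by rewrite addrAC.
Qed.

Lemma bil_app_smooth m (U : set V) (b : V -> 'rV[R]_m -> 'rV[R]_m -> R) (f g : V -> 'rV[R]_m) : open U ->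
  (forall y, U y -> bilin (b y)) -> (forall u v, smooth U (fun y => b y u v)) ->
  smooth U f -> smooth U g -> smooth U (fun y => b y (f y) (g y)).
Proof.
move=> oU bl sb sf sg; apply: (@smooth_lin_app _ _ _ _ (fun y u => b y u (g y))) => //.
  by move=> y /bl [_ l2].
move=> i; apply: (@smooth_lin_app _ _ _ _ (fun y u => b y _ u)) => //.
by move=> y /bl [l1 _].
Qed.

End Bilinear_forms.

Lemma lc_sub {R : realType} {n : nat} (U U' : set 'rV[R]_n) G : U' `<=` U ->
  local_connection U G -> local_connection U' G.
Proof.
move=> UU' [l s sm]; split.
- by move=> x u /UU'; exact: l.
- by move=> x u v /UU'; exact: s.
- by move=> u v; exact: smooth_sub (sm u v).
Qed.

(** The combinatorial core of the uniqueness of Levi-Civita connections: six alternating uses of the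
    two symmetries bring the arguments back with the opposite sign. *)
Lemma sym_skew0 {R : realFieldType} {A : Type} (T : A -> A -> A -> R) :
  (forall w u v, T w u v = T u w v) -> (forall w u v, T w u v = - T w v u) ->
  forall w u v, T w u v = 0.
Proof.
move=> s k w u v; have : T w u v = - T w u v.
  by rewrite {1}k (s w v u) (k v w u) opprK (s v u w) (k u v w) (s u w v).
lra.
Qed.

Lemma lin_BD {R : realType} {U W : lmodType R} (f : U -> W) : lin f ->
  forall x y z, f (x - (y + z)) = f x - (f y + f z).
Proof. by move=> lf x y z; rewrite (linB lf) (linD lf). Qed.

Lemma metric_aux (R : realFieldType) (a1 a2 b1 b2 c1 c2 : R) :
  a1 + a2 = c1 + c2 + b1 + b2 -> a1 - (b1 + c1) = - (a2 - (b2 + c2)).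
Proof. lra. Qed.

Lemma leibniz_aux (V : zmodType) (a b c d : V) : a + b + c + d = (c + a) + (d + b).
Proof. by rewrite [c + a]addrC [d + b]addrC addrACA addrA. Qed.

Section LeviCivita.
Context {R : realType} {n : nat} {N : atlas R n}.
Hypothesis HN : smooth_manifold N.
Variables (h : tensor2 N) (hl : chart N -> 'rV[R]_n -> 'rV[R]_n -> 'rV[R]_n -> R)
  (L : chart N -> 'rV[R]_n -> 'rV[R]_n -> 'rV[R]_n -> 'rV[R]_n).
Implicit Types (a b c : chart N) (p q : N).

Hypothesis h_loc : forall a p u v, cdom a p -> h p u v = hl a (cmap a p) (tcomp a p u) (tcomp a p v).
Hypothesis hl_bilin : forall a x, im a x -> bilin (hl a x).
Hypothesis hl_sym : forall a x u v, im a x -> hl a x u v = hl a x v u.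
Hypothesis hl_smooth : forall a u v, smooth (im a) (fun x => hl a x u v).
Hypothesis hl_nondeg : forall a x u, im a x -> (forall v, hl a x u v = 0) -> u = 0.
Hypothesis L_lc : forall a, local_connection (im a) (L a).
Hypothesis L_metric : forall a x u v w, im a x ->
  'D_w (fun y => hl a y u v) x = hl a x (L a x w u) v + hl a x u (L a x w v).

Lemma hl_change a b p u v : cdom a p -> cdom b p ->
  hl a (cmap a p) u v = hl b (cmap b p) (jac a b (cmap a p) u) (jac a b (cmap a p) v).
Proof.
move=> pa pb; have := h_loc (tvec a p u) (tvec a p v) pa.
by rewrite (h_loc _ _ pb) !(tcomp_tvec HN _ pa) !(tcomp_tvec_jac HN _ pa pb).
Qed.

(** The defect [E] of the transformation law is the difference of two torsion-free connections
    compatible with the same metric. Paired with the metric it is symmetric in two arguments and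
    skew in two, hence zero, so no formula for L is needed. *)
Lemma L_phi a b p u v : cdom a p -> cdom b p ->
  jac a b (cmap a p) (L a (cmap a p) u v) = hess a b (cmap a p) u v
   + L b (cmap b p) (jac a b (cmap a p) u) (jac a b (cmap a p) v).
Proof.
move=> pa pb; set x := cmap a p; set y := cmap b p; set J := jac a b x.
have xI : im a x by exact: imP.
have yI : im b y by exact: imP.
have Jl : lin J := jac_lin HN pa pb.
pose E w u := J (L a x w u) - (hess a b x w u + L b y (J w) (J u)).
have [b1 b2] := hl_bilin yI.
(* The Jacobian is onto, so it suffices to test nondegeneracy on vectors [J v']. *)
have J' w : exists v, w = J v.
  exists (jac b a y w); rewrite /J (jac_chain HN _ pb pa pb).
  by rewrite (jac_id HN).
suff E0 w u' v' : hl b y (E w u') (J v') = 0.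
  have : E u v = 0.
    by apply: (hl_nondeg yI) => w; have [w' ->] := J' w; exact: E0.
  by move/eqP; rewrite subr_eq0 => /eqP.
move: w u' v'; apply: sym_skew0 => [w u' v'|w u' v'].
  have e1 := lc_sym (L_lc a) w u' xI.
  have e2 : hess a b x w u' = hess a b x u' w := hess_sym HN w u' pa pb.
  have e3 := lc_sym (L_lc b) (J w) (J u') yI.
  have EE : E w u' = E u' w by rewrite /E e1 e2 e3.
  by rewrite EE.
(* One derivative of the metric is computed twice, with L in the chart a and, through the transition
   map, with L in the chart b. Comparing the results shows that [E] is skew for the metric. *)
have M1 : 'D_w (fun z => hl a z u' v') x =
   hl b y (J (L a x w u')) (J v') + hl b y (J u') (J (L a x w v')).
  by rewrite (L_metric _ _ _ xI) !(hl_change _ _ pa pb).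
have M2 : 'D_w (fun z => hl a z u' v') x =
   hl b y (L b y (J w) (J u')) (J v') + hl b y (J u') (L b y (J w) (J v'))
   + hl b y (hess a b x w u') (J v') + hl b y (J u') (hess a b x w v').
  transitivity ('D_w (fun z => hl b (phi a b z) (jac a b z u') (jac a b z v')) x).
    apply: near_eq_derive; apply: (open_near (ovl_open HN a b) (ovlP pa pb)) => _ [q [qa qb] <-].
    by rewrite (hl_change _ _ qa qb) (phi_cmap HN b qa).
  have dphi := phi_diff HN pa pb.
  have dh u1 v1 : differentiable (fun z => hl b z u1 v1) (phi a b x).
    by rewrite (phi_cmap HN b pa); exact: (smooth_diff (hl_smooth b u1 v1) yI).
  have nb : \forall z \near x, bilin (hl b (phi a b z)).
    apply: (open_near (ovl_open HN a b) (ovlP pa pb)) => _ [q [qa qb] <-].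
    by rewrite (phi_cmap HN b qa); apply: hl_bilin; exact: imP.
  have dhp u1 v1 : differentiable (fun z => hl b (phi a b z) u1 v1) x.
    exact: (differentiable_comp dphi (dh u1 v1)).
  rewrite (bil_app_derive w nb dhp (jac_diff HN u' pa pb) (jac_diff HN v' pa pb)).
  rewrite (@derive_chain _ _ _ _ (phi a b) (fun z => hl b z (J u') (J v')) x w dphi (dh _ _)).
  by rewrite (phi_cmap HN b pa) -/y (L_metric _ _ _ yI).
have l1 v1 : lin (hl b y ^~ v1) by exact: b2.
have c1 := lin_BD (l1 (J v')) (J (L a x w u')) (hess a b x w u') (L b y (J w) (J u')).
have c2 := lin_BD (b1 (J u')) (J (L a x w v')) (hess a b x w v') (L b y (J w) (J v')).
apply: etrans c1 (etrans _ (congr1 -%R (etrans (esym c2) (hl_sym _ _ yI)))).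
exact: metric_aux (etrans (esym M1) M2).
Qed.

(** The preferred chart need not vary continuously with p. Smoothness is therefore read off
    [lc_nabla_loc], which gives the same expression in any fixed chart. *)
Definition lc_nabla p u (Y : vfield N) : 'rV[R]_n :=
  'D_u (vloc (pref p) Y) (cmap (pref p) p) + L (pref p) (cmap (pref p) p) u (Y p).

Lemma lc_nabla_loc a p u Y : cdom a p -> smooth_vf_near p Y ->
  tcomp a p (lc_nabla p u Y) = 'D_(tcomp a p u) (vloc a Y) (cmap a p)
    + L a (cmap a p) (tcomp a p u) (tcomp a p (Y p)).
Proof.
move=> pa sY; have pp := pref_cdom HN p.
rewrite /lc_nabla (linD (tcomp_lin HN pa)) !(tcompE HN _ pa).
rewrite (derive_vloc_change HN u pp pa sY) (L_phi _ _ pp pa) (vloc_cmap HN Y pp) (tcomp_pref HN).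
by rewrite addrCA addrA.
Qed.

Lemma lc_nabla_linear p Y : smooth_vf_near p Y -> linear (lc_nabla p ^~ Y).
Proof.
move=> sY k u v; have pp := pref_cdom HN p.
rewrite /lc_nabla (derive_dir_lin (vloc_diff HN pp sY)) (lc_linl _ (L_lc _) (imP pp)).
by rewrite scalerDr addrACA.
Qed.

Lemma lc_nablaD p u Y Z : smooth_vf_near p Y -> smooth_vf_near p Z ->
  lc_nabla p u (fun q => Y q + Z q) = lc_nabla p u Y + lc_nabla p u Z.
Proof.
move=> sY sZ; have pp := pref_cdom HN p.
rewrite /lc_nabla (linD (lc_lin (L_lc _) u (imP pp))) addrACA; congr (_ + _).
rewrite -derive_add; try exact: (vloc_diff HN).
apply: near_eq_derive; apply: (open_near (im_open HN _) (imP pp)) => _ [q qp <-].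
by rewrite !(vloc_cmap HN _ qp) (linD (tcomp_lin HN qp)).
Qed.

Lemma lc_nablaM p u f Y : smooth_fun_near p f -> smooth_vf_near p Y ->
  lc_nabla p u (fun q => f q *: Y q) = vder f p u *: Y p + f p *: lc_nabla p u Y.
Proof.
move=> [A [oA Ap sf]] sY; have pp := pref_cdom HN p.
have df : differentiable (f \o cmapV (pref p)) (cmap (pref p) p).
  by apply: (smooth_diff (sf (pref p))); exists p.
have dY := vloc_diff HN pp sY.
rewrite /lc_nabla (linZ (lc_lin (L_lc _) u (imP pp))) scalerDr addrA; congr (_ + _).
pose l (y : 'rV[R]_n) (w : 'rV[R]_n) := f (cmapV (pref p) y) *: w.
have ll y : lin (l y) by move=> k v w; rewrite /l scalerDr !scalerA mulrC.
have dl w : differentiable (fun y => l y w) (cmap (pref p) p) by apply: differentiableZl.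
rewrite (_ : 'D_u _ _ = 'D_u (fun y => l y (vloc (pref p) Y y)) (cmap (pref p) p)); last first.
  apply: near_eq_derive; apply: (open_near (im_open HN _) (imP pp)) => _ [q qp <-].
  by rewrite /l !(vloc_cmap HN _ qp) (cmapK HN qp) (linZ (tcomp_lin HN qp)).
rewrite (derive_lin_app_rV u (filterE _ ll) (fun i => dl _) dY).
congr (_ + _); last by rewrite /l (cmapK HN pp).
rewrite /l (vloc_cmap HN _ pp) (tcomp_pref HN) /vder.
rewrite deriveE; last exact: (dl (Y p)).
by rewrite diffZl // deriveE.
Qed.

Lemma lc_nabla_smooth (A : set N) X Y : mopen A -> smooth_vf_on A X ->
  smooth_vf_on A Y -> smooth_vf_on A (fun p => lc_nabla p (X p) Y).
Proof.
move=> oA sX sY a; have oU := oA a; set U := cmap a @` _ in oU *.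
have UI : U `<=` im a by move=> _ [q [qa _] <-]; exact: imP.
have s1 : smooth U (fun x => 'D_(vloc a X x) (vloc a Y) x).
  apply: (@smooth_lin_app_rV _ _ _ _ _ (fun x u => 'D_u (vloc a Y) x)) => //.
  - by move=> x Ux; apply: derive_dir_lin; exact: (smooth_diff (sY a)).
  - by move=> j; apply: smooth_D; exact: (sY a).
  - exact: (sX a).
have s2 := lc_app_smooth oU (lc_sub UI (L_lc a)) (sX a) (sY a).
apply: (smooth_eq oU _ (smoothD_rV oU s1 s2)) => _ [q [qa qA] <-].
have sq : smooth_vf_near q Y by exists A.
by rewrite (cmapK HN qa) (lc_nabla_loc _ qa sq) (vloc_cmap HN _ qa).
Qed.

Definition lc_connection : connection N :=
  Connection lc_nabla_linear lc_nablaD lc_nablaM lc_nabla_smooth.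

Lemma lc_connection_levi_civita : levi_civita lc_connection h.
Proof.
split=> [p X Y sX sY|p u Y Z sY sZ]; have pp := pref_cdom HN p.
  rewrite /cov /= /lc_nabla (lc_sym (L_lc _) (Y p) (X p) (imP pp)) bracket_pref.
  by rewrite opprD addrACA subrr addr0.
have nb : \forall z \near cmap (pref p) p, bilin (hl (pref p) z).
  by apply: (open_near (im_open HN _) (imP pp)) => z; exact: hl_bilin.
have dh u1 v1 : differentiable (fun z => hl (pref p) z u1 v1) (cmap (pref p) p).
  exact: (smooth_diff (hl_smooth _ u1 v1) (imP pp)).
have dY := vloc_diff HN pp sY; have dZ := vloc_diff HN pp sZ.
rewrite /vder (_ : 'D_u _ _ = 'D_u (fun x => hl (pref p) x (vloc (pref p) Y x) (vloc (pref p) Z x)) (cmap (pref p) p)); last first.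
  apply: near_eq_derive; apply: (open_near (im_open HN _) (imP pp)) => _ [q qp <-].
  by rewrite /= (cmapK HN qp) (h_loc _ _ qp) !(vloc_cmap HN _ qp).
rewrite (bil_app_derive u nb dh dY dZ) (L_metric _ _ _ (imP pp)) /= !(h_loc _ _ pp).
rewrite !(tcomp_pref HN) !(vloc_cmap HN _ pp) !(tcomp_pref HN) /lc_nabla.
have [b1 b2] := hl_bilin (imP pp).
rewrite (linD (b1 _)) (linD (b2 _)).
exact: leibniz_aux.
Qed.

(** Identifies the glued connection with the local data, so that its Ricci tensor can be computed
    from L. *)
Lemma gam_lc_connection a p u v : cdom a p ->
  gam lc_connection a (cmap a p) u v = L a (cmap a p) u v.
Proof.
move=> pa; have sv := tvec_field_near HN v pa.
rewrite /gam (cmapK HN pa) /= (lc_nabla_loc _ pa sv) !(tcomp_tvec HN _ pa).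
suff -> : 'D_u (vloc a (fun q => tvec a q v)) (cmap a p) = 0 by rewrite add0r.
rewrite -(derive_cst v (cmap a p) u); apply: near_eq_derive.
by apply: (open_near (im_open HN a) (imP pa)) => x xa; rewrite (vloc_tvec HN).
Qed.

End LeviCivita.

(** * The metric in a canonical chart *)

Section Covectors.
Context {R : realType} {n : nat}.
Implicit Types (x u v w z : 'rV[R]_n).

Lemma evE u v : ev u v = \sum_k u 0 k * v 0 k.
Proof. by rewrite /ev mxE; apply: eq_bigr => k _; rewrite mxE. Qed.

Lemma evC u v : ev u v = ev v u.
Proof. by rewrite !evE; apply: eq_bigr => k _; rewrite mulrC. Qed.

Lemma ev_linr u : lin (ev u : 'rV[R]_n -> R).
Proof.
move=> k v w; rewrite !evE scaler_sumr -big_split /=; apply: eq_bigr => j _.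
by rewrite !mxE mulrDr mulrCA.
Qed.

Lemma ev_linl v : lin (ev ^~ v : 'rV[R]_n -> R).
Proof. by move=> k u w; rewrite !(evC _ v) ev_linr. Qed.

Lemma ev_delta v k : ev (delta_mx 0 k) v = v 0 k.
Proof.
rewrite evE (bigD1 k) //= big1 ?addr0 ?mxE ?eqxx ?mul1r // => j jk.
by rewrite mxE (negPf jk) andbF mul0r.
Qed.

Lemma ev_deltar u k : ev u (delta_mx 0 k) = u 0 k.
Proof. by rewrite evC ev_delta. Qed.

Lemma trc_rank1 (f : 'rV[R]_n -> R) u : lin f -> trc (fun z => f z *: u) = f u.
Proof.
move=> lf; rewrite (lin_row u lf); apply: eq_bigr => k _.
by rewrite mxE mulrC.
Qed.

Lemma trc_id : trc (fun z : 'rV[R]_n => z) = n%:R.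
Proof.
rewrite /trc (eq_bigr (fun=> 1)); first by rewrite sumr_const card_ord.
by move=> k _; rewrite mxE !eqxx.
Qed.

Lemma ev_coord_lin (A : 'rV[R]_n -> 'rV[R]_n) (f : 'rV[R]_n -> R) w :
  lin f -> ev (\row_k f (delta_mx 0 k)) w = f w.
Proof.
move=> lf; rewrite evE (lin_row w lf); apply: eq_bigr => k _.
by rewrite mxE mulrC.
Qed.

(* The difference of [shift_by g xi] and g is the tensor defining a projective change by the one-form xi. *)
Definition shift_by (g : 'rV[R]_n -> 'rV[R]_n -> 'rV[R]_n) (xi u v : 'rV[R]_n) : 'rV[R]_n :=
  g u v + ev xi v *: u + ev xi u *: v.

Section Shift.
Variables (g : 'rV[R]_n -> 'rV[R]_n -> 'rV[R]_n) (xi : 'rV[R]_n).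
Hypotheses (gl : forall u, lin (g u)) (gs : forall u v, g u v = g v u).
Let t u := trc (g u).

Lemma shift_by_sym u v : shift_by g xi u v = shift_by g xi v u.
Proof. by rewrite /shift_by gs addrAC. Qed.

Lemma shift_by_lin u : lin (shift_by g xi u).
Proof.
move=> k v w; rewrite /shift_by gl ev_linr.
by apply/rowP => j; rewrite !mxE -[_ *: _]/(_ * _); ring.
Qed.

Lemma trc_shift u : trc (shift_by g xi u) = t u + (n%:R + 1) * ev xi u.
Proof.
rewrite /shift_by !trcD trc_rank1; last exact: ev_linr.
rewrite trcZ trc_id -/(t u); ring.
Qed.

Lemma trc_shift2 u v : trc (fun z => shift_by g xi u (shift_by g xi v z)) =
  trc (fun z => g u (g v z)) + 2 * ev xi (g u v) + ev xi v * t u + ev xi u * t v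
  + (n%:R + 3) * (ev xi u * ev xi v).
Proof.
(* Apart from the composite, the terms are sorted into multiples of z, of [g u z] and of [g v z],
   and rank-one maps, whose traces are all immediate. *)
have E z : shift_by g xi u (shift_by g xi v z) =
   g u (g v z) + ev xi z *: g u v + ev xi v *: g u z + ev xi (g v z) *: u
   + ev xi z *: ((2 * ev xi v) *: u + ev xi u *: v) + ev xi u *: g v z + (ev xi u * ev xi v) *: z.
  rewrite /shift_by !(linD (gl u)) !(linZ (gl u)) !(linD (ev_linr xi)) !(linZ (ev_linr xi)).
  by apply/rowP => j; rewrite !mxE -![_ *: _]/(_ * _); ring.
have l1 : lin (ev xi : 'rV[R]_n -> R) by exact: ev_linr.
have l2 : lin (fun z => ev xi (g v z)) by move=> k z w; rewrite gl ev_linr.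
rewrite (eq_trc E) !trcD !trcZ trc_id !trc_rank1 // (linD l1) !(linZ l1).
rewrite (gs v u) -!/(t _) -![_ *: _]/(_ * _); ring.
Qed.

End Shift.
End Covectors.

Section Param.
Context {R : realType} {V : normedModType R}.

Lemma derive_lin_param {W : normedModType R} m (l : V -> 'rV[R]_m -> W) x w :
  (\forall y \near x, lin (l y)) -> (forall u, differentiable (fun y => l y u) x) ->
  lin (fun u => 'D_w (fun y => l y u) x).
Proof.
move=> ll dl k u v; rewrite -derive_scale // -derive_add //; last exact: differentiableZ.
by apply: near_eq_derive; apply: filterS ll => y ly; exact: ly.
Qed.

End Param.

Section Ev_derive.
Context {R : realType} {n : nat} {V : normedModType R}.
Implicit Types (f g : V -> 'rV[R]_n).

Lemma ev_bilin : bilin (@ev R n).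
Proof. by split=> [u|v]; [exact: ev_linr | exact: ev_linl]. Qed.

Lemma diff_ev f g t : differentiable f t -> differentiable g t -> differentiable (fun s => ev (f s) (g s)) t.
Proof.
move=> df dg; apply: (@bil_app_diff _ _ _ (fun _ => @ev R n) f g t) => //.
by apply: filterE => _; exact: ev_bilin.
Qed.

Lemma derive_ev f g t w : differentiable f t -> differentiable g t ->
  'D_w (fun s => ev (f s) (g s)) t = ev ('D_w f t) (g t) + ev (f t) ('D_w g t).
Proof.
move=> df dg; rewrite (@bil_app_derive _ _ _ (fun _ => @ev R n) f g t w) //.
  by rewrite derive_cst add0r.
by apply: filterE => _; exact: ev_bilin.
Qed.

Lemma derive_ev_cst f u t w : differentiable f t ->
  'D_w (fun s => ev (f s) u) t = ev ('D_w f t) u.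
Proof.
move=> df; rewrite (@derive_ev f (fun=> u)) //.
by rewrite derive_cst (lin0 (ev_linr _)) addr0.
Qed.

End Ev_derive.

Lemma koszul_aux (R : realFieldType) (a1 a2 b c1 c2 : R) :
  2 * a1 = b + c1 - c2 -> 2 * a2 = b + c2 - c1 -> b = a1 + a2.
Proof. lra. Qed.

Lemma fibre_lin_aux (R : comPzRingType) (k a1 a2 b1 b2 c1 c2 d1 d2 : R) :
  (k * a1 + a2) + (k * b1 + b2) - (k * c1 + c2) - 2 * (k * d1 + d2) =
  k * (a1 + b1 - c1 - 2 * d1) + (a2 + b2 - c2 - 2 * d2).
Proof. ring. Qed.

Section Model.
Context {R : realType} {n : nat}.
Implicit Types (x u v w : 'rV[R]_n) (y X Y Z : 'rV[R]_(n + n)).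
Variables (U : set 'rV[R]_n) (G : 'rV[R]_n -> 'rV[R]_n -> 'rV[R]_n -> 'rV[R]_n)
  (S : 'rV[R]_n -> 'rV[R]_n -> 'rV[R]_n -> R).
Hypotheses (oU : open U) (lG : local_connection U G)
  (Sbil : forall x, U x -> bilin (S x)) (Ssym : forall x u v, U x -> S x u v = S x v u)
  (Ssm : forall u v, smooth U (fun x => S x u v)).

Let UU : set 'rV[R]_(n + n) := [set y | U (lsubmx y)].

Lemma lsubmx_lin : lin (@lsubmx R 1 n n). Proof. by move=> k u v; apply/rowP => j; rewrite !mxE. Qed.
Lemma rsubmx_lin : lin (@rsubmx R 1 n n). Proof. by move=> k u v; apply/rowP => j; rewrite !mxE. Qed.

Lemma cyl_open (U0 : set 'rV[R]_n) : open U0 -> open [set y : 'rV[R]_(n + n) | U0 (lsubmx y)].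
Proof.
move=> oU0; have c : continuous (@lsubmx R 1 n n).
  by move=> y; apply: differentiable_continuous; apply: diff_of_lin; exact: lsubmx_lin.
have := @open_comp _ _ (@lsubmx R 1 n n) U0 (fun y _ => c y) oU0; exact.
Qed.

Let oUU : open UU. Proof. exact: cyl_open. Qed.

(** The horizontal part of the metric, with S in place of the symmetrized Schouten tensor. It
    carries all the dependence on y, since the pairing of base and fibre directions has constant
    coefficients. *)
Definition wform y u v : R := - ev (rsubmx y) (G (lsubmx y) u v) - S (lsubmx y) u v
  - ev (rsubmx y) u * ev (rsubmx y) v.

Definition pw_form y X Y : R := 2^-1 * (ev (rsubmx X) (lsubmx Y) + ev (rsubmx Y) (lsubmx X))
  + wform y (lsubmx X) (lsubmx Y).

(* The Levi-Civita connection of [pw_form], read off from the Koszul formula: as the form pairs the base with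
   the fibre directions, pairing with fibre vectors gives the base components [pw_base], and pairing with base
   vectors then gives the fibre components [pw_fibre]. *)
Definition pw_base y u v := shift_by (G (lsubmx y)) (rsubmx y) u v.

Definition pw_fibre y X Y (k : 'I_n) : R := let u := lsubmx X in let v := lsubmx Y in
  let e := delta_mx 0 k in
  'D_X (fun y => wform y v e) y + 'D_Y (fun y => wform y u e) y
  - 'D_(row_mx e 0) (fun y => wform y u v) y - 2 * wform y (pw_base y u v) e.

Definition pw_conn y X Y : 'rV[R]_(n + n) :=
  row_mx (pw_base y (lsubmx X) (lsubmx Y)) (\row_k pw_fibre y X Y k).

Lemma wform_bilin y : UU y -> bilin (wform y).
Proof.
move=> Uy; have [s1 s2] := Sbil Uy.
split=> [u k v w|v k u w].
  rewrite /wform (lc_lin lG _ Uy) s1 !ev_linr -![_ *: _]/(_ * _); ring.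
rewrite /wform (lc_linl _ lG Uy) s2 !ev_linr -![_ *: _]/(_ * _); ring.
Qed.

Lemma wform_sym y u v : UU y -> wform y u v = wform y v u.
Proof. by move=> Uy; rewrite /wform (lc_sym lG) // Ssym // [_ u * _]mulrC. Qed.

Lemma lsub_smooth : smooth UU (@lsubmx R 1 n n). Proof. exact: smooth_lin lsubmx_lin. Qed.
Lemma rsub_smooth : smooth UU (@rsubmx R 1 n n). Proof. exact: smooth_lin rsubmx_lin. Qed.

Lemma ev_smooth (V : normedModType R) (U0 : set V) (f g : V -> 'rV[R]_n) : open U0 -> smooth U0 f -> smooth U0 g ->
  smooth U0 (fun t => ev (f t) (g t)).
Proof.
move=> oU0 sf sg; have s (k : 'I_n) := smoothM oU0 (smooth_coord k oU0 sf) (smooth_coord k oU0 sg).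
by apply: (smooth_eq oU0 _ (smooth_sum (index_enum 'I_n) oU0 s)) => t _; rewrite evE.
Qed.

Lemma Gl_smooth u v : smooth UU (fun y => G (lsubmx y) u v).
Proof. by apply: (smooth_comp_rV oUU oU lsub_smooth (lc_smooth lG u v)). Qed.

Lemma wform_smooth u v : smooth UU (fun y => wform y u v).
Proof.
have sr := rsub_smooth; have c w : smooth UU (fun=> w : 'rV[R]_n) by exact: smooth_cst.
apply: smoothB => //; first apply: smoothB => //.
- by apply: smoothN => //; apply: ev_smooth => //; exact: Gl_smooth.
- exact: (smooth_comp oUU lsub_smooth (Ssm u v)).
- by apply: smoothM => //; apply: ev_smooth.
Qed.

Lemma pw_base_smooth u v : smooth UU (fun y => pw_base y u v).
Proof.
have sr := rsub_smooth; have c w : smooth UU (fun=> w : 'rV[R]_n) by exact: smooth_cst.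
apply: smoothD => //; first (apply: smoothD => //; first exact: Gl_smooth).
  by apply: smoothZl => //; apply: ev_smooth.
by apply: smoothZl => //; apply: ev_smooth.
Qed.

Lemma wform_diff y u v : UU y -> differentiable (fun y => wform y u v) y.
Proof. by move=> Uy; exact: (smooth_diff (wform_smooth u v)). Qed.

Lemma wform_near y : UU y -> \forall z \near y, bilin (wform z).
Proof. by move=> Uy; apply: (open_near oUU Uy) => z; exact: wform_bilin. Qed.

Lemma pw_base_lin y u : UU y -> lin (pw_base y u).
Proof. by move=> Uy; apply: shift_by_lin => w; exact: (lc_lin lG). Qed.

Lemma pw_base_sym y u v : UU y -> pw_base y u v = pw_base y v u.
Proof. by move=> Uy; apply: shift_by_sym => w z; exact: (lc_sym lG). Qed.

Lemma derive_wform_linr y X u : UU y -> lin (fun v => 'D_X (fun y => wform y u v) y).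
Proof.
move=> Uy; apply: (@derive_lin_param _ _ _ _ (fun y v => wform y u v)).
  by apply: filterS (wform_near Uy) => z [].
by move=> v; exact: wform_diff.
Qed.

Lemma derive_wform_linl y X v : UU y -> lin (fun u => 'D_X (fun y => wform y u v) y).
Proof.
move=> Uy; apply: (@derive_lin_param _ _ _ _ (fun y u => wform y u v)).
  by apply: filterS (wform_near Uy) => z [].
by move=> u; exact: wform_diff.
Qed.

Lemma derive_wform_dir y u v : UU y -> lin (fun X => 'D_X (fun y => wform y u v) y).
Proof. by move=> Uy; apply: derive_dir_lin; exact: wform_diff. Qed.

Lemma pw_fibre_lin y X k : UU y -> lin (fun Y => pw_fibre y X Y k : R).
Proof.
move=> Uy c Y Z; rewrite /pw_fibre lsubmx_lin (derive_wform_linl _ _ Uy) (derive_wform_dir _ _ Uy).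
rewrite (derive_wform_linr _ _ Uy) (pw_base_lin _ Uy) (wform_bilin Uy).2.
exact: fibre_lin_aux.
Qed.

Lemma derive_wform_sym y X u v : UU y -> 'D_X (fun y => wform y u v) y = 'D_X (fun y => wform y v u) y.
Proof. by move=> Uy; apply: near_eq_derive; apply: (open_near oUU Uy) => z Uz; exact: wform_sym. Qed.

Lemma pw_fibre_sym y X Y k : UU y -> pw_fibre y X Y k = pw_fibre y Y X k.
Proof.
move=> Uy; rewrite /pw_fibre (pw_base_sym _ _ Uy) (derive_wform_sym _ (lsubmx X) (lsubmx Y) Uy).
exact: (congr1 (fun s => s - _ - _) (addrC _ _)).
Qed.

Lemma pw_conn_lc : local_connection UU pw_conn.
Proof.
split=> [y X Uy k Y Z|y X Y Uy|X Y].
- rewrite /pw_conn lsubmx_lin (pw_base_lin _ Uy) scale_row_mx add_row_mx; congr row_mx.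
  by apply/rowP => j; rewrite !mxE (pw_fibre_lin _ _ Uy).
- rewrite /pw_conn (pw_base_sym _ _ Uy); congr row_mx.
  by apply/rowP => j; rewrite !mxE (pw_fibre_sym _ _ _ Uy).
apply: smooth_rV => // j.
have sb := pw_base_smooth (lsubmx X) (lsubmx Y).
have sw := wform_smooth.
case: (split_ordP j) => k ->; rewrite /pw_conn.
  apply: (smooth_eq oUU _ (smooth_coord k oUU sb)) => y _; by rewrite row_mxEl.
have s1 := smooth_D X (sw (lsubmx Y) (delta_mx 0 k)).
have s2 := smooth_D Y (sw (lsubmx X) (delta_mx 0 k)).
have s3 := smooth_D (row_mx (delta_mx 0 k) 0) (sw (lsubmx X) (lsubmx Y)).
have s4 := bil_app_smooth oUU wform_bilin sw sb (@smooth_cst _ _ _ UU (delta_mx 0 k : 'rV[R]_n)).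
apply: (smooth_eq oUU _ (smoothB oUU (smoothB oUU (smoothD oUU s1 s2) s3) (smoothZ 2 oUU s4))) => y _.
by rewrite row_mxEr mxE.
Qed.

Lemma derive_rsub y X : 'D_X (@rsubmx R 1 n n) y = rsubmx X.
Proof. exact: derive_of_lin rsubmx_lin. Qed.

Lemma diff_rsub y : differentiable (@rsubmx R 1 n n) y.
Proof. exact: diff_of_lin rsubmx_lin. Qed.

Lemma diff_lsub y : differentiable (@lsubmx R 1 n n) y.
Proof. exact: diff_of_lin lsubmx_lin. Qed.

Lemma derive_lsub_comp {W : normedModType R} (f : 'rV[R]_n -> W) y X :
  differentiable f (lsubmx y) -> 'D_X (fun y => f (lsubmx y)) y = 'D_(lsubmx X) f (lsubmx y).
Proof.
move=> df; rewrite (@derive_chain R _ _ _ (@lsubmx R 1 n n) f y X (diff_lsub y) df).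
by rewrite (derive_of_lin _ _ lsubmx_lin).
Qed.

Lemma diff_lsub_comp {W : normedModType R} (f : 'rV[R]_n -> W) y :
  differentiable f (lsubmx y) -> differentiable (fun y => f (lsubmx y)) y.
Proof. by move=> df; exact: (differentiable_comp (diff_lsub y) df). Qed.

Lemma derive_wform y X u v : UU y -> 'D_X (fun y => wform y u v) y =
  - (ev (rsubmx X) (G (lsubmx y) u v) + ev (rsubmx y) ('D_(lsubmx X) (fun x => G x u v) (lsubmx y)))
  - 'D_(lsubmx X) (fun x => S x u v) (lsubmx y)
  - (ev (rsubmx X) u * ev (rsubmx y) v + ev (rsubmx y) u * ev (rsubmx X) v).
Proof.
move=> Uy; have dG : differentiable (fun x => G x u v) (lsubmx y) by exact: (lc_diff u v lG Uy).
have dS : differentiable (fun x => S x u v) (lsubmx y) by exact: (smooth_diff (Ssm u v) Uy).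
have dr := diff_rsub y.
have dGl := diff_lsub_comp dG; have dSl := diff_lsub_comp dS.
have de w : differentiable (fun y => ev (rsubmx y) w) y.
  by apply: (@diff_ev _ _ _ (@rsubmx R 1 n n) (fun=> w)).
have deG : differentiable (fun y => ev (rsubmx y) (G (lsubmx y) u v)) y.
  exact: (diff_ev dr dGl).
rewrite /wform derive_sub; first last.
- exact: diff_mul.
- by apply: diff_sub => //; exact: diff_opp.
rewrite derive_sub //; last exact: diff_opp.
rewrite derive_opp // derive_mul // (derive_ev X dr dGl) !(derive_ev_cst _ _ dr) !derive_rsub.
by rewrite (derive_lsub_comp _ dG) (derive_lsub_comp _ dS).
Qed.

(** The origin of [pw_base]: along a fibre the form is a quadratic polynomial in xi, and its
    derivative is minus the pairing with the Christoffel term shifted projectively by xi itself. *)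
Lemma derive_wform_fibre y w u v : UU y ->
  'D_(row_mx 0 w) (fun y => wform y u v) y = - ev w (pw_base y u v).
Proof.
move=> Uy; rewrite derive_wform // row_mxKl row_mxKr /pw_base /shift_by.
have dG : differentiable (fun x => G x u v) (lsubmx y) by exact: (lc_diff u v lG Uy).
have dS : differentiable (fun x => S x u v) (lsubmx y) by exact: (smooth_diff (Ssm u v) Uy).
rewrite !derive0 (lin0 (ev_linr _)) !(linD (ev_linr w)) !(linZ (ev_linr w)) -![_ *: _]/(_ * _); ring.
Qed.

Lemma row_mx_linl : lin (fun w : 'rV[R]_n => row_mx w (0 : 'rV[R]_n)).
Proof. by move=> k u v; rewrite scale_row_mx add_row_mx scaler0 addr0. Qed.

Lemma ev_pw_fibre y X Y w : UU y -> let u := lsubmx X in let v := lsubmx Y in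
  ev (\row_k pw_fibre y X Y k) w =
  'D_X (fun y => wform y v w) y + 'D_Y (fun y => wform y u w) y
  - 'D_(row_mx w 0) (fun y => wform y u v) y - 2 * wform y (pw_base y u v) w.
Proof.
move=> Uy u v.
pose f w : R := 'D_X (fun y => wform y v w) y + 'D_Y (fun y => wform y u w) y
  - 'D_(row_mx w 0) (fun y => wform y u v) y - 2 * wform y (pw_base y u v) w.
apply: (@ev_coord_lin _ _ id f) => k w1 w2.
rewrite /f (derive_wform_linr _ _ Uy) (derive_wform_linr _ _ Uy) row_mx_linl.
rewrite (derive_wform_dir _ _ Uy) (wform_bilin Uy).1.
exact: fibre_lin_aux.
Qed.

(** For a base vector Z this is the definition of [pw_fibre]. For a fibre vector the first two
    derivatives drop out and [derive_wform_fibre] gives the third. *)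
Lemma koszul y X Y Z : UU y -> 2 * pw_form y (pw_conn y X Y) Z =
  'D_X (fun y => wform y (lsubmx Y) (lsubmx Z)) y + 'D_Y (fun y => wform y (lsubmx X) (lsubmx Z)) y
  - 'D_Z (fun y => wform y (lsubmx X) (lsubmx Y)) y.
Proof.
move=> Uy; rewrite /pw_form /pw_conn row_mxKl row_mxKr (ev_pw_fibre _ _ _ Uy).
have -> : 'D_Z (fun y => wform y (lsubmx X) (lsubmx Y)) y =
    'D_(row_mx (lsubmx Z) 0) (fun y => wform y (lsubmx X) (lsubmx Y)) y
    - ev (rsubmx Z) (pw_base y (lsubmx X) (lsubmx Y)).
  rewrite -derive_wform_fibre // -(linD (derive_wform_dir _ _ Uy)).
  by rewrite add_row_mx addr0 add0r hsubmxK.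
by field.
Qed.

Lemma pw_form_sym y X Y : UU y -> pw_form y X Y = pw_form y Y X.
Proof. by move=> Uy; rewrite /pw_form (wform_sym _ _ Uy) [ev _ _ + _]addrC. Qed.

Lemma pw_form_bilin y : UU y -> bilin (pw_form y).
Proof.
move=> Uy; suff l X : lin (pw_form y X).
  by split=> // Y k X Z; rewrite !(pw_form_sym _ Y Uy) l.
move=> k Y Z; rewrite /pw_form lsubmx_lin rsubmx_lin ev_linr ev_linl (wform_bilin Uy).1.
by rewrite -![_ *: _]/(_ * _); ring.
Qed.

Lemma pw_form_smooth X Y : smooth UU (fun y => pw_form y X Y).
Proof.
apply: smoothD => //; first exact: smooth_cst.
exact: wform_smooth.
Qed.

Lemma pw_form_derive y X Y Z : UU y -> 'D_Z (fun y => pw_form y X Y) y =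
  'D_Z (fun y => wform y (lsubmx X) (lsubmx Y)) y.
Proof.
move=> Uy; rewrite /pw_form derive_add //; last exact: wform_diff.
by rewrite derive_cst add0r.
Qed.

(** The sum of two Koszul formulas, in which the derivatives along X and along Y cancel. *)
Lemma pw_conn_metric y X Y Z : UU y -> 'D_Z (fun y => pw_form y X Y) y =
  pw_form y (pw_conn y Z X) Y + pw_form y X (pw_conn y Z Y).
Proof.
move=> Uy; rewrite (pw_form_sym X) // pw_form_derive //.
have k1 := koszul Z X Y Uy; have k2 := koszul Z Y X Uy.
rewrite (derive_wform_sym _ (lsubmx Y) (lsubmx X) Uy) in k2.
exact: koszul_aux k1 k2.
Qed.

(** Fibre vectors detect the base part of X; once that vanishes, [wform] drops out and base vectors
    detect the fibre part. *)
Lemma pw_form_nondeg y X : UU y -> (forall Y, pw_form y X Y = 0) -> X = 0.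
Proof.
move=> Uy H; have l0 : lsubmx X = 0.
  apply/rowP => k; rewrite [in RHS]mxE -ev_delta.
  have := H (row_mx 0 (delta_mx 0 k)); rewrite /pw_form row_mxKl row_mxKr.
  rewrite (lin0 (ev_linr _)) (lin0 ((wform_bilin Uy).1 _)) add0r addr0.
  by move=> /eqP; rewrite mulf_eq0 invr_eq0 pnatr_eq0 /= => /eqP.
have r0 : rsubmx X = 0.
  apply/rowP => k; rewrite [in RHS]mxE -ev_deltar.
  have := H (row_mx (delta_mx 0 k) 0); rewrite /pw_form row_mxKl row_mxKr l0.
  rewrite (lin0 (ev_linr _)) (lin0 ((wform_bilin Uy).2 _)) !addr0.
  by move=> /eqP; rewrite mulf_eq0 invr_eq0 pnatr_eq0 /= => /eqP.
by rewrite -(hsubmxK X) l0 r0 row_mx0.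
Qed.

End Model.

(** * Ricci tensor through divergence and traces of the connection *)

Section Trace_formula.
Context {R : realType} {n : nat}.
Variables (U : set 'rV[R]_n) (G : 'rV[R]_n -> 'rV[R]_n -> 'rV[R]_n -> 'rV[R]_n).
Hypotheses (oU : open U) (lG : local_connection U G).

Lemma trc4 (f1 f2 f3 f4 : 'rV[R]_n -> 'rV[R]_n) :
  trc (fun z => f1 z - f2 z + f3 z - f4 z) = trc f1 - trc f2 + trc f3 - trc f4.
Proof. by rewrite !(trcD, trcN). Qed.

Lemma congr4_aux (V : zmodType) (a a' b b' c c' d d' : V) :
  a = a' -> b = b' -> c = c' -> d = d' -> a - b + c - d = a' - b' + c' - d'.
Proof. by move=> -> -> -> ->. Qed.

Lemma half_sum_aux (F : realFieldType) (d p q g h : F) :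
  2^-1 * ((d - p + g - h) + (d - q + g - h)) = d - 2^-1 * (p + q) + g - h.
Proof. by field. Qed.

Lemma diff_aux (F : realFieldType) (d p q g h : F) :
  (d - p + g - h) - (d - q + g - h) = q - p.
Proof. by ring. Qed.

Definition divg x u v : R := trc (fun z => 'D_z (fun y => G y u v) x).
Definition dtr x w v : R := trc (fun z => 'D_w (fun y => G y v z) x).

(** The symmetry of G brings z to the last slot wherever it is an argument of G, so that traces of
    G(w, .) and their derivatives appear. *)
Lemma ricc_expand x u v : U x -> ricc G x u v =
  divg x u v - dtr x u v + trc (G x (G x u v)) - trc (fun z => G x u (G x v z)).
Proof.
move=> Ux; apply: etrans (trc4 (fun z => 'D_z (fun y => G y u v) x)
  (fun z => 'D_u (fun y => G y z v) x) (fun z => G x z (G x u v)) (fun z => G x u (G x z v))) _.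
apply: congr4_aux.
- by [].
- apply: eq_trc => z; apply: near_eq_derive; apply: (open_near oU Ux) => y Uy.
  exact: (lc_sym lG).
- by apply: eq_trc => z; rewrite (lc_sym lG z).
- by apply: eq_trc => z; rewrite (lc_sym lG z).
Qed.

Lemma divg_sym x u v : U x -> divg x u v = divg x v u.
Proof.
move=> Ux; apply: eq_trc => z; apply: near_eq_derive; apply: (open_near oU Ux) => y Uy.
exact: (lc_sym lG).
Qed.

Lemma dtrE x w v : U x -> dtr x w v = 'D_w (fun y => trc (G y v)) x.
Proof.
move=> Ux; have d z := lc_diff v z lG Ux.
rewrite derive_bigsum; last by move=> k; exact: diff_coord.
by apply: eq_bigr => k _; rewrite derive_coord.
Qed.

Lemma trc_comp_sym x u v : U x -> trc (fun z => G x u (G x v z)) = trc (fun z => G x v (G x u z)).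
Proof. by move=> Ux; apply: trcC; exact: (lc_lin lG). Qed.

Lemma ricc_sym_expand x u v : U x -> 2^-1 * (ricc G x u v + ricc G x v u) =
  divg x u v - 2^-1 * (dtr x u v + dtr x v u) + trc (G x (G x u v)) - trc (fun z => G x u (G x v z)).
Proof.
move=> Ux; rewrite !ricc_expand // (divg_sym v) // (lc_sym lG v) // (trc_comp_sym v u) //.
exact: half_sum_aux.
Qed.

(** The divergence and both quadratic terms are symmetric in u and v and cancel; the two derivatives
    of tr G remain. *)
Lemma ricc_alt_expand x u v : U x -> ricc G x u v - ricc G x v u = dtr x v u - dtr x u v.
Proof.
move=> Ux; rewrite !ricc_expand // (divg_sym v) // (lc_sym lG v) // (trc_comp_sym v u) //.
exact: diff_aux.
Qed.

End Trace_formula.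

Lemma trc_split {R : realType} {n : nat} (f : 'rV[R]_(n + n) -> 'rV[R]_(n + n)) :
  trc f = trc (fun z => lsubmx (f (row_mx z 0))) + trc (fun z => rsubmx (f (row_mx 0 z))).
Proof.
rewrite /trc big_split_ord /=; congr (_ + _); apply: eq_bigr => k _.
  by rewrite mxE delta_mx_lshift.
by rewrite mxE delta_mx_rshift.
Qed.

(** * Ricci tensor of the metric in a canonical chart *)

Section Model_ricci.
Context {R : realType} {n : nat}.
Implicit Types (x u v w : 'rV[R]_n) (y X Y Z : 'rV[R]_(n + n)).
Variables (U : set 'rV[R]_n) (G : 'rV[R]_n -> 'rV[R]_n -> 'rV[R]_n -> 'rV[R]_n)
  (S : 'rV[R]_n -> 'rV[R]_n -> 'rV[R]_n -> R).
Hypotheses (oU : open U) (lG : local_connection U G)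
  (Sbil : forall x, U x -> bilin (S x)) (Ssym : forall x u v, U x -> S x u v = S x v u)
  (Ssm : forall u v, smooth U (fun x => S x u v)).

Let UU : set 'rV[R]_(n + n) := [set y | U (lsubmx y)].
Let oUU : open UU. Proof. exact: cyl_open. Qed.
Let lP : local_connection UU (pw_conn G S) := pw_conn_lc oU lG Sbil Ssym Ssm.

Lemma pw_base0 y u : UU y -> pw_base G y u 0 = 0.
Proof. by move=> Uy; exact: lin0 (pw_base_lin lG u Uy). Qed.

Lemma pw_fibre_vertical y X z k : UU y ->
  pw_fibre G S y X (row_mx 0 z) k = - ev z (pw_base G y (lsubmx X) (delta_mx 0 k)).
Proof.
move=> Uy; rewrite /pw_fibre row_mxKl (derive_wform_fibre lG Ssm) // pw_base0 //.
rewrite (lin0 (derive_wform_linl oU lG Sbil Ssm X (delta_mx 0 k) Uy)).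
rewrite (lin0 (derive_wform_linr oU lG Sbil Ssm (row_mx (delta_mx 0 k) 0) (lsubmx X) Uy)).
by rewrite (lin0 ((wform_bilin lG Sbil Uy).2 _)) mulr0 !subr0 add0r.
Qed.

(** Vertical vectors stay vertical, and on them the operator is minus the transpose of the base
    block [pw_base]. The trace identities below rest on this. *)
Lemma pw_conn_vertical y X z : UU y -> pw_conn G S y X (row_mx 0 z) =
  row_mx 0 (\row_k - ev z (pw_base G y (lsubmx X) (delta_mx 0 k))).
Proof.
move=> Uy; rewrite /pw_conn row_mxKl pw_base0 //; congr row_mx.
by apply/rowP => k; rewrite !mxE pw_fibre_vertical.
Qed.

Lemma trc_pw_conn y X : UU y -> trc (pw_conn G S y X) = 0.
Proof.
move=> Uy; rewrite trc_split.
rewrite (eq_trc (g := pw_base G y (lsubmx X))); last first.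
  by move=> z; rewrite /pw_conn !row_mxKl.
rewrite addrC (eq_trc (g := fun z => \row_k - ev z (pw_base G y (lsubmx X) (delta_mx 0 k)))).
  rewrite /trc -big_split /= big1 // => k _.
  by rewrite mxE ev_delta addNr.
by move=> z; rewrite pw_conn_vertical // row_mxKr.
Qed.

Lemma dtr_pw_conn y X Y : UU y -> dtr (pw_conn G S) y X Y = 0.
Proof.
move=> Uy; rewrite (dtrE lP) // -(derive_cst (0 : R) y X).
apply: near_eq_derive; apply: (open_near oUU Uy) => z Uz; exact: trc_pw_conn.
Qed.

(** The operators are block triangular. In the product of the two fibre blocks the signs cancel and
    transposition reverses the order, which the trace does not see; hence the factor 2. *)
Lemma trc_pw_conn2 y X Y : UU y ->
  trc (fun Z => pw_conn G S y X (pw_conn G S y Y Z)) =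
  2 * trc (fun z => pw_base G y (lsubmx X) (pw_base G y (lsubmx Y) z)).
Proof.
move=> Uy; rewrite trc_split.
set u := lsubmx X; set v := lsubmx Y.
rewrite (eq_trc (g := fun z => pw_base G y u (pw_base G y v z))); last first.
  by move=> z; rewrite /pw_conn !row_mxKl.
pose bt w (z : 'rV[R]_n) : 'rV[R]_n := \row_k - ev z (pw_base G y w (delta_mx 0 k)).
rewrite [X in _ + X](eq_trc (g := fun z => bt u (bt v z))); last first.
  by move=> z; rewrite pw_conn_vertical // pw_conn_vertical // row_mxKr.
suff -> : trc (fun z => bt u (bt v z)) = trc (fun z => pw_base G y u (pw_base G y v z)).
  by rewrite mulr_natl mulr2n.
have E k : bt u (bt v (delta_mx 0 k)) 0 k = pw_base G y v (pw_base G y u (delta_mx 0 k)) 0 k.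
  have btE w z j : bt w z 0 j = - ev z (pw_base G y w (delta_mx 0 j)) by rewrite /bt mxE.
  rewrite btE evE (lin_row (pw_base G y u _) (pw_base_lin lG v Uy)) summxE -sumrN.
  apply: eq_bigr => j _; rewrite btE ev_delta mulNr opprK mulrC.
  by rewrite [RHS]mxE.
rewrite /trc (eq_bigr _ (fun k _ => E k)).
by apply: (@trcC _ _ (pw_base G y v) (pw_base G y u)); exact: (pw_base_lin lG).
Qed.

Lemma derive_pw_base y Z u v : UU y -> 'D_Z (fun y => pw_base G y u v) y =
  'D_(lsubmx Z) (fun x => G x u v) (lsubmx y) + ev (rsubmx Z) v *: u + ev (rsubmx Z) u *: v.
Proof.
move=> Uy; have dG : differentiable (fun x => G x u v) (lsubmx y) by exact: (lc_diff u v lG Uy).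
have dGl := diff_lsub_comp dG; have dr := @diff_rsub R n y.
have de w : differentiable (fun y => ev (rsubmx y) w) y.
  by apply: (@diff_ev _ _ _ (@rsubmx R 1 n n) (fun=> w)).
have dez w z : differentiable (fun y => ev (rsubmx y) w *: z) y by exact: differentiableZl.
have dE w z : 'D_Z (fun y => ev (rsubmx y) w *: z) y = ev (rsubmx Z) w *: z.
  rewrite deriveE // diffZl // -deriveE // derive_ev_cst //.
  by rewrite derive_rsub.
rewrite /pw_base /shift_by derive_add //; last exact: diff_add.
by rewrite derive_add // !dE (derive_lsub_comp _ dG).
Qed.

(** Exchanging the two derivatives lets the vertical one act first, where [derive_wform_fibre] gives
    it in closed form. *)
Lemma derive2_wform y X z u v : UU y ->
  'D_(row_mx 0 z) ('D_X (fun y => wform G S y u v)) y =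
  - ev z ('D_(lsubmx X) (fun x => G x u v) (lsubmx y) + ev (rsubmx X) v *: u + ev (rsubmx X) u *: v).
Proof.
move=> Uy; rewrite (schwarz _ _ oUU Uy (wform_smooth oU lG Ssm u v)).
have db : differentiable (fun y => pw_base G y u v) y by exact: (smooth_diff (pw_base_smooth oU lG u v)).
transitivity ('D_X (fun y => - ev (pw_base G y u v) z) y).
  apply: near_eq_derive; apply: (open_near oUU Uy) => y' Uy'.
  by rewrite (derive_wform_fibre lG Ssm) // evC.
rewrite derive_opp; last by apply: (@diff_ev _ _ _ (fun y => pw_base G y u v) (fun=> z)).
by rewrite derive_ev_cst // derive_pw_base // evC.
Qed.

Lemma derive_pw_fibre y X Y z k : UU y -> let u := lsubmx X in let v := lsubmx Y in
  let e := delta_mx 0 k in let x := lsubmx y in let A := pw_base G y u v in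
  'D_(row_mx 0 z) (fun y => pw_fibre G S y X Y k) y =
  - ev z ('D_u (fun x => G x v e) x + ev (rsubmx X) e *: v + ev (rsubmx X) v *: e)
  - ev z ('D_v (fun x => G x u e) x + ev (rsubmx Y) e *: u + ev (rsubmx Y) u *: e)
  + ev z ('D_e (fun x => G x u v) x)
  - 2 * (- ev z (pw_base G y A e) + wform G S y (ev z v *: u + ev z u *: v) e).
Proof.
move=> Uy u v e x A.
have sw := wform_smooth oU lG Ssm.
have dD Z w w' : differentiable ('D_Z (fun y => wform G S y w w')) y.
  exact: (smooth_diff (smooth_D Z (sw w w'))).
have db : differentiable (fun y => pw_base G y u v) y by exact: (smooth_diff (pw_base_smooth oU lG u v)).
have dw w w' := wform_diff oU lG Ssm w w' Uy.
have nb := wform_near oU lG Sbil Uy.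
have dc : differentiable (fun=> e : 'rV[R]_n) y by exact: differentiable_cst.
have dwb : differentiable (fun y => wform G S y (pw_base G y u v) e) y.
  exact: (bil_app_diff nb dw db dc).
rewrite /pw_fibre derive_sub; first last.
- exact: differentiableZ.
- by apply: diff_sub => //; exact: diff_add.
rewrite derive_sub //; last exact: diff_add.
rewrite derive_add // !derive2_wform // row_mxKl row_mxKr.
rewrite (@derive_scale _ _ _ 2 (fun y => wform G S y (pw_base G y u v) e)) //.
rewrite (bil_app_derive (row_mx 0 z) nb dw db dc) derive_cst (lin0 ((wform_bilin lG Sbil Uy).1 _)) addr0.
rewrite (derive_wform_fibre lG Ssm) // derive_pw_base // row_mxKl row_mxKr derive0 add0r.
by rewrite !(lin0 (ev_linl _)) !scale0r !addr0 opprK.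
Qed.

(** Base components are differentiated along base vectors and fibre components along fibre vectors.
    Each kind contributes one copy of [divg G], and the second also the coefficient n + 1 that
    becomes the Einstein constant. *)
Lemma divg_pw_conn y X Y : UU y -> let u := lsubmx X in let v := lsubmx Y in
  let x := lsubmx y in
  divg (pw_conn G S) y X Y = 2 * divg G x u v - dtr G x u v - dtr G x v u
   - (n%:R + 1) * (ev (rsubmx X) v + ev (rsubmx Y) u)
   + 2 * trc (pw_base G y (pw_base G y u v)) - 4 * wform G S y u v.
Proof.
move=> Uy u v x; apply: etrans (trc_split _) _.
have dL : differentiable (fun y => pw_conn G S y X Y) y by exact: (lc_diff X Y lP).
have db : differentiable (fun y => pw_base G y u v) y by exact: (smooth_diff (pw_base_smooth oU lG u v)).
rewrite [X in X + _ = _](_ : _ = divg G x u v); last first.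
  apply: eq_bigr => k _; rewrite mxE -derive_coord //.
  have -> : (fun y' => pw_conn G S y' X Y 0 (lshift n k)) = (fun y' => pw_base G y' u v 0 k).
    by apply/funext => y'; rewrite /pw_conn row_mxEl.
  rewrite derive_coord // derive_pw_base // row_mxKl row_mxKr.
  by rewrite !(lin0 (ev_linl _)) !scale0r !addr0.
set A := pw_base G y u v.
pose t1 (p q : 'rV[R]_n) (Z : 'rV[R]_(n + n)) z :=
   'D_p (fun x => G x q z) x + ev (rsubmx Z) z *: q + ev (rsubmx Z) q *: z.
rewrite [X in _ + X = _](_ : _ = \sum_k (- t1 u v X (delta_mx 0 k) 0 k - t1 v u Y (delta_mx 0 k) 0 k
   + ('D_(delta_mx 0 k) (fun x => G x u v) x) 0 k
   - 2 * (- (pw_base G y A (delta_mx 0 k) 0 k) + (v 0 k * wform G S y u (delta_mx 0 k) + u 0 k * wform G S y v (delta_mx 0 k))))); last first.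
  apply: eq_bigr => k _; rewrite mxE -(derive_coord (row_mx 0 (delta_mx 0 k)) (rshift n k) dL).
  have -> : (fun y' => pw_conn G S y' X Y 0 (rshift n k)) = (fun y' => pw_fibre G S y' X Y k).
    by apply/funext => y'; rewrite /pw_conn row_mxEr mxE.
  rewrite derive_pw_fibre // !ev_delta.
  have [_ b2] := wform_bilin lG Sbil Uy.
  by rewrite (linD (b2 _)) !(linZ (b2 _)).
rewrite !big_split /= !sumrN -!mulr_sumr big_split /= sumrN big_split /=.
have [b1 b2] := wform_bilin lG Sbil Uy.
have -> : \sum_i v 0 i * wform G S y u (delta_mx 0 i) = wform G S y u v by rewrite (lin_row v (b1 u)).
have -> : \sum_i u 0 i * wform G S y v (delta_mx 0 i) = wform G S y u v.
  by rewrite (wform_sym lG Ssym u v Uy) (lin_row u (b1 v)).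
(* Here n is the trace of the multiple of the identity and 1 that of the rank-one term. *)
have T p q Z : \sum_i t1 p q Z (delta_mx 0 i) 0 i = dtr G x p q + (n%:R + 1) * ev (rsubmx Z) q.
  transitivity (trc (t1 p q Z)) => //.
  rewrite /t1 !trcD trc_rank1; last exact: ev_linr.
  by rewrite trcZ trc_id /dtr; ring.
rewrite !T.
have -> : \sum_i ('D_(delta_mx 0 i) (fun x0 => G x0 u v) x : 'rV[R]_n) 0 i = divg G x u v by [].
have -> : \sum_i pw_base G y A (delta_mx 0 i) 0 i = trc (pw_base G y A) by [].
move: (divg _ _ _ _) (dtr _ _ _ _) (dtr _ _ _ _) (ev _ _) (ev _ _) (trc _) (wform _ _ _ _ _) => d p q a b t w.
ring.
Qed.

Hypothesis n2 : (2 <= n)%N.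
Hypothesis S_schouten : forall x u v, U x ->
  S x u v = (n%:R - 1)^-1 * (2^-1 * (ricc G x u v + ricc G x v u)).

(* The endomorphisms [pw_conn y X] are trace free, their diagonal blocks being negative transposes of each other.
   So the Ricci tensor is the divergence of pw_conn minus the trace of a product. *)
Lemma ricc_pw_conn y X Y : UU y ->
  ricc (pw_conn G S) y X Y = - (2 * (n%:R + 1)) * pw_form G S y X Y.
Proof.
move=> Uy; rewrite (ricc_expand oUU lP) // dtr_pw_conn // trc_pw_conn // trc_pw_conn2 //.
rewrite divg_pw_conn // /pw_form.
set u := lsubmx X; set v := lsubmx Y; set x := lsubmx y; set xi := rsubmx y.
have gl w : lin (G x w) by exact: (lc_lin lG).
have gs w z : G x w z = G x z w by exact: (lc_sym lG).
rewrite /pw_base !trc_shift // trc_shift2 // -/x -/xi.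
have n1 : n%:R - 1 != 0 :> R by rewrite subr_eq0 pnatr_eq1 gtn_eqF.
(* The definition of S is solved for the divergence, with n - 1 invertible as n is at least 2. After
   this substitution only an identity between scalars is left. *)
have HS : (n%:R - 1) * S x u v = divg G x u v - 2^-1 * (dtr G x u v + dtr G x v u)
   + trc (G x (G x u v)) - trc (fun z => G x u (G x v z)).
  by rewrite S_schouten // mulVKf // (ricc_sym_expand oU lG).
rewrite /wform -/x -/xi {1 2}/shift_by.
have tl : lin (fun w => trc (G x w)).
  move=> k w z; rewrite /trc scaler_sumr -big_split; apply: eq_bigr => j _ /=.
  by rewrite (lc_linl _ lG) // !mxE.
rewrite !(linD tl) !(linZ tl) !(linD (ev_linr xi)) !(linZ (ev_linr xi)).
rewrite -![_ *: _]/(_ * _).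
move: HS; move: (S x u v) (divg G x u v) (dtr G x u v) (dtr G x v u) (ev xi u) (ev xi v)
  (ev xi (G x u v)) (trc (G x u)) (trc (G x v)) (trc (G x (G x u v))) (trc (fun z => G x u (G x v z)))
  (ev (rsubmx X) v) (ev (rsubmx Y) u).
move=> s d p q a b c e f g h k l HS.
have {HS} -> : d = (n%:R - 1) * s + 2^-1 * (p + q) - g + h by rewrite HS; ring.
by field.
Qed.

End Model_ricci.

(** * Projective changes of connection *)

Section Projective_change.
Context {R : realType} {n : nat}.
Variables (U : set 'rV[R]_n) (G G' : 'rV[R]_n -> 'rV[R]_n -> 'rV[R]_n -> 'rV[R]_n)
  (ups : 'rV[R]_n -> 'rV[R]_n).
Hypotheses (oU : open U) (lG : local_connection U G) (lG' : local_connection U G')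
  (su : smooth U ups) (G'E : forall x u v, U x -> G' x u v = shift_by (G x) (ups x) u v).
Hypothesis n2 : (2 <= n)%N.

(** The symmetric part of the projective Schouten tensor in a chart; its alternating part is
    [altl]. *)
Definition schl (F : 'rV[R]_n -> 'rV[R]_n -> 'rV[R]_n -> 'rV[R]_n) x u v : R :=
  (n%:R - 1)^-1 * (2^-1 * (ricc F x u v + ricc F x v u)).

Lemma schl_proj_aux (F : fieldType) (nn d p q t h t1 t2 a b du dv g : F) : nn - 1 != 0 -> (2 : F) != 0 ->
  (nn - 1)^-1 * ((d + (du + dv)) - 2^-1 * ((p + (nn + 1) * du) + (q + (nn + 1) * dv))
   + (t + b * t1 + a * t2 + (nn + 1) * (g + b * a + a * b))
   - (h + 2 * g + b * t1 + a * t2 + (nn + 3) * (a * b))) =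
  (nn - 1)^-1 * (d - 2^-1 * (p + q) + t - h) - 2^-1 * (du + dv) + g + a * b.
Proof. by move=> n1 t0; field; rewrite n1 t0. Qed.

Lemma schl_projective x u v : U x -> schl G' x u v = schl G x u v
  - 2^-1 * (ev ('D_u ups x) v + ev ('D_v ups x) u) + ev (ups x) (G x u v)
  + ev (ups x) u * ev (ups x) v.
Proof.
move=> Ux; have du := smooth_diff su Ux.
have n1 : n%:R - 1 != 0 :> R by rewrite subr_eq0 pnatr_eq1 gtn_eqF.
have nG w z := lc_diff w z lG Ux.
have de w : differentiable (fun y => ev (ups y) w) x by exact: (@diff_ev _ _ _ ups (fun=> w)).
have gl w : lin (G x w) by exact: (lc_lin lG).
have gs w z : G x w z = G x z w by exact: (lc_sym lG).
have divE : divg G' x u v = divg G x u v + (ev ('D_u ups x) v + ev ('D_v ups x) u).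
  have E z : 'D_z (fun y => G' y u v) x =
      'D_z (fun y => G y u v) x + ev ('D_z ups x) v *: u + ev ('D_z ups x) u *: v.
    transitivity ('D_z (fun y => G y u v + ev (ups y) v *: u + ev (ups y) u *: v) x).
      by apply: near_eq_derive; apply: (open_near oU Ux) => y Uy; rewrite G'E.
    have dez w w' : differentiable (fun y => ev (ups y) w *: w') x by exact: differentiableZl.
    have dE w w' : 'D_z (fun y => ev (ups y) w *: w') x = ev ('D_z ups x) w *: w'.
      by rewrite deriveE // diffZl // -deriveE // derive_ev_cst.
    rewrite derive_add //; last exact: diff_add.
    by rewrite derive_add // !dE.
  have l w : lin (fun z => ev ('D_z ups x) w) by move=> k z z'; rewrite derive_dir_lin // ev_linl.
  by rewrite /divg (eq_trc E) !trcD !trc_rank1 // addrA.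
have dtrE' p q : dtr G' x p q = dtr G x p q + (n%:R + 1) * ev ('D_p ups x) q.
  rewrite (dtrE lG') // (dtrE lG) //.
  have dt : differentiable (fun y => trc (G y q)) x.
    by apply: diff_sum => k; apply: diff_coord.
  transitivity ('D_p (fun y => trc (G y q) + (n%:R + 1) * ev (ups y) q) x).
    apply: near_eq_derive; apply: (open_near oU Ux) => y Uy.
    by rewrite (eq_trc (fun z => G'E q z Uy)) trc_shift.
  rewrite derive_add //; last exact: differentiableZ.
  by rewrite (@derive_scale _ _ _ (n%:R + 1) (fun y => ev (ups y) q)) // derive_ev_cst.
have tl : lin (fun w => trc (G x w)).
  move=> k w z; rewrite /trc scaler_sumr -big_split; apply: eq_bigr => j _ /=.
  by rewrite (lc_linl _ lG) // !mxE.
have tE : trc (G' x (G' x u v)) = trc (G x (G x u v)) + ev (ups x) v * trc (G x u) + ev (ups x) u * trc (G x v)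
   + (n%:R + 1) * (ev (ups x) (G x u v) + ev (ups x) v * ev (ups x) u + ev (ups x) u * ev (ups x) v).
  rewrite (eq_trc (fun z => G'E _ z Ux)) trc_shift G'E //.
  rewrite /shift_by !(linD tl) !(linZ tl) !(linD (ev_linr (ups x))) !(linZ (ev_linr (ups x))).
  by rewrite -![_ *: _]/(_ * _).
have t2E : trc (fun z => G' x u (G' x v z)) = trc (fun z => G x u (G x v z)) + 2 * ev (ups x) (G x u v)
   + ev (ups x) v * trc (G x u) + ev (ups x) u * trc (G x v) + (n%:R + 3) * (ev (ups x) u * ev (ups x) v).
  rewrite -(trc_shift2 (ups x) gl gs u v); apply: eq_trc => z.
  by rewrite !G'E.
rewrite /schl (ricc_sym_expand oU lG') // (ricc_sym_expand oU lG) // divE !dtrE' tE t2E.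
by apply: schl_proj_aux => //; rewrite pnatr_eq0.
Qed.

Lemma pw_form_proj_aux (F : realFieldType) (xy yx du dv g s s' a b p q xg xy' yx' z p' q' xg' g' : F) :
  s' = s - 2^-1 * (du + dv) + g + a * b ->
  xy' = xy - du -> yx' = yx - dv -> z = xg' - g' -> p' = p - a -> q' = q - b ->
  xg' = xg + b * p + a * q -> g' = g + b * a + a * b ->
  2^-1 * (xy + yx) + (- xg - s - p * q) = 2^-1 * (xy' + yx') + (- z - s' - p' * q').
Proof. by move=> -> -> -> -> -> -> -> ->; lra. Qed.

Lemma pw_form_row F (S : 'rV[R]_n -> 'rV[R]_n -> 'rV[R]_n -> R) (x xi u a v b : 'rV[R]_n) :
  pw_form F S (row_mx x xi) (row_mx u a) (row_mx v b) =
  2^-1 * (ev a v + ev b u) + (- ev xi (F x u v) - S x u v - ev xi u * ev xi v).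
Proof. by rewrite /pw_form /wform !row_mxKl !row_mxKr. Qed.

(** The map (x, xi) |-> (x, xi - ups x) has differential (u, a) |-> (u, a - D_u ups), whose
    derivatives of ups offset those in the Schouten tensor. Terms mixing xi and ups come from [G']
    and from the square, with opposite signs. *)
Lemma pw_form_projective (x xi u a v b : 'rV[R]_n) : U x ->
  pw_form G (schl G) (row_mx x xi) (row_mx u a) (row_mx v b) =
  pw_form G' (schl G') (row_mx x (xi - ups x)) (row_mx u (a - 'D_u ups x)) (row_mx v (b - 'D_v ups x)).
Proof.
move=> Ux; apply: etrans (pw_form_row _ _ _ _ _ _ _ _) (etrans _ (esym (pw_form_row _ _ _ _ _ _ _ _))).
have el w : lin (ev ^~ w : 'rV[R]_n -> R) by exact: ev_linl.
have er w : lin (ev w : 'rV[R]_n -> R) by exact: ev_linr.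
have E (w : 'rV[R]_n) : ev w (G' x u v) = ev w (G x u v) + ev (ups x) v * ev w u + ev (ups x) u * ev w v.
  by rewrite G'E // /shift_by !(linD (er w)) !(linZ (er w)).
have B (w w' z : 'rV[R]_n) : ev (w - w') z = ev w z - ev w' z := linB (el z) w w'.
exact: (pw_form_proj_aux (schl_projective u v Ux) (B a _ v) (B b _ u) (B xi _ (G' x u v)) (B xi _ u) (B xi _ v) (E xi) (E (ups x))).
Qed.

End Projective_change.

(** * Ordinary differential equations *)

Section Primitive.
Context {R : realType}.

(** Integration starts at -1 so that 0 is interior to the interval of the fundamental theorem of
    calculus; hence the requirement h < 1 below. *)
Lemma primitive_ex (g : R -> R) : continuous g ->
  exists P : R -> R, P 0 = 0 /\ forall t : R, -1 < t < 1 -> is_derive t 1 P (g t).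
Proof.
move=> cg; pose mu := @lebesgue_measure R.
pose F (x : R) := (\int[mu]_(t in `[-1, x]) g t)%R.
exists (fun x => F x - F 0); split; first by rewrite subrr.
move=> t /andP[t1 t2].
have ig : mu.-integrable `[-1, 1] (EFin \o g).
  apply: continuous_compact_integrable; first exact: segment_compact.
  by apply: continuous_subspaceT.
have [dF FE] := continuous_FTC1_closed t2 ig t1 (cg t).
have dF' : is_derive t 1 F (g t) := DeriveDef dF (etrans (esym (derive1E F t)) FE).
by apply: is_derive_eq; rewrite subr0.
Qed.

Lemma row_norm_le m (u : 'rV[R]_m) (c : R) : 0 <= c -> (forall j, `|u 0 j| <= c) -> `|u| <= c.
Proof.
move=> c0 uc; rewrite /Num.Def.normr /= mx_normrE; apply: bigmax_le => // -[i j] _.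
by rewrite ord1.
Qed.

Lemma row_coord_le m (u : 'rV[R]_m) j : `|u 0 j| <= `|u|.
Proof.
rewrite [leRHS]/Num.Def.normr /= mx_normrE.
exact: (le_bigmax _ (fun ij : 'I_1 * 'I_m => `|u ij.1 ij.2|) (0, j)).
Qed.

(** Primitives are estimated through the mean value theorem, which makes inequalities between
    integrals unnecessary. *)
Lemma MVT_lip (P g : R -> R) (K h s t : R) :
  (forall x : R, `|x| <= h -> is_derive x 1 P (g x)) -> (forall x : R, `|x| <= h -> `|g x| <= K) ->
  `|s| <= h -> `|t| <= h -> `|P t - P s| <= K * `|t - s|.
Proof.
move=> dP gK sh th.
have inb a : 0 <= a <= 1 -> `|s + a *: (t - s)| <= h.
  move=> /andP[a0 a1]; move: sh th; rewrite !ler_norml => /andP[s1 s2] /andP[t1 t2].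
  rewrite -[a *: _]/(a * _); apply/andP; split; nra.
have dfP x : `|x| <= h -> differentiable P x.
  by move=> /dP dx; apply/derivable1_diffP; case: dx.
have [a a01] := @MVT_line R R P s (t - s) 1 ltr01 (fun a a01 => dfP _ (inb a a01)).
rewrite scale1r [s + (t - s)]addrC subrK mulr1 => ->.
have ax := inb a a01; have dx := dP _ ax.
have -> : 'D_(t - s) P (s + a *: (t - s)) = (t - s) * g (s + a *: (t - s)).
  rewrite deriveE; last exact: dfP.
  rewrite -[X in 'd _ _ X]mulr1 -[(t - s) * 1]/((t - s) *: (1 : R)) linearZ /= -deriveE; last exact: dfP.
  by case: dx => _ ->.
rewrite normrM mulrC ler_wpM2r // gK //.
Qed.

(** Completeness by nested intervals: with [d k] twice the k-th bound, u k - d k increases and u k +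
    d k decreases, so the supremum of the lower ends lies in every interval. *)
Lemma geometric_limit (u : nat -> R) (C : R) :
  (forall k, `|u k.+1 - u k| <= C * 2^-1 ^+ k) ->
  exists l, forall k, `|l - u k| <= 2 * C * 2^-1 ^+ k.
Proof.
move=> uC; pose d k := 2 * C * 2^-1 ^+ k.
have C0 : 0 <= C by have := le_trans (normr_ge0 _) (uC 0%N); rewrite expr0 mulr1.
have dS k : d k.+1 = d k - C * 2^-1 ^+ k by rewrite /d exprS; field.
have d0 k : 0 <= d k by rewrite /d !mulr_ge0 // exprn_ge0 // invr_ge0.
have step k : `|u k.+1 - u k| <= d k - d k.+1 by rewrite dS subKr uC.
have am k j : u k - d k <= u (k + j)%N - d (k + j)%N.
  elim: j => [|j IH]; first by rewrite addn0.
  rewrite addnS; apply: le_trans IH _; have := step (k + j)%N; rewrite ler_norml; lra.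
have bm k j : u (k + j)%N + d (k + j)%N <= u k + d k.
  elim: j => [|j IH]; first by rewrite addn0.
  rewrite addnS; apply: le_trans IH; have := step (k + j)%N; rewrite ler_norml; lra.
have ab k j : u k - d k <= u j + d j.
  apply: (@le_trans _ _ (u (k + j)%N - d (k + j)%N)); first exact: am.
  apply: (@le_trans _ _ (u (k + j)%N + d (k + j)%N)); last by rewrite addnC; exact: bm.
  by have := d0 (k + j)%N; lra.
pose E := range (fun k => u k - d k).
have E0 : E !=set0 by exists (u 0%N - d 0%N); exists 0%N.
have Eub j : ubound E (u j + d j) by move=> _ [k _ <-]; exact: ab.
have hs : has_sup E by split => //; exists (u 0%N + d 0%N).
exists (sup E) => k; rewrite ler_norml -/(d k).
have h1 : u k - d k <= sup E by apply: (ub_le_sup hs.2); exists k.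
have h2 : sup E <= u k + d k by apply: ge_sup.
apply/andP; split; lra.
Qed.

End Primitive.

Lemma choice_ex (X Y : Type) (P : X -> Y -> Prop) :
  (forall x, exists y, P x y) -> exists f : X -> Y, forall x, P x (f x).
Proof. by move=> /choice [f fP]; exists f. Qed.

Section Clamp.
Context {R : realType}.
(** Truncation to [-h, h]. It serves in time, to extend curves by constants, and in space, to make a
    local vector field globally Lipschitz. *)
Definition clampr (h t : R) : R := Num.max (- h) (Num.min h t).

Section Pos.
Variable h : R.
Hypothesis h0 : 0 < h.

Lemma clampr_le t : `|clampr h t| <= h.
Proof.
rewrite ler_norml /clampr; apply/andP; split; first by rewrite le_max lexx.
by rewrite ge_max ge_min lexx /= andbT; move: h0; lra.
Qed.

Lemma clampr_lip t s : `|clampr h t - clampr h s| <= `|t - s|.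
Proof.
have hp := h0.
have tc x : [\/ clampr h x = - h /\ x <= - h, clampr h x = x /\ - h <= x <= h | clampr h x = h /\ h <= x].
  have hh : - h <= h by move: hp; lra.
  rewrite /clampr; have [hx|xh] := leP h x; first by rewrite max_r //; apply: Or33.
  have [hx|xh'] := leP x (- h); first by apply: Or31.
  by apply: Or32; rewrite !ltW.
have main (a b : R) : [\/ clampr h a = - h /\ a <= - h, clampr h a = a /\ - h <= a <= h | clampr h a = h /\ h <= a] ->
  [\/ clampr h b = - h /\ b <= - h, clampr h b = b /\ - h <= b <= h | clampr h b = h /\ h <= b] ->
  a <= b -> clampr h b - clampr h a <= b - a /\ 0 <= clampr h b - clampr h a.
  move: hp => hp [][-> ?] [][-> ?] ?; split; lra.
have [ts|st] : t <= s \/ s <= t by apply/orP; exact: le_total.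
  rewrite (distrC (clampr h t)) (distrC t); have [m1 m2] := main _ _ (tc t) (tc s) ts.
  by rewrite !ger0_norm // subr_ge0.
have [m1 m2] := main _ _ (tc s) (tc t) st.
by rewrite !ger0_norm // subr_ge0.
Qed.

End Pos.

Lemma clampr_id h t : `|t| < h -> clampr h t = t.
Proof.
rewrite ltr_norml => /andP[a b]; rewrite /clampr min_r; last by rewrite ltW.
by rewrite max_r // ltW.
Qed.

End Clamp.

Section Picard.
Context {R : realType} {m : nat}.
Implicit Types (y z : R -> 'rV[R]_m) (t s : R).
Variables (G : 'rV[R]_m -> 'rV[R]_m) (y0 : 'rV[R]_m) (L K h : R).
Hypotheses (h0 : 0 < h) (h1 : h < 1) (Lh : L * h <= 2^-1) (L0 : 0 <= L) (K0 : 0 <= K).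
Hypotheses (GL : forall u v, `|G u - G v| <= L * `|u - v|) (GK : forall u, `|G u| <= K).

Let tau := clampr h.
Let tau_le t : `|tau t| <= h := clampr_le h0 t.
Let tau_lip t s : `|tau t - tau s| <= `|t - s| := clampr_lip h0 t s.
Let tau_id t : `|t| < h -> tau t = t := @clampr_id _ h t.

(** The class in which the iteration runs: Picard iterates lie in it, it is stable under the limit
    taken below, and it supplies the continuity that primitives require. *)
Definition Klip y := forall t s, `|y t - y s| <= K * `|t - s|.

Lemma Klip_continuous y : Klip y -> continuous y.
Proof.
move=> ly t; apply/cvgrPdist_le => e e0.
have K1 : 0 < K + 1 by rewrite ltr_wpDl.
have ee : 0 < e / (K + 1) by apply: divr_gt0.
have ci : (fun s : R => s) s @[s --> t] --> t by exact: cvg_id.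
move/cvgrPdist_le : ci => /(_ _ ee) ci.
near=> s; apply: le_trans (ly _ _) _.
apply: (@le_trans _ _ ((K + 1) * `|t - s|)); first by rewrite ler_wpM2r // lerDl.
rewrite mulrC -ler_pdivlMr //; near: s.
Unshelve. all: by end_near. Qed.

Lemma Klip_comp_continuous y j : Klip y -> continuous (fun t => G (y t) 0 j).
Proof.
move=> ly t; apply/cvgrPdist_le => e e0.
have cy : {for t, continuous y} by exact: Klip_continuous.
have L1 : 0 < L + 1 by rewrite ltr_wpDl.
have ee : 0 < e / (L + 1) by apply: divr_gt0.
move/cvgrPdist_le : cy => /(_ _ ee) cy.
near=> s.
apply: (@le_trans _ _ `|G (y t) - G (y s)|).
  by apply: le_trans (row_coord_le _ j); rewrite !mxE.
apply: le_trans (GL _ _) _; apply: (@le_trans _ _ ((L + 1) * `|y t - y s|)).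
  by rewrite ler_wpM2r // lerDl.
rewrite mulrC -ler_pdivlMr //; near: s.
Unshelve. all: by end_near. Qed.

(* z is the Picard iterate of y on [-h, h], extended by constants so that it is Lipschitz on all of R. *)
Definition picard_rel y z := exists P : 'I_m -> R -> R, [/\ forall j, P j 0 = 0,
  forall j (x : R), `|x| <= h -> is_derive x 1 (P j) (G (y x) 0 j) &
  forall t j, z t 0 j = y0 0 j + P j (tau t)].

Lemma picard_ex y : Klip y -> exists z, picard_rel y z.
Proof.
move=> ly.
have [P HP] : exists P : 'I_m -> R -> R, forall j, P j 0 = 0 /\
    forall t : R, -1 < t < 1 -> is_derive t 1 (P j) (G (y t) 0 j).
  apply: (@choice_ex _ _ (fun j (Q : R -> R) => Q 0 = 0 /\
    forall t : R, -1 < t < 1 -> is_derive t 1 Q (G (y t) 0 j))) => j.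
  have cj : continuous (fun t => G (y t) 0 j) by exact: Klip_comp_continuous.
  by have [Q HQ] := primitive_ex cj; exists Q.
exists (fun t => \row_j (y0 0 j + P j (tau t))), P; split=> [j|j x xh|t j].
- exact: (HP j).1.
- apply: (HP j).2; move: xh h1; rewrite ler_norml => /andP[a b] hh; apply/andP; split; lra.
- by rewrite mxE.
Qed.

Lemma picard_lip y z : picard_rel y z -> Klip z.
Proof.
move=> [P [P0 dP zE]] t s; apply: row_norm_le => [|j]; first by rewrite mulr_ge0.
rewrite !mxE !zE opprD addrACA subrr add0r.
apply: (@le_trans _ _ (K * `|tau t - tau s|)); last by rewrite ler_wpM2l.
apply: (@MVT_lip R (P j) (fun x => G (y x) 0 j) K h) => //.
by move=> x _; apply: le_trans (row_coord_le _ j) (GK _).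
Qed.

Lemma picard_bound y z t : picard_rel y z -> `|z t - y0| <= K * h.
Proof.
move=> [P [P0 dP zE]]; apply: row_norm_le => [|j]; first by rewrite mulr_ge0 // ltW.
rewrite !mxE zE addrC addKr -[P j _]subr0 -(P0 j).
apply: (@le_trans _ _ (K * `|tau t - 0|)); last by rewrite subr0 ler_wpM2l.
apply: (@MVT_lip R (P j) (fun x => G (y x) 0 j) K h) => //.
  by move=> x _; apply: le_trans (row_coord_le _ j) (GK _).
by rewrite normr0 ltW.
Qed.

(** The difference of the primitives has derivative at most L e over a time of at most h, and
    [L * h <= 2^-1]. *)
Lemma picard_contract y z y' z' (e : R) t : 0 <= e -> picard_rel y z -> picard_rel y' z' ->
  (forall s, `|y s - y' s| <= e) -> `|z t - z' t| <= e / 2.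
Proof.
move=> e0 [P [P0 dP zE]] [P' [P'0 dP' zE']] ye.
apply: row_norm_le => [|j]; first by rewrite divr_ge0.
rewrite !mxE zE zE' opprD addrACA subrr add0r.
have -> : P j (tau t) - P' j (tau t) = (P j (tau t) - P' j (tau t)) - (P j 0 - P' j 0).
  by rewrite P0 P'0 !subr0.
apply: (@le_trans _ _ (L * e * `|tau t - 0|)).
  apply: (@MVT_lip R (fun x => P j x - P' j x) (fun x => G (y x) 0 j - G (y' x) 0 j) (L * e) h) => //.
  - by move=> x xh; have := dP j x xh; have := dP' j x xh => d1 d2; apply: is_deriveB.
  - move=> x _; apply: (@le_trans _ _ `|G (y x) - G (y' x)|).
      by apply: le_trans (row_coord_le _ j); rewrite !mxE.
    by apply: le_trans (GL _ _) _; rewrite ler_wpM2l.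
  - by rewrite normr0 ltW.
rewrite subr0; apply: (@le_trans _ _ (L * e * h)); first by rewrite ler_wpM2l // mulr_ge0.
by rewrite mulrAC [L * h * e]mulrC ler_wpM2l.
Qed.

Lemma le_geom (a b C : R) : (forall k, a <= b + C * 2^-1 ^+ k) -> a <= b.
Proof.
move=> H; rewrite leNgt; apply/negP => ab; have d0 : 0 < a - b by rewrite subr_gt0.
have C0 : 0 < C by have := H 0%N; rewrite expr0 mulr1; lra.
(* With k > C / (a - b) and k <= 2 ^ k, the error C / 2 ^ k falls below a - b. *)
pose k := Num.bound (C / (a - b)).
have kP : C / (a - b) < k%:R by have := archi_boundP (ltW (divr_gt0 C0 d0)).
have k2 : (k%:R : R) <= 2 ^+ k by rewrite -natrX ler_nat ltnW // ltn_expl.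
have p0 : 0 < 2 ^+ k :> R by rewrite exprn_gt0.
have := H k; rewrite exprVn -lerBlDl ler_pdivlMr // => le1.
have : C < (a - b) * k%:R by move: kP; rewrite ltr_pdivrMr // mulrC.
have : (a - b) * k%:R <= (a - b) * 2 ^+ k by rewrite ler_wpM2l // ltW.
lra.
Qed.

(** The vector field is bounded and Lipschitz on the whole space; [ode_ex] reduces a local field to
    this case by truncation, and the last bound keeps the solution where the truncation is the
    identity. *)
Theorem picard_lindelof : exists c : R -> 'rV[R]_m, [/\ c 0 = y0,
  forall t j, `|t| < h -> is_derive t 1 (fun s => c s 0 j) (G (c t) 0 j) &
  forall t, `|c t - y0| <= K * h].
Proof.
have [f fP] : exists f : {y | Klip y} -> {y | Klip y}, forall q, picard_rel (sval q) (sval (f q)).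
  apply: (@choice_ex _ _ (fun q q' : {y | Klip y} => picard_rel (sval q) (sval q'))) => -[y ly] /=.
  by have [z yz] := picard_ex ly; exists (exist _ z (picard_lip yz)).
have l0 : Klip (fun=> y0) by move=> t s; rewrite subrr normr0 mulr_ge0.
pose w k := sval (iter k f (exist _ _ l0)).
have wS k : picard_rel (w k) (w k.+1) by exact: fP.
pose C := K * h.
have C0 : 0 <= C by rewrite mulr_ge0 // ltW.
have p0 k : 0 <= (2^-1 : R) ^+ k by apply: exprn_ge0; rewrite invr_ge0.
have wd k t : `|w k.+1 t - w k t| <= C * 2^-1 ^+ k.
  elim: k t => [|k IH] t; first by rewrite expr0 mulr1; exact: picard_bound (wS 0%N).
  have e0 : 0 <= C * 2^-1 ^+ k by rewrite mulr_ge0 // exprn_ge0 // invr_ge0.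
  by rewrite exprSr mulrA; apply: picard_contract e0 (wS k.+1) (wS k) IH.
have [c cP] : exists c : R -> 'rV[R]_m, forall t k, `|c t - w k t| <= 2 * C * 2^-1 ^+ k.
  apply: (@choice_ex _ _ (fun t (u : 'rV[R]_m) => forall k, `|u - w k t| <= 2 * C * 2^-1 ^+ k)) => t.
  have [l lP] : exists l : 'I_m -> R, forall j k, `|l j - w k t 0 j| <= 2 * C * 2^-1 ^+ k.
    apply: (@choice_ex _ _ (fun j (l : R) => forall k, `|l - w k t 0 j| <= 2 * C * 2^-1 ^+ k)) => j.
    apply: geometric_limit => k; apply: le_trans (wd k t).
    by apply: le_trans (row_coord_le _ j); rewrite !mxE.
  exists (\row_j l j) => k; apply: row_norm_le => [|j]; last by rewrite !mxE.
  by apply: mulr_ge0 => //; apply: mulr_ge0.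
have lc : Klip c.
  move=> t s; apply: (@le_geom _ _ (4 * C)) => k.
  have := cP t k; have := cP s k; have := picard_lip (wS k); have lw : Klip (w k) by exact: (svalP (iter k f _)).
  move=> _ c1 c2; have c3 := lw t s; rewrite distrC in c1.
  have : `|c t - c s| <= `|c t - w k t| + `|w k t - w k s| + `|w k s - c s|.
    by apply: le_trans (ler_distD (w k t) _ _) _; rewrite -addrA lerD2l; exact: ler_distD.
  lra.
have [z cz] := picard_ex lc.
(* The limit is a fixed point: z and the iterate k + 1 are Picard images of c and of the iterate k,
   so by contraction they are close, while the iterate k + 1 is close to c. *)
have zc t : z t = c t.
  apply/eqP; rewrite -subr_eq0 -normr_le0; apply: (@le_geom _ _ (2 * C)) => k; rewrite add0r.
  have e0 : 0 <= 2 * C * 2^-1 ^+ k by apply: mulr_ge0 => //; apply: mulr_ge0.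
  have h2 := picard_contract t e0 cz (wS k) (fun s => cP s k).
  have h3 := cP t k.+1; rewrite exprSr mulrA distrC in h3.
  have : `|z t - c t| <= `|z t - w k.+1 t| + `|w k.+1 t - c t|.
    exact: ler_distD.
  lra.
have cc : picard_rel c c by rewrite (_ : picard_rel c c = picard_rel c z) //; congr picard_rel; apply/funext.
have [P [P0 dP cE]] := cc.
exists c; split=> [|t j th|t]; last exact: picard_bound cc.
  by apply/rowP => j; rewrite cE tau_id ?normr0 // P0 addr0.
have dt := dP j t (ltW th).
apply: (@near_eq_is_derive _ _ _ (fun s => y0 0 j + P j s)).
  near=> s; rewrite cE tau_id //; near: s.
  have ee : 0 < h - `|t| by rewrite subr_gt0.
  have ci : (fun s : R => s) s @[s --> t] --> t by exact: cvg_id.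
  move/cvgrPdist_lt : ci => /(_ _ ee); apply: filterS => s ts.
  by rewrite -(subrK t s) (le_lt_trans (ler_normD _ _)) // distrC -ltrBrDr.
by have d := is_deriveD (is_derive_cst (y0 0 j) t 1) dt; rewrite add0r in d; exact: d.
Unshelve. all: by end_near. Qed.

End Picard.

Section ODE.
Context {R : realType} {m : nat}.
Implicit Types (u v y z : 'rV[R]_m).

Lemma derive_bound (f : 'rV[R]_m -> R) y u (M : 'I_m -> R) : differentiable f y ->
  (forall j, `|'D_(delta_mx 0 j) f y| <= M j) -> `|'D_u f y| <= `|u| * \sum_j M j.
Proof.
move=> df fM; rewrite derive_dir_sum // mulr_sumr.
apply: le_trans (ler_norm_sum _ _ _) _; apply: ler_sum => j _.
rewrite -[_ *: _]/(_ * _) normrM; apply: ler_pM => //; exact: row_coord_le.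
Qed.

Lemma smooth_lipschitz (W : set 'rV[R]_m) (F : 'rV[R]_m -> 'rV[R]_m) y0 :
  open W -> W y0 -> smooth W F ->
  exists r L : R, [/\ 0 < r, 0 <= L, forall y, `|y - y0| <= r -> W y &
    forall y z, `|y - y0| <= r -> `|z - y0| <= r -> `|F y - F z| <= L * `|y - z|].
Proof.
move=> oW Wy0 sF.
have sFi i : smooth W (fun y => F y 0 i) by apply: smooth_coord.
(* By continuity a partial derivative exceeds its absolute value at y0 by at most 1 near y0; the sum
   of all these bounds is the Lipschitz constant. *)
pose M i j := `|'D_(delta_mx 0 j) (fun y => F y 0 i) y0| + 1.
have nM : \forall y \near y0, forall i j, `|'D_(delta_mx 0 j) (fun y => F y 0 i) y| <= M i j.
  have nMij i j : \forall y \near y0, `|'D_(delta_mx 0 j) (fun y => F y 0 i) y| <= M i j; last first.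
    have nMi i := @filter_forall _ _ (fun j y => `|'D_(delta_mx 0 j) (fun y => F y 0 i) y| <= M i j) (nbhs y0) (nbhs_filter y0) (nMij i).
    exact: (@filter_forall _ _ (fun i y => forall j, `|'D_(delta_mx 0 j) (fun y => F y 0 i) y| <= M i j) (nbhs y0) (nbhs_filter y0) nMi).
  have c : {for y0, continuous ('D_(delta_mx 0 j) (fun y => F y 0 i))} by exact: (smooth_D _ (sFi i) 0%N).
  move/cvgrPdist_le : c => /(_ 1 ltr01); apply: filterS => y yd.
  rewrite /M -lerBlDl; apply: le_trans (lerB_dist _ _) _.
  by rewrite distrC.
have nW : \forall y \near y0, W y by exact: (open_near oW Wy0 (fun y Wy => Wy)).
have nB : nbhs y0 (W `&` [set y | forall i j, `|'D_(delta_mx 0 j) (fun y => F y 0 i) y| <= M i j]).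
  exact: filterI.
have [r /= r0 rP] := (nbhs_ballP y0 _).1 nB.
have inb y : `|y - y0| <= r / 2 -> ball y0 r y.
  move=> yr; rewrite -ball_normE /ball_ /= distrC; apply: le_lt_trans yr _.
  by rewrite ltr_pdivrMr // ltr_pMr // ltr1n.
have M0 i j : 0 <= M i j by rewrite /M addr_ge0.
(* Half the radius, because the closed ball of radius r / 2 lies in the open ball of radius r. *)
exists (r / 2), (\sum_i \sum_j M i j); split.
- by rewrite divr_gt0.
- by apply: sumr_ge0 => i _; apply: sumr_ge0.
- by move=> y /inb /rP [].
move=> y z yr zr; apply: row_norm_le => [|i].
  by rewrite mulr_ge0 // sumr_ge0 // => i _; apply: sumr_ge0.
have seg (s : R) : 0 <= s <= 1 -> `|z + s *: (y - z) - y0| <= r / 2.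
  move=> /andP[s0 s1]; have -> : z + s *: (y - z) - y0 = (1 - s) *: (z - y0) + s *: (y - y0).
    by apply/rowP => j; rewrite !mxE; ring.
  apply: le_trans (ler_normD _ _) _; rewrite !normrZ !ger0_norm ?subr_ge0 //.
  apply: (@le_trans _ _ ((1 - s) * (r / 2) + s * (r / 2))).
    by apply: lerD; apply: ler_wpM2l => //; rewrite subr_ge0.
  by rewrite -mulrDl subrK mul1r.
have [s s01] : exists2 s, 0 <= s <= 1 & F (z + 1 *: (y - z)) 0 i - F z 0 i = 'D_(y - z) (fun y => F y 0 i) (z + s *: (y - z)) * 1.
  apply: MVT_line => // s s01; apply: (smooth_diff (sFi i)).
  by have [] := rP _ (inb _ (seg _ s01)).
rewrite scale1r [z + (y - z)]addrC subrK mulr1 => E.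
have -> : (F y - F z) 0 i = F y 0 i - F z 0 i by rewrite !mxE.
rewrite E.
have [Ws Ms] := rP _ (inb _ (seg _ s01)).
apply: le_trans (derive_bound _ _ (Ms i)) _; first exact: (smooth_diff (sFi i)).
rewrite mulrC ler_wpM2r // [leRHS](bigD1 i) //= lerDl sumr_ge0 // => k _.
exact: sumr_ge0.
Qed.

(** Bootstrap: if c is of class k, so is F composed with c, which is the derivative of c. *)
Lemma ode_smooth (I : set R) (W : set 'rV[R]_m) (F : 'rV[R]_m -> 'rV[R]_m) (c : R -> 'rV[R]_m) :
  open I -> open W -> smooth W F ->
  (forall t, I t -> [/\ W (c t), differentiable c t & 'D_1 c t = F (c t)]) -> smooth I c.
Proof.
move=> oI oW sF cP; elim=> [|k IH].
  by move=> t /cP[_ dc _]; exact: differentiable_continuous.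
split=> [t /cP[] //|v].
have C1 : Ck k I (fun t => F (c t)) by apply: (Ck_comp_rV oI oW IH (sF k)) => t /cP[].
apply: Ck_rV => // j.
have C2 := CkM oI (Ck_cst k I (v : R)) (Ck_coord j oI C1).
apply: (Ck_eq oI _ C2) => t It /=; have [_ dc <-] := cP t It.
by rewrite -[in RHS](mulr1 v) -[v * 1]/(v *: (1 : R)) !deriveE // linearZ mxE.
Qed.

Lemma ode_ex (W : set 'rV[R]_m) (F : 'rV[R]_m -> 'rV[R]_m) y0 :
  open W -> W y0 -> smooth W F ->
  exists h c, [/\ 0 < h, c 0 = y0 & forall t : R, `|t| < h ->
    [/\ W (c t), differentiable c t & 'D_1 c t = F (c t)]].
Proof.
move=> oW Wy0 sF; have [r [L [r0 L0 rW FL]]] := smooth_lipschitz oW Wy0 sF.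
(* In the maximum norm, truncating each coordinate retracts onto the closed ball of radius r around
   y0 without increasing distances. *)
pose cl y : 'rV[R]_m := y0 + \row_j clampr r (y 0 j - y0 0 j).
have clr y : `|cl y - y0| <= r.
  rewrite /cl addrC addKr; apply: row_norm_le => [|j]; first exact: ltW.
  by rewrite mxE clampr_le.
have cll y z : `|cl y - cl z| <= `|y - z|.
  apply: row_norm_le => // j; rewrite !mxE opprD addrACA subrr add0r.
  apply: le_trans (clampr_lip r0 _ _) _; apply: le_trans (row_coord_le _ j).
  by rewrite !mxE opprB addrA subrK.
have clid y : `|y - y0| < r -> cl y = y.
  move=> yr; apply/rowP => j; rewrite !mxE clampr_id; first by rewrite addrC subrK.
  by apply: le_lt_trans yr; apply: le_trans (row_coord_le _ j); rewrite !mxE.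
pose G y := F (cl y); pose K := `|F y0| + L * r.
have K0 : 0 <= K by rewrite addr_ge0 // mulr_ge0 // ltW.
have GL y z : `|G y - G z| <= L * `|y - z|.
  by apply: le_trans (FL _ _ (clr y) (clr z)) _; rewrite ler_wpM2l.
have GK y : `|G y| <= K.
  rewrite -[G y](subrK (F y0)) addrC; apply: le_trans (ler_normD _ _) _.
  rewrite lerD2l; apply: le_trans (FL _ _ (clr y) _) _; first by rewrite subrr normr0 ltW.
  by rewrite ler_wpM2l.
(* The three bounds yield h < 1, L h <= 1/2 and K h < r. Adding 1 avoids division by zero, and the
   factor 2 makes the last inequality strict. *)
pose h := Num.min (2^-1) (Num.min (2^-1 / (L + 1)) (r / (2 * (K + 1)))).
have L1 : 0 < L + 1 by rewrite ltr_wpDl.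
have K1 : 0 < K + 1 by rewrite ltr_wpDl.
have h0 : 0 < h by rewrite !lt_min invr_gt0 ltr0n /= !divr_gt0 // ?mulr_gt0 // invr_gt0.
have h1 : h <= 2^-1 by rewrite /h ge_min lexx.
have h2 : h <= 2^-1 / (L + 1) by rewrite /h !ge_min lexx orbT.
have h3 : h <= r / (2 * (K + 1)) by rewrite /h !ge_min lexx !orbT.
have Lh : L * h <= 2^-1.
  apply: (@le_trans _ _ ((L + 1) * h)); first by rewrite ler_wpM2r ?(ltW h0) // lerDl.
  by rewrite mulrC -ler_pdivlMr.
have hlt1 : h < 1 by apply: le_lt_trans h1 _; rewrite invf_lt1 // ltr1n.
have Kh : K * h < r.
  apply: (@le_lt_trans _ _ ((K + 1) * h)); first by rewrite ler_wpM2r ?(ltW h0) // lerDl.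
  apply: (@le_lt_trans _ _ (r / 2)).
    move: h3; rewrite ler_pdivlMr ?mulr_gt0 // ler_pdivlMr // => h3; apply: le_trans h3.
    by rewrite (_ : (K + 1) * h * 2 = h * (2 * (K + 1))) //; ring.
  by rewrite ltr_pdivrMr // ltr_pMr // ltr1n.
have [c [c0 dc cb]] := picard_lindelof y0 h0 hlt1 Lh L0 K0 GL GK.
exists h, c; split=> // t th.
have ctr : `|c t - y0| < r by apply: le_lt_trans (cb t) Kh.
have dct : differentiable c t.
  by apply: diff_rV => j; have [d _] := dc t j th; apply/derivable1_diffP.
split=> //; first by apply: rW; exact: ltW.
apply/rowP => j; rewrite -derive_coord //; have [_ ->] := dc t j th.
by rewrite /G clid.
Qed.

End ODE.

(** * Connections with the same geodesics *)

Section Weyl.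
Context {R : realType} {n : nat}.
Variable B : 'rV[R]_n -> 'rV[R]_n -> 'rV[R]_n.
Hypotheses (Bl : forall u, lin (B u)) (Bs : forall u v, B u v = B v u).
Hypothesis Bdir : forall v, exists l : R, B v v = l *: v.

(** The multiplier in [Bdir] is merely known to exist for each v. Diagonal components give the
    one-form explicitly, so that it inherits smoothness when B varies with a point. *)
Definition weyl_form : 'rV[R]_n := \row_k (2^-1 * B (delta_mx 0 k) (delta_mx 0 k) 0 k).

Let e (i : 'I_n) : 'rV[R]_n := delta_mx 0 i.

Lemma delta_coord (i j : 'I_n) : e i 0 j = (i == j)%:R.
Proof. by rewrite /e mxE eqxx eq_sym. Qed.

(** Polarization with e_i + e_j and e_i - e_j, of multipliers l and k. Coordinates i and j give l +
    k = 2 b_i and l - k = 2 b_j, and subtracting the two equations isolates 4 B(e_i, e_j). *)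
Lemma weyl_basis i j : B (e i) (e j) = weyl_form 0 j *: e i + weyl_form 0 i *: e j.
Proof.
have diag k : B (e k) (e k) = (B (e k) (e k) 0 k) *: e k.
  have [l E] := Bdir (e k); rewrite E; congr (_ *: _).
  by rewrite mxE delta_coord eqxx mulr1.
rewrite [weyl_form 0 j]mxE [weyl_form 0 i]mxE -!/(e _).
have [->|ij] := eqVneq i j.
  by rewrite -scalerDl {1}diag; congr (_ *: _); field.
move: (diag i) (diag j); move: (B (e i) (e i) 0 i) (B (e j) (e j) 0 j) => bi bj di dj.
have ji : (j == i) = false by rewrite eq_sym (negPf ij).
have [l El] := Bdir (e i + e j); have [k Ek] := Bdir (e i - e j).
have E1 : B (e i + e j) (e i + e j) = bi *: e i + 2 *: B (e i) (e j) + bj *: e j.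
  rewrite (linD (Bl _)) !(Bs (e i + e j)) !(linD (Bl _)) di dj (Bs (e j)) scaler_nat mulr2n.
  by rewrite !addrA.
have E2 : B (e i - e j) (e i - e j) = bi *: e i - 2 *: B (e i) (e j) + bj *: e j.
  rewrite (linB (Bl _)) !(Bs (e i - e j)) !(linB (Bl _)) di dj (Bs (e j)) scaler_nat mulr2n.
  by rewrite opprB opprD !addrA addrAC.
have c m : l * (e i 0 m + e j 0 m) = bi * e i 0 m + 2 * B (e i) (e j) 0 m + bj * e j 0 m.
  by have := congr1 (fun u : 'rV[R]_n => u 0 m) (etrans (esym El) E1); rewrite !mxE.
have d m : k * (e i 0 m - e j 0 m) = bi * e i 0 m - 2 * B (e i) (e j) 0 m + bj * e j 0 m.
  by have := congr1 (fun u : 'rV[R]_n => u 0 m) (etrans (esym Ek) E2); rewrite !mxE.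
apply/rowP => m.
have -> (s t : R) : (s *: e i + t *: e j) 0 m = s * e i 0 m + t * e j 0 m by rewrite !mxE.
have ci := c i; have cj := c j; have di' := d i; have dj' := d j; have cm := c m; have dm := d m.
rewrite !delta_coord ?eqxx ?ji ?(negPf ij) /= in ci cj di' dj'.
have h1 : l + k = 2 * bi by move: ci di'; lra.
have h2 : l - k = 2 * bj by move: cj dj'; lra.
have h3 : 4 * B (e i) (e j) 0 m = (l - k) * e i 0 m + (l + k) * e j 0 m by move: cm dm; lra.
by rewrite h1 h2 in h3; move: h3; lra.
Qed.

Lemma weyl u v : B u v = ev weyl_form v *: u + ev weyl_form u *: v.
Proof.
have W j k : B (e k) (e j) = ev weyl_form (e j) *: e k + ev weyl_form (e k) *: e j.
  by rewrite weyl_basis !ev_deltar.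
have lw w : lin (fun v => ev weyl_form v *: w + ev weyl_form w *: v).
  move=> k v1 v2; rewrite ev_linr; apply/rowP => j; rewrite !mxE -![_ *: _]/(_ * _); ring.
have lw' w : lin (fun u => ev weyl_form w *: u + ev weyl_form u *: w).
  move=> k v1 v2; rewrite ev_linr; apply/rowP => j; rewrite !mxE -![_ *: _]/(_ * _); ring.
have Wj j w : B w (e j) = ev weyl_form (e j) *: w + ev weyl_form w *: e j.
  rewrite Bs (lin_row w (Bl (e j))) (lin_row w (lw' (e j))); apply: eq_bigr => k _.
  by rewrite -[delta_mx 0 k]/(e k) Bs W.
rewrite (lin_row v (Bl u)) (lin_row v (lw u)); apply: eq_bigr => k _.
by rewrite -[delta_mx 0 k]/(e k) Wj.
Qed.

End Weyl.

Lemma row_cancel (R : zmodType) n (u v : 'rV[R]_n) k : (u - (u + v)) 0 k + v 0 k = 0.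
Proof. by rewrite opprD addrA subrr add0r mxE addNr. Qed.

Section Curves.
Context {R : realType} {n : nat}.

Lemma derive_comp_real {W : normedModType R} (x : R -> W) (f : R -> R) t :
  differentiable f t -> differentiable x (f t) ->
  'D_1 (fun s => x (f s)) t = 'D_1 f t *: 'D_1 x (f t).
Proof.
move=> df dx; rewrite (@derive_chain R _ _ _ f x t 1 df dx).
rewrite -[X in 'D_X x _](mulr1 ('D_1 f t)) -['D_1 f t * 1]/('D_1 f t *: (1 : R)).
by rewrite !deriveE // linearZ.
Qed.

Lemma derive_scale_curve (f : R -> R) (x : R -> 'rV[R]_n) t :
  differentiable f t -> differentiable x t ->
  'D_1 (fun s => f s *: x s) t = 'D_1 f t *: x t + f t *: 'D_1 x t.
Proof.
move=> df dx.
have ll s : lin (fun u : 'rV[R]_n => f s *: u) by move=> k u v; rewrite scalerDr !scalerA mulrC.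
have dl (u : 'rV[R]_n) : differentiable (fun s => f s *: u) t by exact: differentiableZl.
rewrite (@derive_lin_app_rV _ _ _ _ (fun s u => f s *: u) x t 1 (filterE _ ll) (fun i => dl _) dx).
by congr (_ + _); rewrite deriveE // diffZl // deriveE.
Qed.

Lemma derive1_fun {W : normedModType R} (x : R -> W) : derive1 x = 'D_1 x.
Proof. by apply/funext => t; rewrite derive1E. Qed.

End Curves.

Section Geodesics.
Context {R : realType} {n : nat} {M : atlas R n}.
Hypothesis HM : smooth_manifold M.
Implicit Types (a b : chart M) (p q : M) (D : connection M).

Lemma christoffel_sum D a p k (w : 'rV[R]_n) : cdom a p ->
  \sum_(i < n) \sum_(j < n) christoffel D a p i j k * w 0 i * w 0 j = gam D a (cmap a p) w w 0 k.
Proof.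
move=> pa; rewrite (lin_row w (gam_linl HM D w pa)) summxE; apply: eq_bigr => i _.
rewrite mxE (lin_row w (gam_linr HM D _ pa)) summxE mulr_sumr; apply: eq_bigr => j _.
rewrite mxE /christoffel /gam (cmapK HM pa) -mulrA mulrC -mulrA; congr (_ * _).
Qed.

(** In another chart the acceleration gains a Hessian term, the one that [gam_phi] compensates in
    the geodesic equation. *)
Lemma chart_curve_derive a b (x : R -> 'rV[R]_n) (I : set R) t : open I -> I t ->
  smooth I x -> (forall s, I s -> im a (x s)) -> ovl a b (x t) ->
  let z := fun s => phi a b (x s) in
  'D_1 z t = jac a b (x t) ('D_1 x t) /\
  'D_1 ('D_1 z) t = hess a b (x t) ('D_1 x t) ('D_1 x t) + jac a b (x t) ('D_1 ('D_1 x) t).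
Proof.
move=> oI It sx xI xab z.
have dx s : I s -> differentiable x s by exact: (smooth_diff sx).
have dx1 : differentiable ('D_1 x) t by exact: (smooth_diff (smooth_D (1 : R) sx) It).
have z1 s : I s -> ovl a b (x s) -> 'D_1 z s = jac a b (x s) ('D_1 x s).
  move=> Is xs; apply: (@derive_chain R _ _ _ x (phi a b) s 1 (dx _ Is)).
  exact: (smooth_diff (phi_smooth HM a b) xs).
have nx : \forall s \near t, ovl a b (x s).
  have cx : {for t, continuous x} := differentiable_continuous (dx _ It).
  exact: (cx _ (open_nbhs_nbhs (conj (ovl_open HM a b) xab))).
have nI : \forall s \near t, I s by exact: (open_near oI It (fun y Iy => Iy)).
split; first exact: z1.
have jd v : differentiable (fun y => jac a b y v) (x t).
  exact: (smooth_diff (smooth_D v (phi_smooth HM a b)) xab).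
transitivity ('D_1 (fun s => jac a b (x s) ('D_1 x s)) t).
  by apply: near_eq_derive; near=> s; apply: z1; near: s.
have ll : \forall s \near t, lin (jac a b (x s)).
  by apply: filterS nx => s [q [qa qb] <-]; exact: (jac_lin HM).
have jdx v : differentiable (fun s => jac a b (x s) v) t.
  exact: (differentiable_comp (dx _ It) (jd v)).
rewrite (@derive_lin_app_rV _ _ _ _ (fun s => jac a b (x s)) ('D_1 x) t 1 ll (fun i => jdx _) dx1).
by rewrite (@derive_chain R _ _ _ x (fun y => jac a b y ('D_1 x t)) t 1 (dx _ It) (jd _)).
Unshelve. all: by end_near. Qed.

(** The geodesic equation is solved in one chart as a first-order system for position and velocity.
    As [geodesic] speaks of every chart, the equation is then transported: the Hessian terms of the
    acceleration and of the Christoffel term cancel. *)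
Lemma geodesic_ex D a p (v : 'rV[R]_n) : torsion_free D -> cdom a p ->
  exists I x, [/\ geodesic D I (fun t => cmapV a (x t)), I 0 /\ open I, smooth I x,
    forall t, I t -> im a (x t) &
    [/\ x 0 = cmap a p, 'D_1 x 0 = v & 'D_1 ('D_1 x) 0 = - gam D a (cmap a p) v v]].
Proof.
move=> tf pa; have lG := gam_lc HM tf a; have oI := im_open HM a.
pose W : set 'rV[R]_(n + n) := [set y | im a (lsubmx y)].
have oW : open W by exact: cyl_open.
pose F (y : 'rV[R]_(n + n)) : 'rV[R]_(n + n) := row_mx (rsubmx y) (- gam D a (lsubmx y) (rsubmx y) (rsubmx y)).
have sr : smooth W (@rsubmx R 1 n n) by exact: smooth_lin (@rsubmx_lin R n).
have sl : smooth W (@lsubmx R 1 n n) by exact: smooth_lin (@lsubmx_lin R n).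
have sG : smooth W (fun y => gam D a (lsubmx y) (rsubmx y) (rsubmx y)).
  apply: (@smooth_lin_app_rV _ _ _ _ _ (fun y u => gam D a (lsubmx y) u (rsubmx y))) => //.
    by move=> y Wy; exact: (lc_linl _ lG).
  move=> i; apply: (@smooth_lin_app_rV _ _ _ _ _ (fun y u => gam D a (lsubmx y) _ u)) => //.
    by move=> y Wy; exact: (lc_lin lG).
  by move=> j; apply: (smooth_comp_rV oW oI sl (gam_smooth HM D a _ _)).
have sF : smooth W F.
  apply: smooth_rV => // j; case: (split_ordP j) => k ->.
    by apply: (smooth_eq oW _ (smooth_coord k oW sr)) => y _; rewrite /F row_mxEl.
  apply: (smooth_eq oW _ (smoothN oW (smooth_coord k oW sG))) => y _.
  by rewrite /F row_mxEr mxE.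
have Wp : W (row_mx (cmap a p) v) by rewrite /W /= row_mxKl; exact: imP.
have [h [c [h0 c0 cP]]] := ode_ex oW Wp sF.
pose I : set R := [set` `]- h, h[].
have Ih t : I t -> `|t| < h by rewrite /I /= in_itv /= ltr_norml.
have oIh : open I by exact: interval_open.
pose x t : 'rV[R]_n := lsubmx (c t).
have sc : smooth I c by apply: (ode_smooth oIh oW sF) => t /Ih; exact: cP.
have sx : smooth I x.
  apply: smooth_rV => // j; apply: (smooth_eq oIh _ (smooth_coord (lshift n j) oIh sc)) => t _.
  by rewrite /x mxE.
have xI t : I t -> im a (x t) by move=> /Ih /cP [].
have dxc t : I t -> 'D_1 x t = rsubmx (c t).
  move=> It; have [_ dc E] := cP t (Ih _ It).
  apply/rowP => j; rewrite -derive_coord; last exact: (smooth_diff sx).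
  have -> : (fun s => x s 0 j) = (fun s => c s 0 (lshift n j)) by apply/funext => s; rewrite /x mxE.
  by rewrite derive_coord // E /F row_mxEl.
have ddx t : I t -> 'D_1 ('D_1 x) t = - gam D a (x t) ('D_1 x t) ('D_1 x t).
  move=> It; have [_ dc E] := cP t (Ih _ It).
  have E2 : 'D_1 ('D_1 x) t = 'D_1 (fun s => rsubmx (c s)) t.
    by apply: near_eq_derive; apply: (open_near oIh It).
  have dr : differentiable (fun s => rsubmx (c s)) t.
    by apply: diff_rV => j; rewrite (_ : (fun s => _) = (fun s => c s 0 (rshift n j))); [exact: diff_coord | apply/funext => s; rewrite mxE].
  rewrite E2 (dxc _ It); apply/rowP => j; rewrite -derive_coord //.
  have -> : (fun s => rsubmx (c s) 0 j) = (fun s => c s 0 (rshift n j)) by apply/funext => s; rewrite mxE.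
  by rewrite derive_coord // E /F row_mxEr.
have I0 : I 0 by rewrite /I /= in_itv /= oppr_lt0 h0.
exists I, x; split=> //; last first.
  by split; rewrite ?dxc ?ddx ?dxc // /x c0 ?row_mxKl ?row_mxKr.
split=> //; first exact: interval_is_interval.
- move=> b.
  have -> : I `&` (fun t => cmapV a (x t)) @^-1` cdom b = [set t | I t /\ ovl a b (x t)].
    apply/seteqP; split=> t [It tb]; split => //.
      by have [xa xE] := cmapVP HM (xI t It); exists (cmapV a (x t)).
    by move: tb => [q [qa qb] qE]; rewrite /= -qE (cmapK HM qa).
  have oJ : open [set t | I t /\ ovl a b (x t)].
    rewrite openE => t [It xt]; apply: filterI; first exact: (open_nbhs_nbhs (conj oIh It)).
    have cx : {for t, continuous x} := differentiable_continuous (smooth_diff sx It).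
    exact: (cx _ (open_nbhs_nbhs (conj (ovl_open HM a b) xt))).
  split=> //.
  have sJ : smooth [set t | I t /\ ovl a b (x t)] x by apply: smooth_sub sx => t [].
  by apply: (smooth_comp_rV oJ (ovl_open HM a b) sJ (phi_smooth HM a b)) => t [].
move=> b t It tb z k.
have [ta tE] := cmapVP HM (xI t It).
have xt : ovl a b (x t) by exists (cmapV a (x t)).
have [z1 z2] := chart_curve_derive oIh It sx xI xt.
rewrite (christoffel_sum D k _ tb) !derive1_fun.
have -> : 'D_1 z = 'D_1 (fun s => phi a b (x s)) by [].
rewrite z2 z1 ddx // -tE (linN (jac_lin HM ta tb)) (gam_phi HM D _ _ ta tb) (cmapK HM ta).
exact: row_cancel.
Qed.

(** The geodesic with velocity v, reparametrized by f, has acceleration f'' v - f'^2 Gamma(v, v) at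
    p and solves the geodesic equation of [D']. So f'^2 (Gamma' - Gamma)(v, v) = - f'' v, and f'
    does not vanish. *)
Lemma geodesics_dir D D' a p (v : 'rV[R]_n) : torsion_free D -> torsion_free D' ->
  geodesics_in D D' -> cdom a p ->
  exists l : R, gam D' a (cmap a p) v v - gam D a (cmap a p) v v = l *: v.
Proof.
move=> tf tf' DD' pa.
have [I [x [gx [I0 oI] sx xI [x0 x1 x2]]]] := geodesic_ex v tf pa.
have [J [f [[sf fJ f1] gJ]]] := DD' _ _ gx.
have [t Jt ft] : (f @` J) 0 by rewrite fJ.
have fI s : J s -> I (f s) by move=> Js; rewrite -fJ; exists s.
have [oJ _ _ gE] := gJ.
have Et : cmapV a (x (f t)) = p by rewrite ft x0 (cmapK HM pa).
have := gE a t Jt; rewrite /= Et => /(_ pa) {}gE.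
have zE : forall s, J s -> cmap a (cmapV a (x (f s))) = x (f s).
  by move=> s Js; have [_ ->] := cmapVP HM (xI _ (fI _ Js)).
set z := _ \o _ in gE.
have df s : J s -> differentiable f s by exact: (smooth_diff sf).
have dxf s : J s -> differentiable x (f s) by move=> Js; exact: (smooth_diff sx (fI _ Js)).
have d1 s : J s -> 'D_1 z s = 'D_1 f s *: 'D_1 x (f s).
  move=> Js; rewrite -(derive_comp_real (df _ Js) (dxf _ Js)).
  by apply: near_eq_derive; apply: (open_near oJ Js) => r Jr; exact: zE.
have d2 : 'D_1 ('D_1 z) t = 'D_1 ('D_1 f) t *: v + ('D_1 f t ^+ 2) *: 'D_1 ('D_1 x) 0.
  have dx1 : differentiable ('D_1 x) (f t) by exact: (smooth_diff (smooth_D (1 : R) sx) (fI _ Jt)).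
  have df1 : differentiable ('D_1 f) t by exact: (smooth_diff (smooth_D (1 : R) sf) Jt).
  transitivity ('D_1 (fun s => 'D_1 f s *: 'D_1 x (f s)) t).
    by apply: near_eq_derive; apply: (open_near oJ Jt).
  rewrite (@derive_scale_curve _ _ ('D_1 f) (fun s => 'D_1 x (f s)) t df1 (differentiable_comp (df _ Jt) dx1)).
  by rewrite (derive_comp_real (df _ Jt) dx1) scalerA -expr2 ft x1.
have w0 : 'D_1 f t != 0 by rewrite -derive1E f1.
set w := 'D_1 f t in d2 w0.
have gE2 : 'D_1 ('D_1 f) t *: v + (w ^+ 2) *: - gam D a (cmap a p) v v + (w ^+ 2) *: gam D' a (cmap a p) v v = 0.
  apply/rowP => k; have := gE k; rewrite (christoffel_sum D' k _ pa) !derive1_fun d2 (d1 _ Jt) ft x1 x2.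
  rewrite (linZ (gam_linr HM D' _ pa)) (linZ (gam_linl HM D' _ pa)) scalerA -expr2 => E.
  by rewrite [LHS]mxE E mxE.
exists (- (w ^+ 2)^-1 * 'D_1 ('D_1 f) t).
have w2 : w ^+ 2 != 0 by rewrite expf_neq0.
apply: (scalerI w2); rewrite scalerA mulrA mulrN divff // mulN1r scaleNr.
apply/eqP; rewrite -addr_eq0 scalerBr -scalerN; apply/eqP; rewrite -gE2.
by rewrite addrC [X in _ + X]addrC addrA.
Qed.

End Geodesics.

(** * The cotangent manifold *)

Section Row_base.
Context {R : realType} {n : nat}.

Lemma coord_norm_lt (u : 'rV[R]_n) (c : R) : 0 < c -> (forall j, `|u 0 j| < c) -> `|u| < c.
Proof.
move=> c0 uc; rewrite /Num.Def.normr /= mx_normrE; apply/bigmax_ltP; split=> // -[i j] _.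
by rewrite ord1; exact: uc.
Qed.

(** Indexed by a countable type, so that [cot_second_countable] can number these balls by
    [pickle]. *)
Definition rat_ball (i : 'rV[rat]_n * nat) : set 'rV[R]_n :=
  ball (\row_j ratr (i.1 0 j) : 'rV[R]_n) (i.2.+1%:R)^-1.

Lemma rat_ball_open i : open (rat_ball i).
Proof. by apply: ball_open; rewrite invr_gt0. Qed.

Lemma rat_ball_base (u : 'rV[R]_n) (e : R) : 0 < e -> exists i, rat_ball i u /\ rat_ball i `<=` ball u e.
Proof.
move=> e0.
pose N := Num.bound (2 / e).
have NP : 2 / e < N.+1%:R.
  apply: lt_le_trans (archi_boundP (ltW (divr_gt0 _ e0))) _ => //.
  by rewrite ler_nat.
have p0 : 0 < (N.+1%:R : R)^-1 by rewrite invr_gt0.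
have [q qP] : exists q : 'I_n -> rat, forall j, `|ratr (q j) - u 0 j| < (N.+1%:R : R)^-1.
  suff H j : exists q : rat, `|ratr q - u 0 j| < (N.+1%:R : R)^-1.
    by have [q qP] := choice H; exists q.
  have lt : u 0 j - (N.+1%:R : R)^-1 < u 0 j + (N.+1%:R : R)^-1.
    by rewrite ltrBlDr -addrA ltrDl addr_gt0.
  have [q] := rat_in_itvoo lt.
  rewrite in_itv /= => /andP[q1 q2]; exists q; rewrite ltr_norml.
    by rewrite ltrBrDr addrC q1 ltrBlDl.
exists (\row_j q j, N); split.
  rewrite /rat_ball /= -ball_normE /ball_ /=; apply: coord_norm_lt => // j.
  by rewrite !mxE.
move=> v; rewrite /rat_ball /= -!ball_normE /ball_ /= => vq.
have h1 : `|u - (\row_j ratr ((\row_j0 q j0) 0 j) : 'rV[R]_n)| < (N.+1%:R : R)^-1.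
  by apply: coord_norm_lt => // j; rewrite !mxE distrC.
apply: le_lt_trans (ler_distD (\row_j ratr ((\row_j0 q j0) 0 j) : 'rV[R]_n) _ _) _.
apply: lt_le_trans (ltrD h1 vq) _.
apply: (@le_trans _ _ (2 * (N.+1%:R : R)^-1)); first by rewrite mulr_natl mulr2n.
by rewrite ler_pdivrMr // mulrC -ler_pdivrMr // ltW.
Qed.

End Row_base.

Section Chart_open.
Context {R : realType} {n : nat} {N : atlas R n}.
Hypotheses (cK : forall (a : chart N) (p : N), cdom a p -> cmapV a (cmap a p) = p)
  (oO : forall a b : chart N, open (@cmap R n N a @` (cdom a `&` cdom b)))
  (tS : forall a b : chart N,
    smooth (@cmap R n N a @` (cdom a `&` cdom b)) (@cmap R n N b \o cmapV a)).

(** Derived from three chart axioms alone, since it serves to establish separation and countability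
    for the cotangent atlas. *)
Lemma chart_open_mopen (a : chart N) (O : set 'rV[R]_n) : open O ->
  mopen [set p : N | cdom a p /\ O (cmap a p)].
Proof.
move=> oW b; rewrite openE => _ [p [pb [pa Op]] <-].
have pab : (@cmap R n N b @` (cdom b `&` cdom a)) (cmap b p) by exists p.
have c : {for cmap b p, continuous (@cmap R n N a \o cmapV b)} := tS b a 0%N _ pab.
have n1 := open_nbhs_nbhs (conj (@oO b a) pab).
have n2 : nbhs (cmap b p) ((@cmap R n N a \o cmapV b) @^-1` O).
  by apply: c; rewrite /= cK //; exact: open_nbhs_nbhs.
apply: filterS (filterI n1 n2) => _ [[q [qb qa] <-]]; rewrite /= cK // => Oq.
by exists q.
Qed.

End Chart_open.

Section Cotangent_manifold.
Context {R : realType} {n : nat} {M : atlas R n}.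
Hypothesis HM : smooth_manifold M.
Implicit Types (a b c : chart M) (p q : M) (z : cotangent M).

Lemma ev_ext (u w : 'rV[R]_n) : (forall v, ev u v = ev w v) -> u = w.
Proof. by move=> H; apply/rowP => k; rewrite -!ev_deltar H. Qed.

Lemma ev_ccomp a p (xi v : 'rV[R]_n) : cdom a p -> ev (ccomp a p xi) v = ev xi (tvec a p v).
Proof.
move=> pa; apply: (@ev_coord_lin _ _ id (fun v => ev xi (tvec a p v))) => k u w.
by rewrite (tvec_lin HM pa) ev_linr.
Qed.

Lemma ev_covec a p (y v : 'rV[R]_n) : cdom a p -> ev (covec a p y) v = ev y (tcomp a p v).
Proof.
move=> pa; apply: (@ev_coord_lin _ _ id (fun v => ev y (tcomp a p v))) => k u w.
by rewrite (tcomp_lin HM pa) ev_linr.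
Qed.

Lemma ccomp_covec a p y : cdom a p -> ccomp a p (covec a p y) = y.
Proof. by move=> pa; apply: ev_ext => v; rewrite ev_ccomp // ev_covec // (tcomp_tvec HM). Qed.

Lemma covec_ccomp a p y : cdom a p -> covec a p (ccomp a p y) = y.
Proof. by move=> pa; apply: ev_ext => v; rewrite ev_covec // ev_ccomp // (tvec_tcomp HM). Qed.

Lemma ccomp_pref p y : ccomp (pref p) p y = y.
Proof. by apply: ev_ext => v; rewrite ev_ccomp ?(tvec_pref HM) //; exact: pref_cdom. Qed.

(** The transition map of canonical coordinates: covectors transform by the transpose of the inverse
    Jacobian [jac b a]. *)
Definition cphi a b (y : 'rV[R]_(n + n)) : 'rV[R]_(n + n) :=
  row_mx (phi a b (lsubmx y)) (\row_k ev (rsubmx y) (jac b a (phi a b (lsubmx y)) (delta_mx 0 k))).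

Lemma cot_cmapV a p eta : cdom a p ->
  @cmapV R _ (cotangent M) a (row_mx (cmap a p) eta) = (p, covec a p eta).
Proof. by move=> pa /=; rewrite row_mxKl row_mxKr (cmapK HM pa). Qed.

Lemma cphiE a b y : ovl a b (lsubmx y) ->
  @cmap R _ (cotangent M) b (@cmapV R _ (cotangent M) a y) = cphi a b y.
Proof.
move=> [p [pa pb] E]; rewrite -(hsubmxK y) -E cot_cmapV // /cphi row_mxKl row_mxKr /=.
rewrite (phi_cmap HM b pa); congr row_mx; apply: ev_ext => v.
rewrite (@ev_coord_lin _ _ id (fun v => ev (rsubmx y) (jac b a (cmap b p) v))); last first.
  by move=> k u w; rewrite (jac_lin HM pb pa) ev_linr.
by rewrite ev_ccomp // ev_covec // (tcomp_tvec_jac HM v pb pa).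
Qed.

Lemma cphi_smooth a b : smooth [set y : 'rV[R]_(n + n) | ovl a b (lsubmx y)] (cphi a b).
Proof.
set U := [set y | _]; have oU : open U by apply: cyl_open; exact: (ovl_open HM).
have sl : smooth U (@lsubmx R 1 n n) by exact: smooth_lin (@lsubmx_lin R n).
have sr : smooth U (@rsubmx R 1 n n) by exact: smooth_lin (@rsubmx_lin R n).
have sp : smooth U (fun y => phi a b (lsubmx y)).
  by apply: (smooth_comp_rV oU (ovl_open HM a b) sl (phi_smooth HM a b)).
apply: smooth_rV => // j; case: (split_ordP j) => k ->.
  by apply: (smooth_eq oU _ (smooth_coord k oU sp)) => y _; rewrite /cphi row_mxEl.
have sj : smooth U (fun y => jac b a (phi a b (lsubmx y)) (delta_mx 0 k)).
  apply: (smooth_comp_rV oU (ovl_open HM b a) sp (smooth_D _ (phi_smooth HM b a))).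
  by move=> y [p [pa pb] E]; rewrite -E (phi_cmap HM b pa); exists p.
apply: (smooth_eq oU _ (ev_smooth oU sr sj)) => y _.
by rewrite /cphi row_mxEr mxE.
Qed.

Lemma cot_image a (A : set M) :
  @cmap R _ (cotangent M) a @` (@cdom R _ (cotangent M) a `&` (fst @^-1` A)) =
  [set y | (cmap a @` (cdom a `&` A)) (lsubmx y)].
Proof.
apply/seteqP; split=> [_ [z [/= za zA] <-]|y [p [pa pA] E]] /=.
  by rewrite row_mxKl; exists z.1.
exists (p, covec a p (rsubmx y)) => //=.
by rewrite ccomp_covec // E hsubmxK.
Qed.

Lemma cot_ovl a b : @cmap R _ (cotangent M) a @` (@cdom R _ (cotangent M) a `&` @cdom R _ (cotangent M) b) =
  [set y | ovl a b (lsubmx y)].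
Proof. exact: cot_image a (cdom b). Qed.

Lemma cot_im a : @cmap R _ (cotangent M) a @` (@cdom R _ (cotangent M) a) = [set y | im a (lsubmx y)].
Proof. by have := cot_image a setT; rewrite preimage_setT !setIT. Qed.

Lemma cot_cmapK a z : @cdom R _ (cotangent M) a z -> @cmapV R _ (cotangent M) a (@cmap R _ (cotangent M) a z) = z.
Proof. by case: z => p xi /= pa; rewrite row_mxKl row_mxKr (cmapK HM pa) covec_ccomp. Qed.

Lemma cot_overlap_open a b :
  open (@cmap R _ (cotangent M) a @` (@cdom R _ (cotangent M) a `&` @cdom R _ (cotangent M) b)).
Proof. by rewrite cot_ovl; apply: cyl_open; exact: (ovl_open HM). Qed.

Lemma cot_transition_smooth a b :
  smooth (@cmap R _ (cotangent M) a @` (@cdom R _ (cotangent M) a `&` @cdom R _ (cotangent M) b))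
    (@cmap R _ (cotangent M) b \o @cmapV R _ (cotangent M) a).
Proof.
rewrite cot_ovl; apply: smooth_eq (@cphi_smooth a b); first by apply: cyl_open; exact: (ovl_open HM).
by move=> y yab /=; rewrite -cphiE.
Qed.

Lemma cot_preimage_mopen (A : set M) : mopen A -> @mopen R _ (cotangent M) (fst @^-1` A).
Proof. by move=> oA a; rewrite cot_image; apply: cyl_open; exact: (oA a). Qed.

Lemma cot_fibre_mopen a (V : set 'rV[R]_n) : open V ->
  @mopen R _ (cotangent M) [set z : cotangent M | cdom a z.1 /\ V (ccomp a z.1 z.2)].
Proof.
move=> oV; have oV' : open [set y : 'rV[R]_(n + n) | V (rsubmx y)].
  have c : continuous (@rsubmx R 1 n n).
    by move=> y; apply: differentiable_continuous; exact: diff_rsub.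
  exact: (@open_comp _ _ (@rsubmx R 1 n n) V (fun y _ => c y) oV).
have := @chart_open_mopen R _ (cotangent M) cot_cmapK cot_overlap_open cot_transition_smooth a _ oV'.
congr (mopen _); apply/seteqP; split=> z /= [za]; by rewrite row_mxKr.
Qed.

Lemma cot_mopenI (A B : set (cotangent M)) : mopen A -> mopen B -> @mopen R _ (cotangent M) (A `&` B).
Proof.
move=> oA oB a; rewrite (_ : _ @` _ = (cmap a @` (cdom a `&` A)) `&` (cmap a @` (cdom a `&` B))).
  by apply: openI; [exact: (oA a) | exact: (oB a)].
apply/seteqP; split=> [_ [q [qa [qA qB]] <-] //|x [[q [qa qA] <-] [r [ra rB] E]]].
  by split; [exact: (ex_intro2 _ _ q (conj qa qA) erefl) | exact: (ex_intro2 _ _ q (conj qa qB) erefl)].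
have rq : r = q := etrans (esym (cot_cmapK ra)) (etrans (congr1 (@cmapV R _ (cotangent M) a) E) (cot_cmapK qa)).
rewrite rq in rB.
exact: (ex_intro2 _ _ q (conj qa (conj qA rB)) erefl).
Qed.

(** Distinct base points are separated in M. Over one base point, balls of half the distance in the
    fibre coordinates of a single chart are disjoint. *)
Lemma cot_hausdorff z z' : z <> z' -> exists A B : set (cotangent M),
  [/\ mopen A, mopen B, A z, B z' & A `&` B = set0].
Proof.
case: z z' => p xi [q eta] zz'.
have [pq|pq] := pselect (p = q); last first.
  have [A [B [oA oB Ap Bq AB]]] := hausdorff_axiom HM pq.
  exists (fst @^-1` A), (fst @^-1` B); split=> //; try exact: cot_preimage_mopen.
  by rewrite -preimage_setI AB preimage_set0.
subst q; have xe : xi != eta by apply/eqP => xe; apply: zz'; rewrite xe.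
pose r := `|xi - eta| / 2; have r0 : 0 < r by rewrite divr_gt0 // normr_gt0 subr_eq0.
exists [set z | cdom (pref p) z.1 /\ ball xi r (ccomp (pref p) z.1 z.2)].
exists [set z | cdom (pref p) z.1 /\ ball eta r (ccomp (pref p) z.1 z.2)].
have pp := pref_cdom HM p.
split; try (by apply: cot_fibre_mopen; apply: ball_open).
- by rewrite /= ccomp_pref; split=> //; exact: ballxx.
- by rewrite /= ccomp_pref; split=> //; exact: ballxx.
rewrite -subset0 => w [/= [_ b1] [_ b2]].
move: b1 b2; rewrite -!ball_normE /ball_ /= => b1 b2.
have := ler_distD (ccomp (pref p) w.1 w.2) xi eta; rewrite leNgt => /negP; apply.
by rewrite (distrC _ eta) (lt_le_trans (ltrD b1 b2)) // /r -splitr.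
Qed.

(** In the maximum norm a ball around (x, eta) is a product of balls. *)
Lemma cyl_box (A : set 'rV[R]_(n + n)) (x eta : 'rV[R]_n) : open A -> A (row_mx x eta) ->
  exists r : R, 0 < r /\ forall x' eta', ball x r x' -> ball eta r eta' -> A (row_mx x' eta').
Proof.
move=> oA Ax; have nA := open_nbhs_nbhs (conj oA Ax).
have [r /= r0 rP] := (nbhs_ballP _ _).1 nA.
exists r; split=> // x' eta'; rewrite -!ball_normE /ball_ /= => b1 b2.
apply: rP; rewrite -ball_normE /ball_ /=; apply: coord_norm_lt => // j.
rewrite opp_row_mx add_row_mx; case: (split_ordP j) => k ->; rewrite ?row_mxEl ?row_mxEr.
  exact: le_lt_trans (row_coord_le _ _) b1.
exact: le_lt_trans (row_coord_le _ _) b2.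
Qed.

Lemma cot_second_countable : exists B : nat -> set (cotangent M),
  (forall k, mopen (B k)) /\
  (forall (A : set (cotangent M)) z, mopen A -> A z -> exists k, B k z /\ B k `<=` A).
Proof.
have [B [oB BP]] := second_countable_axiom HM.
(* Countably many charts suffice: one for every basic open set that lies in a chart domain. *)
have [ak akP] : exists ak : nat -> option (chart M),
    forall k a, B k `<=` cdom a -> exists2 b, ak k = Some b & B k `<=` cdom b.
  suff [ak akP] : exists ak : nat -> option (chart M), forall k, match ak k with
      | Some b => B k `<=` cdom b | None => forall a, ~ (B k `<=` cdom a) end.
    exists ak => k a Bka; have := akP k; case: (ak k) => [b Bkb|/(_ a)//].
    by exists b.
  suff H k : exists o : option (chart M), match o with
      | Some b => B k `<=` cdom b | None => forall a, ~ (B k `<=` cdom a) end.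
    by have [ak akP] := choice H; exists ak.
  have [[b Bb]|Nb] := pselect (exists b, B k `<=` cdom b); first by exists (Some b).
  by exists None => a Ba; apply: Nb; exists a.
pose I := (nat * nat * ('rV[rat]_n * nat))%type.
(* The first index selects a chart, the second shrinks the base set inside it, and the third is a
   ball in the fibre coordinates of that chart. *)
pose E (i : I) : set (cotangent M) := match ak i.1.1 with
  | Some a => (fst @^-1` (B i.1.1 `&` B i.1.2)) `&`
      [set z | cdom a z.1 /\ rat_ball i.2 (ccomp a z.1 z.2)]
  | None => set0 end.
exists (fun k => if unpickle k is Some i then E i else set0).
have o0 : mopen (set0 : set (cotangent M)).
  by move=> a; rewrite setI0 image_set0; exact: open0.
split=> [k|A z oA Az].
  case: (unpickle k) => [i|//]; rewrite /E; case: (ak _) => [a|//].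
  apply: cot_mopenI; first by apply: cot_preimage_mopen; apply: (mopenI HM).
  by apply: cot_fibre_mopen; exact: rat_ball_open.
have pz := pref_cdom HM z.1.
have [k [kz Bk]] := BP _ _ (cdom_mopen HM (pref z.1)) pz.
have [a ka Bka] := akP _ _ Bk; have az := Bka _ kz.
have Az' : (@cmap R _ (cotangent M) a @` (@cdom R _ (cotangent M) a `&` A)) (row_mx (cmap a z.1) (ccomp a z.1 z.2)) by exact: (ex_intro2 _ _ z (conj az Az) erefl).
have [r [r0 rP]] := cyl_box (oA a) Az'.
have oW : open (ball (cmap a z.1) r) by exact: ball_open.
have oO := chart_open_mopen (cmapK HM) (overlap_open HM) (transition_smooth HM) (a := a) oW.
have Oz : [set p : M | cdom a p /\ ball (cmap a z.1) r (cmap a p)] z.1.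
  by split=> //; exact: ballxx.
have [k' [kz' Bk']] := BP _ _ oO Oz.
have [i [iz iP]] := rat_ball_base (ccomp a z.1 z.2) r0.
exists (pickle ((k, k', i) : I)); rewrite pickleK /E /= ka; split; first by [].
move=> w [[_ /Bk' [aw bw]] [_ /iP cw]].
have [w' [aw' Aw'] E'] := rP _ _ bw cw.
have ww : w' = w := etrans (esym (cot_cmapK aw')) (etrans (congr1 (@cmapV R _ (cotangent M) a) E') (@cot_cmapK a w aw)).
by rewrite -ww.
Qed.

Lemma cotangent_manifold : smooth_manifold (cotangent M).
Proof.
split.
- by move=> z; exact: (pref_cdom HM z.1).
- exact: cot_cmapK.
- exact: cot_overlap_open.
- exact: cot_transition_smooth.
- exact: cot_hausdorff.
- exact: cot_second_countable.
Qed.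

End Cotangent_manifold.

Section Lin_ops.
Context {R : realType} {U V W : lmodType R}.

Lemma lin_comp (f : V -> W) (g : U -> V) : lin f -> lin g -> lin (fun u => f (g u)).
Proof. by move=> lf lg k u v; rewrite lg lf. Qed.

Lemma lin_add (f g : U -> W) : lin f -> lin g -> lin (fun u => f u + g u).
Proof. by move=> lf lg k u v; rewrite lf lg scalerDr addrACA. Qed.

End Lin_ops.

(** * Canonical coordinates under a change of chart *)

Section Cotangent_change.
Context {R : realType} {n : nat} {M : atlas R n}.
Hypothesis HM : smooth_manifold M.
Implicit Types (a b c : chart M) (p q : M).

Let C := cotangent M.
Let HC : smooth_manifold C := cotangent_manifold HM.

Definition cjac a b : 'rV[R]_(n + n) -> 'rV[R]_(n + n) -> 'rV[R]_(n + n) := @jac R (n + n) C a b.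
Definition ccoord a (z : M * 'rV[R]_n) : 'rV[R]_(n + n) := row_mx (cmap a z.1) (ccomp a z.1 z.2).

Lemma cjac_near a b z X : cdom a z.1 -> cdom b z.1 ->
  cjac a b (ccoord a z) X = 'D_X (cphi (M := M) a b) (ccoord a z).
Proof.
move=> za zb; apply: near_eq_derive.
have oU : open [set y : 'rV[R]_(n + n) | ovl a b (lsubmx y)] by apply: cyl_open; exact: (ovl_open HM).
apply: (open_near oU); first by rewrite /= row_mxKl; exact: ovlP.
by move=> y yab; rewrite -cphiE.
Qed.

Lemma cphi_diff a b z : cdom a z.1 -> cdom b z.1 -> differentiable (cphi (M := M) a b) (ccoord a z).
Proof.
move=> za zb; apply: (smooth_diff (cphi_smooth HM a b)).
by rewrite /= row_mxKl; exact: ovlP.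
Qed.

Lemma cjac_base a b z X : cdom a z.1 -> cdom b z.1 ->
  lsubmx (cjac a b (ccoord a z) X) = jac a b (cmap a z.1) (lsubmx X).
Proof.
move=> za zb; have dc := cphi_diff za zb; have dp := phi_diff HM za zb.
have dp' : differentiable (phi a b) (lsubmx (ccoord a z)) by rewrite row_mxKl.
rewrite cjac_near //; apply/rowP => j; rewrite mxE -derive_coord //.
have -> : (fun y => cphi a b y 0 (lshift n j)) = (fun y : 'rV[R]_(n + n) => phi a b (lsubmx y) 0 j).
  by apply/funext => y; rewrite /cphi row_mxEl.
rewrite derive_coord; last exact: diff_lsub_comp.
by rewrite (derive_lsub_comp X dp') row_mxKl.
Qed.

(** The derivative of the inverse Jacobian is expressed by [hess a b] through differentiating the
    identity [jac b a] after [jac a b]; evaluation on a transported vector gives the result this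
    form. *)
Lemma cjac_fibre a b z X v : cdom a z.1 -> cdom b z.1 ->
  ev (rsubmx (cjac a b (ccoord a z) X)) (jac a b (cmap a z.1) v) =
  ev (rsubmx X) v - ev (ccomp a z.1 z.2) (jac b a (cmap b z.1) (hess a b (cmap a z.1) (lsubmx X) v)).
Proof.
move=> za zb; have dc := cphi_diff za zb; have dp := phi_diff HM za zb.
set x := cmap a z.1; set eta := ccomp a z.1 z.2; set u := lsubmx X.
pose k (y : 'rV[R]_n) w := jac b a (phi a b y) w.
have kl : \forall y \near x, lin (k y).
  apply: (open_near (ovl_open HM a b) (ovlP za zb)) => _ [q [qa qb] <-].
  by rewrite /k (phi_cmap HM b qa); exact: (jac_lin HM).
have jd w : differentiable (fun y => jac b a y w) (phi a b x).
  by rewrite (phi_cmap HM b za); exact: (jac_diff HM).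
have kd w : differentiable (fun y => k y w) x by exact: (differentiable_comp dp (jd w)).
have xE : lsubmx (ccoord a z) = x by rewrite row_mxKl.
have kd' w : differentiable (fun y => k y w) (lsubmx (ccoord a z)) by rewrite xE.
have E w : ev (rsubmx (cjac a b (ccoord a z) X)) w = ev (rsubmx X) (k x w) + ev eta ('D_u (fun y => k y w) x).
  have l : lin (fun w => ev (rsubmx X) (k x w) + ev eta ('D_u (fun y => k y w) x)).
    have l1 : lin (k x) by exact: (nbhs_singleton kl).
    have l2 : lin (fun w => 'D_u (fun y => k y w) x) by exact: derive_lin_param.
    exact: (lin_add (lin_comp (ev_linr _) l1) (lin_comp (ev_linr _) l2)).
  rewrite (lin_row w l) evE; apply: eq_bigr => j _; rewrite mulrC; congr (_ * _).
  rewrite cjac_near // mxE -derive_coord //.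
  have -> : (fun y => cphi a b y 0 (rshift n j)) = (fun y : 'rV[R]_(n + n) => ev (rsubmx y) (k (lsubmx y) (delta_mx 0 j))).
    by apply/funext => y; rewrite /cphi row_mxEr mxE.
  rewrite (derive_ev X (@diff_rsub R n _) (diff_lsub_comp (kd' _))) derive_rsub.
  by rewrite (derive_lsub_comp X (kd' _)) xE row_mxKr.
have dj : differentiable (fun y => jac a b y v) x by exact: (jac_diff HM).
have E1 := @derive_lin_app_rV _ _ _ _ k (fun y => jac a b y v) x u kl (fun j => kd _) dj.
have E0 : 'D_u (fun y => k y (jac a b y v)) x = 0.
  rewrite -(derive_cst v x u); apply: near_eq_derive.
  apply: (open_near (ovl_open HM a b) (ovlP za zb)) => _ [q [qa qb] <-].
  by rewrite /k (phi_cmap HM b qa) (jac_chain HM _ qa qb qa) (jac_id HM).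
have E2 : 'D_u (fun y => k y (jac a b x v)) x = - k x ('D_u (fun y => jac a b y v) x).
  by apply/eqP; rewrite -addr_eq0; apply/eqP; exact: etrans (esym E1) E0.
have kx w : k x w = jac b a (cmap b z.1) w by rewrite /k (phi_cmap HM b za).
have kJ : k x (jac a b x v) = v by rewrite kx (jac_chain HM _ za zb za) (jac_id HM _ za).
apply: etrans (E _) _; rewrite kJ E2 kx.
by congr (_ + _); exact: (linN (ev_linr eta)).
Qed.

Lemma ev_ccomp_change a b p (xi w : 'rV[R]_n) : cdom a p -> cdom b p ->
  ev (ccomp b p xi) w = ev (ccomp a p xi) (jac b a (cmap b p) w).
Proof.
move=> pa pb; apply: etrans (ev_ccomp HM _ _ pb) (esym (etrans (ev_ccomp HM _ _ pa) _)).
have -> : jac b a (cmap b p) w = tcomp a p (tvec b p w) := esym (tcomp_tvec_jac HM w pb pa).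
by rewrite (tvec_tcomp HM _ pa).
Qed.

Section Connection_change.
Variable D : connection M.
Hypothesis tf : torsion_free D.

Lemma ricc_change a b p u v : cdom a p -> cdom b p ->
  ricc (gam D a) (cmap a p) u v = ricc (gam D b) (cmap b p) (jac a b (cmap a p) u) (jac a b (cmap a p) v).
Proof.
move=> pa pb; have Ea := Ric_loc HM tf (tvec a p u) (tvec a p v) pa.
have Eb := Ric_loc HM tf (tvec a p u) (tvec a p v) pb.
rewrite !(tcomp_tvec HM _ pa) in Ea; rewrite !(tcomp_tvec_jac HM _ pa pb) in Eb.
exact: etrans (esym Ea) Eb.
Qed.
End Connection_change.

End Cotangent_change.

Definition altl {R : realType} {n : nat} (G : 'rV[R]_n -> 'rV[R]_n -> 'rV[R]_n -> 'rV[R]_n) x u v : R :=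
  (n%:R + 1)^-1 * (2^-1 * (ricc G x u v - ricc G x v u)).

(** The first summand is the coordinate expression of minus the differential of [tau], its factor
    1/2 being that of the convention for Alt. *)
Definition om_form {R : realType} {n : nat} (G : 'rV[R]_n -> 'rV[R]_n -> 'rV[R]_n -> 'rV[R]_n)
    (y X Y : 'rV[R]_(n + n)) : R :=
  - (2^-1 * (ev (rsubmx X) (lsubmx Y) - ev (rsubmx Y) (lsubmx X)))
  + altl G (lsubmx y) (lsubmx X) (lsubmx Y).

(** * The metric and the two-form in canonical coordinates *)

Section Local_forms.
Context {R : realType} {n : nat} {M : atlas R n}.
Hypothesis HM : smooth_manifold M.
Variable D : connection M.
Hypothesis tf : torsion_free D.
Implicit Types (a b c : chart M) (p q : M).

Let C := cotangent M.
Let HC : smooth_manifold C := cotangent_manifold HM.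

Definition hl a := pw_form (gam D a) (schl (gam D a)).
Definition wl a := om_form (gam D a).

Lemma pw_change_aux (F : realFieldType) (xy yx k k' g s p q xy' yx' g' s' p' q' : F) :
  k' = k -> xy' = xy - k -> yx' = yx - k' -> g' = g - k -> s' = s -> p' = p -> q' = q ->
  2^-1 * (xy + yx) + (- g - s - p * q) = 2^-1 * (xy' + yx') + (- g' - s' - p' * q').
Proof. by move=> -> -> -> -> -> -> ->; lra. Qed.

Lemma om_change_aux (F : realFieldType) (xy yx k k' s xy' yx' s' : F) :
  k' = k -> xy' = xy - k -> yx' = yx - k' -> s' = s ->
  - (2^-1 * (xy - yx)) + s = - (2^-1 * (xy' - yx')) + s'.
Proof. by move=> -> -> -> ->; lra. Qed.

Lemma schl_change a b p u v : cdom a p -> cdom b p ->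
  schl (gam D b) (cmap b p) (jac a b (cmap a p) u) (jac a b (cmap a p) v) = schl (gam D a) (cmap a p) u v.
Proof.
move=> pa pb; have e1 := ricc_change HM tf u v pa pb; have e2 := ricc_change HM tf v u pa pb.
exact: esym (f_equal2 (fun r s : R => (n%:R - 1)^-1 * (2^-1 * (r + s))) e1 e2).
Qed.

Lemma altl_change a b p u v : cdom a p -> cdom b p ->
  altl (gam D b) (cmap b p) (jac a b (cmap a p) u) (jac a b (cmap a p) v) = altl (gam D a) (cmap a p) u v.
Proof.
move=> pa pb; have e1 := ricc_change HM tf u v pa pb; have e2 := ricc_change HM tf v u pa pb.
exact: esym (f_equal2 (fun r s : R => (n%:R + 1)^-1 * (2^-1 * (r - s))) e1 e2).
Qed.

Lemma ccoord_l a (z : M * 'rV[R]_n) : lsubmx (ccoord a z) = cmap a z.1.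
Proof. exact: row_mxKl. Qed.

Lemma ccoord_r a (z : M * 'rV[R]_n) : rsubmx (ccoord a z) = ccomp a z.1 z.2.
Proof. exact: row_mxKr. Qed.

Lemma pw_formE F S (y X Y : 'rV[R]_(n + n)) (x xi u v : 'rV[R]_n) :
  lsubmx y = x -> rsubmx y = xi -> lsubmx X = u -> lsubmx Y = v ->
  pw_form F S y X Y = 2^-1 * (ev (rsubmx X) v + ev (rsubmx Y) u)
    + (- ev xi (F x u v) - S x u v - ev xi u * ev xi v).
Proof. by move=> <- <- <- <-. Qed.

Lemma om_formE F (y X Y : 'rV[R]_(n + n)) (x u v : 'rV[R]_n) :
  lsubmx y = x -> lsubmx X = u -> lsubmx Y = v ->
  om_form F y X Y = - (2^-1 * (ev (rsubmx X) v - ev (rsubmx Y) u)) + altl F x u v.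
Proof. by move=> <- <- <-. Qed.

(** The Hessian enters both halves of the pairing through [cjac_fibre] and the Christoffel term
    through [gam_phi]; being symmetric, it cancels. *)
Lemma hl_cot_change a b (z : M * 'rV[R]_n) X Y : cdom a z.1 -> cdom b z.1 ->
  hl a (ccoord a z) X Y = hl b (ccoord b z) (cjac a b (ccoord a z) X) (cjac a b (ccoord a z) Y).
Proof.
move=> za zb; set u := lsubmx X; set v := lsubmx Y.
apply: etrans (pw_formE _ _ (ccoord_l a z) (ccoord_r a z) (erefl u) (erefl v)) (etrans _ (esym
  (pw_formE _ _ (ccoord_l b z) (ccoord_r b z) (cjac_base HM X za zb) (cjac_base HM Y za zb)))).
have ev_J w : ev (ccomp b z.1 z.2) (jac a b (cmap a z.1) w) = ev (ccomp a z.1 z.2) w.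
  apply: etrans (ev_ccomp_change HM _ _ za zb) _.
  exact: (congr1 (ev _) (etrans (jac_chain HM w za zb za) (jac_id HM w za))).
apply: (pw_change_aux _ (cjac_fibre HM X v za zb) (cjac_fibre HM Y u za zb) _ (schl_change _ _ za zb) (ev_J u) (ev_J v)).
  exact: (congr1 (fun w => ev _ (jac b a _ w)) (hess_sym HM _ _ za zb)).
have gE : gam D b (cmap b z.1) (jac a b (cmap a z.1) u) (jac a b (cmap a z.1) v) =
    jac a b (cmap a z.1) (gam D a (cmap a z.1) u v) - hess a b (cmap a z.1) u v.
  by apply/eqP; rewrite eq_sym subr_eq addrC; apply/eqP; exact: (gam_phi HM D u v za zb).
rewrite gE; apply: etrans (linB (ev_linr _) _ _) _.
exact: (f_equal2 (fun r s : R => r - s) (ev_J _) (ev_ccomp_change HM _ _ za zb)).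
Qed.

(** Here the two Hessian terms have opposite signs and cancel by symmetry. *)
Lemma wl_cot_change a b (z : M * 'rV[R]_n) X Y : cdom a z.1 -> cdom b z.1 ->
  wl a (ccoord a z) X Y = wl b (ccoord b z) (cjac a b (ccoord a z) X) (cjac a b (ccoord a z) Y).
Proof.
move=> za zb; set u := lsubmx X; set v := lsubmx Y.
apply: etrans (om_formE _ (ccoord_l a z) (erefl u) (erefl v)) (etrans _ (esym
  (om_formE _ (ccoord_l b z) (cjac_base HM X za zb) (cjac_base HM Y za zb)))).
apply: (om_change_aux _ (cjac_fibre HM X v za zb) (cjac_fibre HM Y u za zb) (altl_change _ _ za zb)).
exact: (congr1 (fun w => ev _ (jac b a _ w)) (hess_sym HM _ _ za zb)).
Qed.

Lemma Sym2_schouten a p u v : cdom a p ->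
  Sym2 (schouten D) p u v = schl (gam D a) (cmap a p) (tcomp a p u) (tcomp a p v).
Proof.
move=> pa; rewrite /Sym2 /schouten /Sym2 /Alt2 !(Ric_loc HM tf _ _ pa) /schl.
move: (ricc _ _ _ _) (ricc _ _ _ _) ((n%:R - 1)^-1) ((n%:R + 1)^-1) => r s c d.
lra.
Qed.

Lemma Alt2_schouten a p u v : cdom a p ->
  Alt2 (schouten D) p u v = altl (gam D a) (cmap a p) (tcomp a p u) (tcomp a p v).
Proof.
move=> pa; rewrite /Alt2 /schouten /Sym2 /Alt2 !(Ric_loc HM tf _ _ pa) /altl.
move: (ricc _ _ _ _) (ricc _ _ _ _) ((n%:R - 1)^-1) ((n%:R + 1)^-1) => r s c d.
lra.
Qed.

(** A covector and its base point share their preferred chart, in which [nu] is the projection to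
    the base coordinates. *)
Lemma tangent_map_nu (z : C) X : tangent_map (@nu R n M) z X = lsubmx X.
Proof.
have pz := pref_cdom HM z.1; set a := pref z.1 in pz *.
have nE : \forall y \near ccoord a z, lsubmx y = (@cmap R n M a \o @nu R n M \o @cmapV R _ C a) y.
  have oU : open [set y : 'rV[R]_(n + n) | im a (lsubmx y)] by apply: cyl_open; exact: (im_open HM).
  apply: (open_near oU); first by rewrite /= row_mxKl; exact: imP.
  by move=> y /= /(cmapVP HM)[_ ->].
have dl := @diff_lsub R n (ccoord a z).
have df := near_eq_diff nE dl.
rewrite /tangent_map -[LHS]/('d (@cmap R n M a \o @nu R n M \o @cmapV R _ C a) (ccoord a z) X).
rewrite -deriveE // -(near_eq_derive X nE).
exact: derive_of_lin (@lsubmx_lin R n).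
Qed.

Lemma pullback2_nu (b : tensor2 M) (z : C) X Y : pullback2 (@nu R n M) b z X Y = b z.1 (lsubmx X) (lsubmx Y).
Proof. by rewrite /pullback2 !tangent_map_nu. Qed.

Lemma tauE (z : C) X : tau z X = ev z.2 (lsubmx X).
Proof. by rewrite /tau tangent_map_nu. Qed.

Lemma christoffel_ev a p (xi w : 'rV[R]_n) i : cdom a p ->
  \sum_(j < n) \sum_(k < n) christoffel D a p i j k * xi 0 k * w 0 j =
  ev xi (gam D a (cmap a p) (delta_mx 0 i) w).
Proof.
move=> pa; have l : lin (fun w => ev xi (gam D a (cmap a p) (delta_mx 0 i) w)).
  exact: lin_comp (ev_linr _) (gam_linr HM D _ pa).
rewrite (lin_row w l); apply: eq_bigr => j _; rewrite -mulr_suml mulrC; congr (_ * _).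
rewrite evE; apply: eq_bigr => k _.
have ce : gam D a (cmap a p) (delta_mx 0 i) (delta_mx 0 j) 0 k = christoffel D a p i j k.
  by rewrite /gam (cmapK HM pa).
exact: etrans (mulrC _ _) (congr1 ( *%R (xi 0 k)) (esym ce)).
Qed.

Lemma patterson_walkerE (z : C) X Y : let a := pref z.1 in
  patterson_walker D z X Y = 2^-1 * (ev (rsubmx X) (lsubmx Y) + ev (rsubmx Y) (lsubmx X))
   - ev z.2 (gam D a (cmap a z.1) (lsubmx X) (lsubmx Y)).
Proof.
move=> a; have pz : cdom a z.1 := pref_cdom HM z.1.
have tc W : @tcomp R _ C a z W = W := tcomp_pref HC z W.
pose s W i : R := rsubmx W 0 i - ev z.2 (gam D a (cmap a z.1) (delta_mx 0 i) (lsubmx W)).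
transitivity (\sum_i 2^-1 * (s X i * lsubmx Y 0 i + s Y i * lsubmx X 0 i)).
  apply: eq_bigr => i _; rewrite /odot /Sym2 /tens /dx /dxi !tc.
  rewrite (eq_bigr (fun j => \sum_(k < n) christoffel D a z.1 i j k * z.2 0 k * lsubmx X 0 j)); last first.
    by move=> j _; apply: eq_bigr => k _; rewrite (ccomp_pref HM).
  rewrite [X in _ + (_ - X) * _](eq_bigr (fun j => \sum_(k < n) christoffel D a z.1 i j k * z.2 0 k * lsubmx Y 0 j)); last first.
    by move=> j _; apply: eq_bigr => k _; rewrite (ccomp_pref HM).
  by rewrite !christoffel_ev.
have S W (w : 'rV[R]_n) : \sum_i s W i * w 0 i = ev (rsubmx W) w - ev z.2 (gam D a (cmap a z.1) w (lsubmx W)).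
  have l : lin (fun w => ev z.2 (gam D a (cmap a z.1) w (lsubmx W))).
    exact: lin_comp (ev_linr _) (gam_linl HM D _ pz).
  rewrite evE (lin_row w l) -sumrB; apply: eq_bigr => i _.
  by rewrite /s mulrBl [w 0 i *: _]mulrC.
rewrite -mulr_sumr big_split /= !S (gam_sym HM (lsubmx Y) _ tf pz).
move: (ev _ _) (ev _ _) (ev _ _) => r1 r2 r3; lra.
Qed.

Lemma einstein_cot_pref (z : C) X Y : let a := pref z.1 in
  einstein_cot D z X Y = hl a (ccoord a z) X Y.
Proof.
move=> a; have pz : cdom a z.1 := pref_cdom HM z.1.
rewrite /einstein_cot patterson_walkerE pullback2_nu (Sym2_schouten _ _ pz) /tens !tauE.
rewrite /hl /pw_form /wform !ccoord_l !ccoord_r !(tcomp_pref HM) !(ccomp_pref HM).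
by rewrite -!addrA.
Qed.

Lemma tcomp_cjac a (z : C) X : cdom a z.1 ->
  @tcomp R _ C a z X = cjac (pref z.1) a (ccoord (pref z.1) z) X.
Proof. by move=> za; apply: (tcompE HC). Qed.

Lemma einstein_cot_loc a (z : C) X Y : cdom a z.1 -> einstein_cot D z X Y =
  hl a (ccoord a z) (@tcomp R _ C a z X) (@tcomp R _ C a z Y).
Proof.
move=> za; have pz := pref_cdom HM z.1.
by rewrite einstein_cot_pref (hl_cot_change X Y pz za) -!tcomp_cjac.
Qed.

Lemma tau_tvec a (z : C) v : cdom a z.1 -> tau z (@tvec R _ C a z v) = ev (ccomp a z.1 z.2) (lsubmx v).
Proof.
move=> za; have pz := pref_cdom HM z.1.
have -> : @tvec R _ C a z v = cjac a (pref z.1) (ccoord a z) v by exact: (tvecE HC).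
rewrite tauE (cjac_base HM _ za pz) -(tvecE HM _ za).
by rewrite -(ev_ccomp HM _ _ za).
Qed.

(** The extensions of X and Y are coordinate fields, which commute. On such a field [tau] is xi
    paired with a constant vector, so its derivative involves only the fibre part of the
    direction. *)
Lemma extd1_tau (z : C) X Y : extd1 (@tau R n M) z X Y =
  2^-1 * (ev (rsubmx X) (lsubmx Y) - ev (rsubmx Y) (lsubmx X)).
Proof.
have pz := pref_cdom HM z.1.
have br : bracket (extend z X) (extend z Y) z = 0 by exact: (bracket_tvec HC).
have E v w : vder (fun q : C => tau q (extend z v q)) z w = ev (rsubmx w) (lsubmx v).
  rewrite /vder -(derive_rsub (ccoord (pref z.1) z)) -(derive_ev_cst (lsubmx v) w (@diff_rsub R n _)).
  apply: near_eq_derive.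
  have oU : open [set y : 'rV[R]_(n + n) | im (pref z.1) (lsubmx y)] by apply: cyl_open; exact: (im_open HM).
  apply: (open_near oU); first by rewrite /= row_mxKl; exact: imP.
  move=> y yI; have yI' : @im R _ C (pref z.1) y by rewrite /im cot_im.
  have [ya yE] := cmapVP HC yI'.
  apply: etrans (tau_tvec v ya) _.
  exact: (congr1 (fun w => ev w (lsubmx v)) (etrans (esym (ccoord_r _ _)) (congr1 rsubmx yE))).
have ez v : extend z v z = v by exact: (tvec_pref HC).
by rewrite /extd1 br tauE (lin0 (@lsubmx_lin R n)) (lin0 (ev_linr _)) subr0 !E !ez.
Qed.

Lemma Omega_cot_pref (z : C) X Y : let a := pref z.1 in
  Omega_cot D z X Y = wl a (ccoord a z) X Y.
Proof.
move=> a; have pz : cdom a z.1 := pref_cdom HM z.1.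
rewrite /Omega_cot extd1_tau pullback2_nu (Alt2_schouten _ _ pz).
by rewrite /wl /om_form !ccoord_l !(tcomp_pref HM).
Qed.

Lemma Omega_cot_loc a (z : C) X Y : cdom a z.1 -> Omega_cot D z X Y =
  wl a (ccoord a z) (@tcomp R _ C a z X) (@tcomp R _ C a z Y).
Proof.
move=> za; have pz := pref_cdom HM z.1.
by rewrite Omega_cot_pref (wl_cot_change X Y pz za) -!tcomp_cjac.
Qed.

End Local_forms.

(** * Einstein and para-Kaehler structure *)

Section Ricci_bilinear.
Context {R : realType} {n : nat}.
Variables (U : set 'rV[R]_n) (G : 'rV[R]_n -> 'rV[R]_n -> 'rV[R]_n -> 'rV[R]_n).
Hypotheses (oU : open U) (lG : local_connection U G).

Lemma trc_lin (f : 'rV[R]_n -> 'rV[R]_n -> 'rV[R]_n) : (forall z, lin (fun u => f u z)) ->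
  lin (fun u => trc (f u)).
Proof.
move=> lf k u v; rewrite /trc scaler_sumr -big_split; apply: eq_bigr => j _ /=.
by rewrite lf !mxE.
Qed.

Lemma lin_opp (V W : lmodType R) (f : V -> W) : lin f -> lin (fun u => - f u).
Proof. by move=> lf k u v; rewrite lf opprD scalerN. Qed.

Lemma lc_near_lin x u : U x -> \forall y \near x, lin (G y u).
Proof. by move=> Ux; apply: (open_near oU Ux) => y Uy; exact: (lc_lin lG). Qed.

Lemma lc_near_linl x v : U x -> \forall y \near x, lin (G y ^~ v).
Proof. by move=> Ux; apply: (open_near oU Ux) => y Uy; exact: (lc_linl _ lG). Qed.

Lemma ricc_bilin x : U x -> bilin (ricc G x).
Proof.
move=> Ux; have d u v := lc_diff u v lG Ux.
have p w u : lin (fun v => 'D_w (fun y => G y u v) x) := derive_lin_param w (lc_near_lin u Ux) (d u).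
have pl w v : lin (fun u => 'D_w (fun y => G y u v) x).
  exact: (derive_lin_param w (lc_near_linl v Ux) (fun u => d u v)).
have q z v : lin (fun u => 'D_u (fun y => G y z v) x) := derive_dir_lin (d z v).
have g u : lin (G x u) := lc_lin lG u Ux.
have gl v : lin (G x ^~ v) := lc_linl v lG Ux.
split=> [u|v]; apply: trc_lin => z.
  exact: (lin_add (lin_add (lin_add (p z u) (lin_opp (p u z))) (lin_comp (g z) (g u))) (lin_opp (lin_comp (g u) (g z)))).
exact: (lin_add (lin_add (lin_add (pl z v) (lin_opp (q z v))) (lin_comp (g z) (gl v))) (lin_opp (gl _))).
Qed.

Lemma bilin_comb (b : 'rV[R]_n -> 'rV[R]_n -> R) (c d : R) : bilin b ->
  bilin (fun u v => c * (2^-1 * (b u v + d * b v u))).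
Proof.
move=> [b1 b2]; split=> [u k v w|v k u w].
  rewrite b1 b2 -![_ *: _]/(_ * _); ring.
rewrite b1 b2 -![_ *: _]/(_ * _); ring.
Qed.

Lemma schl_bilin x : U x -> bilin (schl G x).
Proof.
move=> Ux; have := bilin_comb (n%:R - 1)^-1 1 (ricc_bilin Ux).
by rewrite (_ : (fun u v => _) = schl G x) //; apply/funext => u; apply/funext => v; rewrite mul1r.
Qed.

Lemma altl_bilin x : U x -> bilin (altl G x).
Proof.
move=> Ux; have := bilin_comb (n%:R + 1)^-1 (-1) (ricc_bilin Ux).
by rewrite (_ : (fun u v => _) = altl G x) //; apply/funext => u; apply/funext => v; rewrite mulN1r.
Qed.

Lemma schl_sym x u v : schl G x u v = schl G x v u.
Proof. by rewrite /schl [ricc G x u v + _]addrC. Qed.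

Lemma altl_skew x u v : altl G x u v = - altl G x v u.
Proof. by rewrite /altl -mulrN -mulrN opprB. Qed.

Lemma schl_smooth u v : smooth U (fun x => schl G x u v).
Proof.
have s := ricc_smooth oU lG.
exact: (smoothZ _ oU (smoothZ _ oU (smoothD oU (s u v) (s v u)))).
Qed.

Lemma altl_smooth u v : smooth U (fun x => altl G x u v).
Proof.
have s := ricc_smooth oU lG.
exact: (smoothZ _ oU (smoothZ _ oU (smoothB oU (s u v) (s v u)))).
Qed.

Lemma cyc_aux (F : comPzRingType) (c p q r : F) : c * (p - q) + c * (q - r) + c * (r - p) = 0.
Proof. by ring. Qed.

(** Passes from the Christoffel terms of the glued connection to their explicit formula, the two
    being known to agree only on chart images. *)
Lemma ricc_eq G' x u v : U x -> (forall y u v, U y -> G' y u v = G y u v) ->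
  ricc G' x u v = ricc G x u v.
Proof.
move=> Ux GG; apply: eq_trc => z.
have E w w' w'' : 'D_w (fun y => G' y w' w'') x = 'D_w (fun y => G y w' w'') x.
  by apply: near_eq_derive; apply: (open_near oU Ux) => y Uy; exact: GG.
have F w w' := GG x w w' Ux.
by rewrite /curvc (E z u v) (E u z v) (F u v) (F z v) (F z) (F u).
Qed.

(* By the Bianchi identity the alternating part of the Ricci tensor is, up to a factor, the differential of the one-form tr G. *)
Lemma altl_closed x u v w : U x ->
  'D_u (fun y => altl G y v w) x + 'D_v (fun y => altl G y w u) x + 'D_w (fun y => altl G y u v) x = 0.
Proof.
move=> Ux; pose t (q y : 'rV[R]_n) : R := trc (G y q).
have st q : smooth U (t q).
  exact: (smooth_sum (index_enum 'I_n) oU (fun k => smooth_coord k oU (lc_smooth lG q (delta_mx 0 k)))).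
have dd p q : differentiable ('D_p (t q)) x by exact: (smooth_diff (smooth_D p (st q)) Ux).
pose c : R := (n%:R + 1)^-1 * 2^-1.
have E p q r : 'D_p (fun y => altl G y q r) x = c * ('D_p ('D_r (t q)) x - 'D_p ('D_q (t r)) x).
  have dB : differentiable (fun y => 'D_r (t q) y - 'D_q (t r) y) x by exact: (diff_sub (dd r q) (dd q r)).
  apply: etrans (etrans (derive_scale c p dB) (congr1 ( *%R c) (derive_sub p (dd r q) (dd q r)))).
  apply: near_eq_derive; apply: (open_near oU Ux) => y Uy.
  by rewrite /altl (ricc_alt_expand oU lG) // !(dtrE lG) // mulrA.
have sw p q r : 'D_p ('D_q (t r)) x = 'D_q ('D_p (t r)) x := schwarz p q oU Ux (st r).
rewrite !E (sw w u) (sw v u) (sw w v).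
exact: cyc_aux.
Qed.

End Ricci_bilinear.

Lemma extd2_aux (F : realFieldType) (v1 v2 v3 b1 b2 b3 d1 d2 d3 xy xz yx yz zx zy xz' yx' zy' : F) :
  v1 = d1 + xy + xz' -> v2 = d2 + yz + yx' -> v3 = d3 + zx + zy' ->
  b1 = xy - yx -> b2 = yz - zy -> b3 = zx - xz ->
  xz' = - xz -> yx' = - yx -> zy' = - zy -> d1 + d2 + d3 = 0 ->
  3^-1 * (v1 + v2 + v3 - b1 - b2 - b3) = 0.
Proof. by move=> -> -> -> -> -> -> -> -> -> d; lra. Qed.

Section Tensor_of_loc.
Context {R : realType} {n : nat} {N : atlas R n}.
Hypothesis HN : smooth_manifold N.
Variables (h : tensor2 N) (hl : chart N -> 'rV[R]_n -> 'rV[R]_n -> 'rV[R]_n -> R).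
Implicit Types (a : chart N) (p : N).
Hypothesis h_loc : forall a p u v, cdom a p -> h p u v = hl a (cmap a p) (tcomp a p u) (tcomp a p v).
Hypothesis hl_bilin : forall a x, im a x -> bilin (hl a x).
Hypothesis hl_smooth : forall a u v, smooth (im a) (fun x => hl a x u v).

Lemma smooth_tensor2_of_loc : smooth_tensor2 h.
Proof.
have pref_loc p u v : h p u v = hl (pref p) (cmap (pref p) p) u v.
  by rewrite (h_loc _ _ (pref_cdom HN p)) !(tcomp_pref HN).
split=> [p u k v w|p v k u w|a i j].
- by rewrite !pref_loc (hl_bilin (imP (pref_cdom HN p))).1.
- by rewrite !pref_loc (hl_bilin (imP (pref_cdom HN p))).2.
apply: (smooth_eq (im_open HN a) _ (hl_smooth a (delta_mx 0 i) (delta_mx 0 j))) => _ [p pa <-].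
by rewrite /= (cmapK HN pa) (h_loc _ _ pa) /dd !(tcomp_tvec HN _ pa).
Qed.

Hypothesis hl_skew : forall a x u v, im a x -> hl a x u v = - hl a x v u.
Hypothesis hl_closed : forall a x u v w, im a x ->
  'D_u (fun y => hl a y v w) x + 'D_v (fun y => hl a y w u) x + 'D_w (fun y => hl a y u v) x = 0.

(** Derivatives of the fields cancel against the brackets by skewness, so closedness on constant
    components suffices. *)
Lemma extd2_closed p X Y Z : smooth_vf_near p X -> smooth_vf_near p Y -> smooth_vf_near p Z ->
  extd2 h X Y Z p = 0.
Proof.
move=> sX sY sZ; have pp := pref_cdom HN p; set a := pref p in pp.
have xI := imP pp; set x := cmap a p in xI.
have nb : \forall z \near x, bilin (hl a z).
  by apply: (open_near (im_open HN _) xI) => z; exact: hl_bilin.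
have dh u1 v1 : differentiable (fun z => hl a z u1 v1) x by exact: (smooth_diff (hl_smooth _ u1 v1) xI).
have D1 (A B : vfield N) w : smooth_vf_near p A -> smooth_vf_near p B ->
  vder (fun q => h q (A q) (B q)) p w = 'D_w (fun y => hl a y (A p) (B p)) x
   + hl a x ('D_w (vloc a A) x) (B p) + hl a x (A p) ('D_w (vloc a B) x).
  move=> sA sB; have dA := vloc_diff HN pp sA; have dB := vloc_diff HN pp sB.
  rewrite /vder (_ : 'D_w _ _ = 'D_w (fun x => hl a x (vloc a A x) (vloc a B x)) x); last first.
    apply: near_eq_derive; apply: (open_near (im_open HN _) xI) => _ [q qp <-].
    by rewrite /= (cmapK HN qp) (h_loc _ _ qp) !(vloc_cmap HN _ qp).
  by rewrite (bil_app_derive w nb dh dA dB) !(vloc_cmap HN _ pp) !(tcomp_pref HN).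
have D2 (A B E : vfield N) : h p (bracket A B p) (E p) =
    hl a x ('D_(A p) (vloc a B) x) (E p) - hl a x ('D_(B p) (vloc a A) x) (E p).
  rewrite (h_loc _ _ pp) !(tcomp_pref HN) bracket_pref.
  exact: (linB ((hl_bilin xI).2 (E p))).
have sk u v := hl_skew u v xI.
exact: (extd2_aux (D1 Y Z (X p) sY sZ) (D1 Z X (Y p) sZ sX) (D1 X Y (Z p) sX sY)
  (D2 X Y Z) (D2 Y Z X) (D2 Z X Y) (sk (Y p) _) (sk (Z p) _) (sk (X p) _) (hl_closed (X p) (Y p) (Z p) xI)).
Qed.

End Tensor_of_loc.

Section Einstein.
Context {R : realType} {n : nat} {M : atlas R n}.
Hypothesis n2 : (2 <= n)%N.
Hypothesis HM : smooth_manifold M.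
Variable D : connection M.
Hypothesis tf : torsion_free D.
Implicit Types (a : chart M) (p : M).

Let C := cotangent M.
Let HC : smooth_manifold C := cotangent_manifold HM.
Let G a := gam D a.
Let lG a : local_connection (im a) (G a) := gam_lc HM tf a.
Let Sb a x (xI : im a x) : bilin (schl (G a) x) := schl_bilin (im_open HM a) (lG a) xI.
Let Ss a x u v (xI : im a x) : schl (G a) x u v = schl (G a) x v u := schl_sym (G a) x u v.
Let Sm a u v : smooth (im a) (fun x => schl (G a) x u v) := schl_smooth (im_open HM a) (lG a) u v.

Let imC a (y : 'rV[R]_(n + n)) : @im R _ C a y -> im a (lsubmx y).
Proof. by rewrite /im cot_im. Qed.

Let imCE a : @im R _ C a = [set y | im a (lsubmx y)].
Proof. by rewrite /im cot_im. Qed.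

Let ccoord_im a (z : C) : cdom a z.1 -> im a (lsubmx (ccoord a z)).
Proof. by move=> za; rewrite ccoord_l; exact: imP. Qed.

Lemma cot_hl_smooth a X Y : smooth (@im R _ C a) (fun y => hl D a y X Y).
Proof. by rewrite imCE; exact: (pw_form_smooth (im_open HM a) (lG a) (@Sm a)). Qed.

Lemma cot_hl_bilin a y : @im R _ C a y -> bilin (hl D a y).
Proof. by move=> /imC yI; exact: (pw_form_bilin (lG a) (Sb (a:=a)) (Ss (a:=a)) yI). Qed.

Lemma einstein_cot_smooth : smooth_tensor2 (einstein_cot D).
Proof.
apply: (@smooth_tensor2_of_loc _ _ C HC _ (fun a => hl D a)).
- by move=> a z X Y za; exact: (einstein_cot_loc HM tf).
- exact: cot_hl_bilin.
- exact: cot_hl_smooth.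
Qed.

Lemma einstein_cot_sym z X Y : einstein_cot D z X Y = einstein_cot D z Y X.
Proof.
rewrite !(einstein_cot_pref HM tf).
exact: (pw_form_sym (lG _) (Ss (a := pref z.1)) X Y (ccoord_im (pref_cdom HM z.1))).
Qed.

Lemma einstein_cot_nondeg : nondegenerate2 (einstein_cot D).
Proof.
move=> z X H; apply: (pw_form_nondeg (lG _) (Sb (a := pref z.1)) (ccoord_im (pref_cdom HM z.1))) => Y.
exact: etrans (esym (einstein_cot_pref HM tf z X Y)) (H Y).
Qed.

Lemma einstein_cot_pseudo_riemannian : pseudo_riemannian (einstein_cot D).
Proof.
split; [exact: HC | exact: einstein_cot_smooth | exact: einstein_cot_sym | exact: einstein_cot_nondeg].
Qed.

Lemma cot_pw_conn_lc (a : chart C) : local_connection (@im R _ C a) (pw_conn (G a) (schl (G a))).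
Proof. by rewrite imCE; exact: (pw_conn_lc (im_open HM a) (lG a) (Sb (a:=a)) (Ss (a:=a)) (@Sm a)). Qed.

Lemma einstein_cot_einstein : einstein (einstein_cot D).
Proof.
split; first exact: einstein_cot_pseudo_riemannian.
have h1 (a : chart C) (z : C) X Y (za : cdom a z) := einstein_cot_loc HM tf X Y za.
have h2 (a : chart C) y X Y : im a y -> hl D a y X Y = hl D a y Y X.
  by move=> /imC yI; exact: (pw_form_sym (lG a) (Ss (a:=a)) X Y yI).
have h3 (a : chart C) y X : im a y -> (forall Y, hl D a y X Y = 0) -> X = 0.
  by move=> /imC yI; exact: (pw_form_nondeg (lG a) (Sb (a:=a)) yI).
have h4 (a : chart C) y X Y Z : im a y -> 'D_Z (fun y => hl D a y X Y) y =
    hl D a y (pw_conn (G a) (schl (G a)) y Z X) Y + hl D a y X (pw_conn (G a) (schl (G a)) y Z Y).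
  by move=> /imC yI; exact: (pw_conn_metric (im_open HM a) (lG a) (Sb (a:=a)) (Ss (a:=a)) (@Sm a) X Y Z yI).
pose E := @lc_connection R _ C HC _ (fun a => hl D a) (fun a => pw_conn (G a) (schl (G a))) h1 cot_hl_bilin h2
  cot_hl_smooth h3 cot_pw_conn_lc h4.
have lE : levi_civita E (einstein_cot D) := lc_connection_levi_civita HC h1 cot_hl_bilin h2
  cot_hl_smooth h3 cot_pw_conn_lc h4.
exists E; split=> //; exists (- (2 * (n%:R + 1))) => z X Y.
have zp : @cdom R _ C (pref z.1) z := pref_cdom HM z.1.
rewrite (Ric_loc HC lE.1 X Y zp) (einstein_cot_loc HM tf X Y zp).
have zI : @im R _ C (pref z.1) (ccoord (pref z.1) z) by exact: (@imP R _ C).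
apply: etrans (ricc_eq (im_open HC _) _ _ zI _) _; last first.
  apply: (ricc_pw_conn (im_open HM _) (lG _) (Sb (a := pref z.1)) (Ss (a := pref z.1)) (@Sm _) n2) => //.
  exact: imC.
move=> y X' Y' yI; have [ya yE] := cmapVP HC yI.
by rewrite -yE; exact: gam_lc_connection.
Qed.

End Einstein.

Lemma om_skew_aux (F : comPzRingType) (h p q s : F) : - (h * (p - q)) + - s = - (- (h * (q - p)) + s).
Proof. by ring. Qed.

(** * The symplectic form, the signature and the endomorphism I *)

Section Para_Kaehler.
Context {R : realType} {n : nat} {M : atlas R n}.
Hypothesis n2 : (2 <= n)%N.
Hypothesis HM : smooth_manifold M.
Variable D : connection M.
Hypothesis tf : torsion_free D.
Implicit Types (a : chart M) (p : M).

Let C := cotangent M.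
Let HC : smooth_manifold C := cotangent_manifold HM.
Let G a := gam D a.
Let lG a : local_connection (im a) (G a) := gam_lc HM tf a.

Let imCE a : @im R _ C a = [set y | im a (lsubmx y)].
Proof. by rewrite /im cot_im. Qed.

Let ccoord_im a (z : C) : cdom a z.1 -> im a (lsubmx (ccoord a z)).
Proof. by move=> za; rewrite ccoord_l; exact: imP. Qed.

Lemma om_form_bilin a y : im a (lsubmx y) -> bilin (wl D a y).
Proof.
move=> yI; have [b1 b2] := altl_bilin (im_open HM a) (lG a) yI.
split=> [X k Y Z|Y k X Z]; rewrite /wl /om_form lsubmx_lin rsubmx_lin ev_linr ev_linl ?b1 ?b2;
  rewrite -![_ *: _]/(_ * _); ring.
Qed.

Lemma om_form_skew a y X Y : wl D a y X Y = - wl D a y Y X.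
Proof.
by rewrite /wl /om_form (altl_skew (gam D a) _ (lsubmx X)); exact: om_skew_aux.
Qed.

Lemma om_form_smooth a X Y : smooth (@im R _ C a) (fun y => wl D a y X Y).
Proof.
rewrite imCE; have oU : open [set y : 'rV[R]_(n + n) | im a (lsubmx y)] by apply: cyl_open; exact: (im_open HM).
apply: smoothD => //; first exact: smooth_cst.
have sl := smooth_lin oU (@lsubmx_lin R n).
exact: (smooth_comp oU sl (altl_smooth (im_open HM a) (lG a) (lsubmx X) (lsubmx Y))).
Qed.

Lemma om_form_closed a y X Y Z : im a (lsubmx y) ->
  'D_X (fun y => wl D a y Y Z) y + 'D_Y (fun y => wl D a y Z X) y + 'D_Z (fun y => wl D a y X Y) y = 0.
Proof.
move=> yI.
have E W X' Y' : 'D_W (fun y => wl D a y X' Y') y = 'D_(lsubmx W) (fun x => altl (G a) x (lsubmx X') (lsubmx Y')) (lsubmx y).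
  have dA := smooth_diff (altl_smooth (im_open HM a) (lG a) (lsubmx X') (lsubmx Y')) yI.
  have dl := diff_lsub_comp dA.
  have dc : differentiable (fun _ : 'rV[R]_(n + n) => - (2^-1 * (ev (rsubmx X') (lsubmx Y') - ev (rsubmx Y') (lsubmx X')))) y by [].
  by apply: etrans (derive_add W dc dl) _; rewrite derive_cst add0r (derive_lsub_comp W dA).
rewrite !E; exact: (altl_closed (im_open HM a) (lG a) _ _ _ yI).
Qed.

Lemma Omega_cot_nondeg : nondegenerate2 (Omega_cot D).
Proof.
move=> z X H; set a := pref z.1; have zI := ccoord_im (pref_cdom HM z.1).
have {}H Y : wl D a (ccoord a z) X Y = 0 by rewrite -(Omega_cot_pref HM tf).
have [b1 b2] := altl_bilin (im_open HM a) (lG a) zI.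
have half0 (r : R) : 2^-1 * r = 0 -> r = 0.
  by move/eqP; rewrite mulf_eq0 invr_eq0 pnatr_eq0 /= => /eqP.
have l0 : lsubmx X = 0.
  apply/rowP => k; rewrite [in RHS]mxE -ev_delta.
  have := H (row_mx 0 (delta_mx 0 k)); rewrite /wl /om_form row_mxKl row_mxKr.
  rewrite (lin0 (ev_linr _)) (lin0 (b1 _)) addr0 sub0r mulrN opprK; exact: half0.
have r0 : rsubmx X = 0.
  apply/rowP => k; rewrite [in RHS]mxE -ev_deltar.
  have := H (row_mx (delta_mx 0 k) 0); rewrite /wl /om_form row_mxKl row_mxKr l0.
  rewrite (lin0 (ev_linr _)) (lin0 (b2 _)) subr0 addr0 => /eqP; rewrite oppr_eq0 => /eqP; exact: half0.
by rewrite -(hsubmxK X) l0 r0 row_mx0.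
Qed.

Lemma Omega_cot_symplectic : symplectic (Omega_cot D).
Proof.
have w_loc (a : chart C) (z : C) X Y (za : cdom a z) := Omega_cot_loc HM tf X Y za.
have wb (a : chart C) y : im a y -> bilin (wl D a y) by rewrite imCE; exact: om_form_bilin.
split.
- by apply: (smooth_tensor2_of_loc HC w_loc wb); exact: om_form_smooth.
- by move=> z X Y; rewrite !(Omega_cot_pref HM tf) om_form_skew.
- exact: Omega_cot_nondeg.
move=> z X Y Z; apply: (extd2_closed HC w_loc wb (@om_form_smooth)).
- by move=> a y X' Y' _; exact: om_form_skew.
- by move=> a y X' Y' Z'; rewrite imCE; exact: om_form_closed.
Qed.

Lemma einstein_cot_neutral : neutral_signature (einstein_cot D).
Proof.
move=> z; set a := pref z.1; have zI := ccoord_im (pref_cdom HM z.1).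
pose y := ccoord a z; pose e (k : 'I_n) : 'rV[R]_n := delta_mx 0 k.
pose A : 'M[R]_n := \matrix_(i, j) wform (G a) (schl (G a)) y (e i) (e j).
have As i j : A i j = A j i.
  by rewrite !mxE; apply: (wform_sym (lG a)) zI => x u v _; exact: schl_sym.
(* The vectors (e_i, - A e_i) span a null subspace; adding e_i or - e_i in the fibre gives the two halves. *)
pose B : 'M[R]_(n + n) := block_mx 1%:M (1%:M - A) 1%:M (- 1%:M - A).
exists B; split.
  (* The inverse of B: half the sum of its block rows is (1, - A) and half their difference is (0,
     1), from which the unit rows are recovered. *)
  pose X : 'M[R]_(n + n) := block_mx (2^-1 *: (1%:M + A)) (2^-1 *: (1%:M - A)) (2^-1 *: 1%:M) (- (2^-1 *: 1%:M)).
  suff BX : B *m X = 1%:M by have [] := mulmx1_unit BX.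
  rewrite mulmx_block !mul1mx !mulmxN -!scalemxAr !mulmx1 [RHS]scalar_mx_block.
  congr block_mx; apply/matrixP => i j; move: A {As B X} => A; rewrite !mxE; move: (A i j) (_ == _) => r c; case: c => /=; lra.
have rl i : row (lshift n i) B = row_mx (e i) (row i (1%:M - A)) by rewrite /B rowKu row_row_mx row1.
have rr i : row (rshift n i) B = row_mx (e i) (row i (- 1%:M - A)) by rewrite /B rowKd row_row_mx row1.
have H i j (r s : 'rV[R]_n) : einstein_cot D z (row_mx (e i) r) (row_mx (e j) s) = 2^-1 * (r 0 j + s 0 i) + A i j.
  rewrite (einstein_cot_pref HM tf) /hl /pw_form !row_mxKl !row_mxKr !ev_deltar.
  by rewrite [A i j]mxE.
have d i j : (1%:M : 'M[R]_n) i j = (1%:M : 'M[R]_n) j i by rewrite !mxE eq_sym.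
have eP i j : row i (1%:M - A) 0 j = (1%:M : 'M[R]_n) i j - A i j by rewrite 2![in LHS]mxE [(- A) i j]mxE.
have eN i j : row i (- 1%:M - A) 0 j = - (1%:M : 'M[R]_n) i j - A i j.
  by rewrite 2![in LHS]mxE [(- A) i j]mxE [(- 1%:M) i j]mxE.
apply/matrixP => i j; rewrite mxE.
case: (split_ordP i) => i' ->; case: (split_ordP j) => j' ->;
  rewrite ?rl ?rr H ?eP ?eN (As j' i') (d j' i') ?(block_mxEul, block_mxEur, block_mxEdl, block_mxEdr);
  move: (A i' j') => x.
- by move: (1%:M i' j') => w; lra.
- by rewrite [RHS]mxE; move: (1%:M i' j') => w; lra.
- by rewrite [RHS]mxE; move: (1%:M i' j') => w; lra.
by rewrite [RHS]mxE; move: (1%:M i' j') => w; lra.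
Qed.

Lemma para_aux (F : realFieldType) (xy yx w s : F) :
  - (2^-1 * (xy - yx)) + s = 2^-1 * (- xy + (2 * (w + s) + yx)) - w.
Proof. by field. Qed.

(** Matrices act on rows from the right, so I sends (v, b) to (- v, 2 v K + b) and squares to the
    identity for every K. The relation between Omega and h dictates K: its pairing must cancel
    [wform] and add the alternating Schouten part. *)
Lemma para_complex_structure : exists I : C -> 'M[R]_(n + n),
  (forall z X Y, Omega_cot D z X Y = einstein_cot D z X (Y *m I z)) /\
  (forall z, I z *m I z = 1%:M).
Proof.
pose e (k : 'I_n) : 'rV[R]_n := delta_mx 0 k.
pose K (z : C) : 'M[R]_n := let a := pref z.1 in let y := ccoord a z in
  \matrix_(j, k) (wform (G a) (schl (G a)) y (e k) (e j) + altl (G a) (lsubmx y) (e k) (e j)).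
exists (fun z => block_mx (- 1%:M) (2 *: K z) 0 1%:M); split=> z; last first.
  rewrite mulmx_block !mulNmx !mulmx1 !mul1mx !mulmx0 !mul0mx !addr0 !add0r opprK.
  by rewrite addNr -scalar_mx_block.
move=> X Y; set a := pref z.1; have zI := ccoord_im (pref_cdom HM z.1).
rewrite (Omega_cot_pref HM tf) (einstein_cot_pref HM tf) -{2}(hsubmxK Y) mul_row_block.
rewrite mulmxN !mulmx1 mulmx0 addr0.
set u := lsubmx X; set v := lsubmx Y.
have wb : bilin (wform (G a) (schl (G a)) (ccoord a z)).
  by apply: (wform_bilin (lG a)) zI => x xI; exact: (schl_bilin (im_open HM a) (lG a) xI).
have ab := altl_bilin (im_open HM a) (lG a) zI.
have KE : ev (v *m K z) u = wform (G a) (schl (G a)) (ccoord a z) u v + altl (G a) (lsubmx (ccoord a z)) u v.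
  have l1 : lin (fun u => wform (G a) (schl (G a)) (ccoord a z) u v + altl (G a) (lsubmx (ccoord a z)) u v).
    exact: (lin_add (wb.2 v) (ab.2 v)).
  rewrite evE (lin_row u l1); apply: eq_bigr => k _; rewrite mulrC; congr (_ * _).
  have l2 : lin (fun v => wform (G a) (schl (G a)) (ccoord a z) (e k) v + altl (G a) (lsubmx (ccoord a z)) (e k) v).
    exact: (lin_add (wb.1 (e k)) (ab.1 (e k))).
  rewrite (lin_row v l2) [LHS]mxE; apply: eq_bigr => j _; congr (_ * _).
  by rewrite [LHS]mxE.
have wN : wform (G a) (schl (G a)) (ccoord a z) u (- v) = - wform (G a) (schl (G a)) (ccoord a z) u v := linN (wb.1 u) v.
have e1 : ev (rsubmx X) (- v) = - ev (rsubmx X) v := linN (ev_linr _) v.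
have e2 : ev (v *m (2 *: K z) + rsubmx Y) u = 2 * ev (v *m K z) u + ev (rsubmx Y) u.
  by rewrite -scalemxAr; exact: ev_linl.
apply: etrans (para_aux _ _ (wform (G a) (schl (G a)) (ccoord a z) u v) _) (esym _).
apply: etrans (pw_formE _ _ (erefl (lsubmx (ccoord a z))) (erefl (rsubmx (ccoord a z))) (erefl u) (row_mxKl _ _)) _.
by rewrite row_mxKr e1 e2 KE -wN.
Qed.

Lemma einstein_cot_almost_para_kaehler : almost_para_kaehler (einstein_cot D) (Omega_cot D).
Proof.
split.
- exact: einstein_cot_pseudo_riemannian.
- exact: einstein_cot_neutral.
- exact: Omega_cot_symplectic.
- exact: para_complex_structure.
Qed.

End Para_Kaehler.

(** * Isometry *)

Section Fibre_translation.
Context {R : realType} {n : nat} {M : atlas R n}.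
Hypothesis HM : smooth_manifold M.
Implicit Types (a b : chart M) (p : M).

Let C := cotangent M.
Let HC : smooth_manifold C := cotangent_manifold HM.

Definition fibre_shift (t : M -> 'rV[R]_n) (z : C) : C := (z.1, z.2 + t z.1).

Variables (t : M -> 'rV[R]_n) (tl : chart M -> 'rV[R]_n -> 'rV[R]_n).
Hypotheses (tE : forall a p, cdom a p -> ccomp a p (t p) = tl a (cmap a p))
  (ts : forall a, smooth (im a) (tl a)).

Let T a (y : 'rV[R]_(n + n)) : 'rV[R]_(n + n) := y + row_mx 0 (tl a (lsubmx y)).

Lemma row_mx_linr : lin (fun w : 'rV[R]_n => row_mx (0 : 'rV[R]_n) w).
Proof. by move=> k u v; rewrite scale_row_mx add_row_mx scaler0 addr0. Qed.

Lemma ccoord_fibre_shift a (z : C) : cdom a z.1 ->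
  ccoord a (fibre_shift t z) = ccoord a z + row_mx 0 (tl a (cmap a z.1)).
Proof.
move=> za; rewrite add_row_mx addr0 /ccoord /= -tE //; congr row_mx.
by apply: ev_ext => v; rewrite (linD (ev_linl v)) !(ev_ccomp HM _ _ za) (linD (ev_linl _)).
Qed.

Let T_smooth a (U : set 'rV[R]_n) : open U -> U `<=` im a -> smooth [set y | U (lsubmx y)] (T a).
Proof.
move=> oU Ua; have oUU := cyl_open oU.
apply: smoothD_rV => //; first exact: smooth_id.
have sl := smooth_lin oUU (@lsubmx_lin R n).
have s1 := smooth_comp_rV oUU (im_open HM a) sl (@ts a) (fun y yU => Ua _ yU).
exact: (smooth_comp_rV oUU openT s1 (smooth_lin openT row_mx_linr) (fun _ _ => I)).
Qed.

Let TE a (z : C) : cdom a z.1 -> T a (ccoord a z) = ccoord a (fibre_shift t z).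
Proof. by move=> za; rewrite ccoord_fibre_shift // /T ccoord_l. Qed.

Lemma fibre_shift_smooth : smooth_map (fibre_shift t).
Proof.
move=> a b.
have E : @cmap R _ C a @` (@cdom R _ C a `&` (fibre_shift t @^-1` @cdom R _ C b)) =
    [set y : 'rV[R]_(n + n) | @ovl R n M a b (lsubmx y)] by exact: (cot_ovl HM a b).
have oU : open [set y : 'rV[R]_(n + n) | @ovl R n M a b (lsubmx y)] by apply: cyl_open; exact: (ovl_open HM).
have sT : smooth [set y : 'rV[R]_(n + n) | @ovl R n M a b (lsubmx y)] (T a).
  by apply: T_smooth; [exact: (ovl_open HM) | move=> _ [q [qa _] <-]; exact: imP].
rewrite E; split=> //.
have sc := smooth_comp_rV oU oU sT (cphi_smooth HM a b).
have zE y : [set y : 'rV[R]_(n + n) | @ovl R n M a b (lsubmx y)] y ->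
    exists z : C, [/\ @cdom R n M a z.1, @cdom R n M b z.1 & @cmap R _ C a z = y].
  by rewrite -E => -[z [za zb] zy]; exists z.
apply: (smooth_eq oU _ (sc _)) => y /zE[z [za zb <-]]; last first.
  have o : @ovl R n M a b (lsubmx (@ccoord R n M a (fibre_shift t z))) by rewrite ccoord_l; exact: ovlP.
  by rewrite (TE za).
have fa : @cdom R _ C a (fibre_shift t z) by [].
have Ez : fibre_shift t (@cmapV R _ C a (@cmap R _ C a z)) = fibre_shift t z := congr1 _ (cot_cmapK HM za).
transitivity (@cmap R _ C b (fibre_shift t z)); last exact: (congr1 (@cmap R _ C b) (esym Ez)).
have Ef := congr1 (@cmap R _ C b) (cot_cmapK HM fa).
apply: etrans Ef; rewrite (TE za) -(cphiE HM) // ccoord_l; exact: ovlP.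
Qed.

Lemma tangent_map_fibre_shift (z : C) X : tangent_map (fibre_shift t) z X =
  row_mx (lsubmx X) (rsubmx X + 'D_(lsubmx X) (tl (pref z.1)) (cmap (pref z.1) z.1)).
Proof.
have pz := pref_cdom HM z.1; set a := pref z.1 in pz *.
have oU : open [set y : 'rV[R]_(n + n) | im a (lsubmx y)] by apply: cyl_open; exact: (im_open HM).
have zU : [set y : 'rV[R]_(n + n) | im a (lsubmx y)] (ccoord a z) by rewrite /= ccoord_l; exact: imP.
have nE : \forall y \near ccoord a z, T a y = (@cmap R _ C a \o fibre_shift t \o @cmapV R _ C a) y.
  apply: (open_near oU zU) => y; rewrite -(cot_im HM a) => -[w wa <-].
  have Ew : fibre_shift t (@cmapV R _ C a (@cmap R _ C a w)) = fibre_shift t w := congr1 _ (cot_cmapK HM wa).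
  transitivity (@cmap R _ C a (fibre_shift t w)); first exact: TE.
  exact: (congr1 (@cmap R _ C a) (esym Ew)).
have dT : differentiable (T a) (ccoord a z).
  by apply: (smooth_diff (T_smooth (im_open HM a) _)) zU.
have df := near_eq_diff nE dT.
rewrite /tangent_map -[LHS]/('d (@cmap R _ C a \o fibre_shift t \o @cmapV R _ C a) (ccoord a z) X).
rewrite -deriveE // -(near_eq_derive X nE).
have dt : differentiable (tl a) (lsubmx (ccoord a z)) by apply: (smooth_diff (@ts a)); rewrite ccoord_l; exact: imP.
have dg := diff_lsub_comp dt; have dr := diff_of_lin (tl a (lsubmx (ccoord a z))) row_mx_linr.
apply: etrans (derive_add X (diff_id _) (differentiable_comp dg dr)) _.
rewrite derive_id (derive_chain X dg dr) (derive_of_lin _ _ row_mx_linr) (derive_lsub_comp X dt) ccoord_l.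
by rewrite -{1}(hsubmxK X) add_row_mx addr0.
Qed.

End Fibre_translation.

Lemma double_inj (F : realFieldType) (r s : F) : r + r = s + s -> r = s.
Proof. by lra. Qed.

Section Projective.
Context {R : realType} {n : nat} {M : atlas R n}.
Hypothesis n2 : (2 <= n)%N.
Hypothesis HM : smooth_manifold M.
Variables D D' : connection M.
Hypotheses (tf : torsion_free D) (tf' : torsion_free D').
Hypothesis DD' : geodesics_in D D'.
Implicit Types (a b : chart M) (p : M).

Let B a x u v := gam D' a x u v - gam D a x u v.

Definition proj_form a x : 'rV[R]_n := weyl_form (fun u v => gam D' a x u v - gam D a x u v).
Local Notation ups := proj_form.

Lemma gam_projective a p u v : cdom a p -> B a (cmap a p) u v =
  ev (ups a (cmap a p)) v *: u + ev (ups a (cmap a p)) u *: v.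
Proof.
move=> pa; apply: (@weyl R n (B a (cmap a p))).
- by move=> w k u' v'; rewrite /B (gam_linr HM D' _ pa) (gam_linr HM D _ pa) scalerBr opprD addrACA.
- by move=> u' v'; rewrite /B (gam_sym HM _ _ tf' pa) (gam_sym HM _ _ tf pa).
by move=> w; exact: (geodesics_dir HM w tf tf' DD' pa).
Qed.

Lemma proj_form_smooth a : smooth (im a) (ups a).
Proof.
have oa := im_open HM a; apply: smooth_rV => // k.
have s := smoothZ 2^-1 oa (smoothB oa (smooth_coord k oa (gam_smooth HM D' a (delta_mx 0 k) (delta_mx 0 k)))
  (smooth_coord k oa (gam_smooth HM D a (delta_mx 0 k) (delta_mx 0 k)))).
apply: (smooth_eq oa _ s) => x _; rewrite /ups /weyl_form [RHS]mxE; congr (_ * _).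
by rewrite [RHS]mxE; congr (_ + _); rewrite [RHS]mxE.
Qed.

(** Both Christoffel terms have the same Hessian term, so their difference is a tensor. *)
Lemma gam_diff_change a b p u v : cdom a p -> cdom b p ->
  B b (cmap b p) (jac a b (cmap a p) u) (jac a b (cmap a p) v) = jac a b (cmap a p) (B a (cmap a p) u v).
Proof.
move=> pa pb; apply: esym; apply: etrans (linB (jac_lin HM pa pb) _ _) _.
rewrite (gam_phi HM D' _ _ pa pb) (gam_phi HM D _ _ pa pb); exact: subr_add2l.
Qed.

(** The formula of [weyl_form] is tied to a basis. Chart independence comes instead from B(v, v) = 2
    ups(v) v, an identity between tensors that determines ups(v) when v is nonzero. *)
Lemma proj_form_change a b p v : cdom a p -> cdom b p ->
  ev (ups b (cmap b p)) (jac a b (cmap a p) v) = ev (ups a (cmap a p)) v.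
Proof.
move=> pa pb; have lJ := jac_lin HM pa pb.
have Ea := etrans (gam_projective v v pa) (esym (scalerDl v _ _)).
have Eb := etrans (gam_projective (jac a b (cmap a p) v) (jac a b (cmap a p) v) pb) (esym (scalerDl _ _ _)).
have E := etrans (esym Eb) (etrans (gam_diff_change v v pa pb) (etrans (congr1 _ Ea) (linZ lJ _ _))).
have [vz|v0] := eqVneq v 0.
  have J0 : jac a b (cmap a p) v = 0 := etrans (congr1 _ vz) (lin0 lJ).
  apply: etrans (congr1 (ev _) J0) (etrans (lin0 (ev_linr _)) (esym _)).
  exact: etrans (congr1 (ev _) vz) (lin0 (ev_linr _)).
have J0 : jac a b (cmap a p) v != 0.
  apply: contra_neq v0 => Jv.
  apply: etrans (esym (etrans (jac_chain HM v pa pb pa) (jac_id HM v pa))) _.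
  exact: etrans (congr1 _ Jv) (lin0 (jac_lin HM pb pa)).
have [k Jk] := rV0Pn _ J0.
have Ek := congr1 (fun w : 'rV[R]_n => w 0 k) E; rewrite [LHS]mxE [RHS]mxE in Ek.
exact: double_inj (mulIf Jk Ek).
Qed.

Definition proj_covector p : 'rV[R]_n := ups (pref p) (cmap (pref p) p).

Lemma ccomp_proj_covector a p : cdom a p -> ccomp a p (proj_covector p) = ups a (cmap a p).
Proof.
move=> pa; apply: ev_ext => v; rewrite (ev_ccomp HM _ _ pa) (tvecE HM _ pa).
exact: (proj_form_change v pa (pref_cdom HM p)).
Qed.

Lemma ccomp_opp_proj_covector a p : cdom a p -> ccomp a p (- proj_covector p) = - ups a (cmap a p).
Proof.
move=> pa; rewrite -ccomp_proj_covector //; apply: ev_ext => v.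
by rewrite (linN (ev_linl _)) !(ev_ccomp HM _ _ pa) (linN (ev_linl _)).
Qed.

(** A fibre translation keeps the base point and hence the preferred chart, so a covector and its
    image are read in the same canonical coordinates and [pw_form_projective] applies directly. *)
Lemma einstein_cot_isometric : isometric (einstein_cot D) (einstein_cot D').
Proof.
pose tN a x := - ups a x.
have cN a p : cdom a p -> ccomp a p (- proj_covector p) = tN a (cmap a p) by exact: ccomp_opp_proj_covector.
have sN a : smooth (im a) (tN a).
  have lN : lin (fun x : 'rV[R]_n => - x) by move=> k u v; rewrite opprD scalerN.
  have sO : smooth [set: 'rV[R]_n] (fun x : 'rV[R]_n => - x) := smooth_lin openT lN.
  exact: (smooth_comp_rV (im_open HM a) openT (@proj_form_smooth a) sO).
exists (fibre_shift (fun p => - proj_covector p)), (fibre_shift proj_covector); split.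
- exact: (fibre_shift_smooth HM cN sN).
- exact: (fibre_shift_smooth HM ccomp_proj_covector proj_form_smooth).
- by case=> p xi; rewrite /fibre_shift /= subrK.
- by case=> p xi; rewrite /fibre_shift /= addrK.
move=> z X Y; rewrite /pullback2 !(einstein_cot_pref HM) //.
have pz := pref_cdom HM z.1.
set a := pref z.1 in pz *.
have dU : differentiable (ups a) (cmap a z.1) by apply: (smooth_diff (@proj_form_smooth a)); exact: imP.
have tm W : tangent_map (fibre_shift (fun p => - proj_covector p)) z W =
    row_mx (lsubmx W) (rsubmx W - 'D_(lsubmx W) (ups a) (cmap a z.1)).
  apply: etrans (tangent_map_fibre_shift HM cN sN z W) _.
  exact: (congr1 (fun d => row_mx (lsubmx W) (rsubmx W + d)) (derive_opp (lsubmx W) dU)).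
have cf : @ccoord R n M a (fibre_shift (fun p => - proj_covector p) z) =
    row_mx (cmap a z.1) (ccomp a z.1 z.2 - ups a (cmap a z.1)).
  apply: etrans (ccoord_fibre_shift HM cN pz) _.
  exact: etrans (add_row_mx _ _ _ _) (congr1 (fun x => row_mx x _) (addr0 _)).
apply: etrans (_ : _ = hl D' a (row_mx (cmap a z.1) (ccomp a z.1 z.2 - ups a (cmap a z.1))) _ _) _; last first.
  exact: esym (f_equal3 (fun y => hl D' a y) cf (tm X) (tm Y)).
rewrite -{1}(hsubmxK X) -{1}(hsubmxK Y).
apply: (pw_form_projective (im_open HM a) (gam_lc HM tf a) (gam_lc HM tf' a) (@proj_form_smooth a)) => //.
  move=> x u v xI; have [xa <-] := cmapVP HM xI.
  have := gam_projective u v xa; rewrite /shift_by -addrA => <-.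
  by rewrite /B addrC subrK.
exact: imP.
Qed.

End Projective.

Theorem proposition1p1 (R : realType) (n : nat) (n_ge2 : (2 <= n)%N)
    (M : atlas R n) (M_manifold : smooth_manifold M) :
  (forall D : connection M, torsion_free D ->
     einstein (einstein_cot D) /\
     almost_para_kaehler (einstein_cot D) (Omega_cot D)) /\
  (forall D D' : connection M, torsion_free D -> torsion_free D' ->
     projectively_equivalent D D' ->
     isometric (einstein_cot D) (einstein_cot D')).
Proof.
split=> [D tf|D D' tf tf' [DD' _]].
  split; first exact: einstein_cot_einstein.
  exact: einstein_cot_almost_para_kaehler.
exact: einstein_cot_isometric.
Qed.
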